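(* Let $\{(\lambda_j,w_j):1\le j\le N\}$ be a solvable Pick problem in $\mathbb G$ and let $\mathcal S\subset\mathbb G$ be its uniqueness set. Then there is an algebraic variety $\mathcal W\subset\mathbb C^2$ such that $\mathcal S=\mathbb G\cap\mathcal W$.
   Context: $\mathbb D$ is the open unit disk and $\mathbb G=\{(z_1+z_2,z_1z_2):z_1,z_2\in\mathbb D\}\subset\mathbb C^2$ is the symmetrized bidisk. A Pick problem in $\mathbb G$ is a data set $\{(\lambda_j,w_j):1\le j\le N\}$ with distinct $\lambda_j\in\mathbb G$ and $w_j\in\mathbb D$; it is solvable if there is an analytic $f:\mathbb G\to\mathbb D$ with $f(\lambda_j)=w_j$ for all $j$ (a solution). The uniqueness set of a solvable problem is the largest subset of $\mathbb G$ on which all the solutions agree. An algebraic variety is the common zero set of a collection of polynomials (the whole of $\mathbb C^2$ is allowed). *)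

(* Defs.v *)
From mathcomp Require Import all_boot all_order all_algebra polyXY.
From mathcomp Require Import all_classical all_reals all_analysis.
From mathcomp Require Import complex.

Set Implicit Arguments.
Unset Strict Implicit.
Unset Printing Implicit Defensive.

Import Order.TTheory GRing.Theory Num.Theory.
Import numFieldNormedType.Exports.
Local Open Scope classical_set_scope.
Local Open Scope ring_scope.

(* The alias [^o] makes the complex field [R[i]] a normed space over itself. *)
Notation CC R := (R[i]%C^o).
Notation CC2 R := (CC R * CC R)%type.

Definition disk (R : realType) : set (CC R) := [set z | `|z| < 1].
Arguments disk : clear implicits.

Definition symmetrized_bidisk (R : realType) : set (CC2 R) :=
  [set z | exists z1 z2 : CC R,
     [/\ disk R z1, disk R z2 & z = (z1 + z2, z1 * z2)]].
Arguments symmetrized_bidisk : clear implicits.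

(* [differentiable] is Frechet differentiability over the base field of the
   normed spaces, here [R[i]]: for open [U] this is analyticity on [U].  The
   values of [f] outside [U] are irrelevant. *)
Definition analytic_on (R : realType) (U : set (CC2 R)) (f : CC2 R -> CC R) :=
  forall z, U z -> differentiable f z.

Definition pick_problem (R : realType) (N : nat)
    (lambda : 'I_N -> CC2 R) (w : 'I_N -> CC R) :=
  [/\ injective lambda,
      forall j, symmetrized_bidisk R (lambda j) &
      forall j, disk R (w j)].

Definition pick_solution (R : realType) (N : nat)
    (lambda : 'I_N -> CC2 R) (w : 'I_N -> CC R) (f : CC2 R -> CC R) :=
  [/\ analytic_on (symmetrized_bidisk R) f,
      forall z, symmetrized_bidisk R z -> disk R (f z) &
      forall j, f (lambda j) = w j].

Definition pick_solvable (R : realType) (N : nat)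
    (lambda : 'I_N -> CC2 R) (w : 'I_N -> CC R) :=
  exists f, pick_solution lambda w f.

Definition solutions_agree_on (R : realType) (N : nat)
    (lambda : 'I_N -> CC2 R) (w : 'I_N -> CC R) (T : set (CC2 R)) :=
  forall f g, pick_solution lambda w f -> pick_solution lambda w g ->
    forall z, T z -> f z = g z.

Definition is_uniqueness_set (R : realType) (N : nat)
    (lambda : 'I_N -> CC2 R) (w : 'I_N -> CC R) (S : set (CC2 R)) :=
  [/\ S `<=` symmetrized_bidisk R,
      solutions_agree_on lambda w S &
      forall T, T `<=` symmetrized_bidisk R -> solutions_agree_on lambda w T ->
        T `<=` S].

Lemma uniqueness_setP (R : realType) (N : nat)
    (lambda : 'I_N -> CC2 R) (w : 'I_N -> CC R) (S : set (CC2 R)) :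
  is_uniqueness_set lambda w S <->
  S = [set z | symmetrized_bidisk R z /\
         forall f g, pick_solution lambda w f -> pick_solution lambda w g ->
           f z = g z].
Proof.
split=> [[SG Sa Smax]|->].
  apply/seteqP; split=> [z Sz|z [Gz az]].
    by split; [exact: SG|move=> f g sf sg; exact: Sa].
  apply: (Smax [set z]) => // [_ ->//|f g sf sg _ ->]; exact: az.
split=> [z []//|f g sf sg z [_]|T TG Ta z Tz]; first exact.
by split; [exact: TG|move=> f g sf sg; exact: Ta].
Qed.

(* [p.[x, y]] evaluates the outer indeterminate of [p] at [x] and the inner one
   at [y].  Taking [P] empty gives the whole plane. *)
Definition algebraic_variety (R : realType) (W : set (CC2 R)) :=
  exists P : set {poly {poly R[i]%C}},
    W = [set z | forall p, P p -> p.[z.1, z.2] = 0].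

(* Main.v *)
(** A solution [f] is pulled back to the bidisk as [F (z1, z2) = f (z1 + z2, z1 z2)].
    On any finite set of points [F] has an Agler decomposition: Ando's inequality
    [|p(T1, T2)| <= sup |p|] extends from polynomials to [F] by Cauchy-Taylor
    approximation, and says that the residual of the best approximation of
    [1 - F F^*] in the cone of Agler kernels is zero.  The decomposition is an equality
    of two Gram matrices, hence a unitary carries one family of vectors to the other;
    its transfer function is a rational function that maps the bidisk to the disk and
    takes the values of [F] at the points.  Averaged over the swap of the variables, it
    descends to a rational solution [a / b] on the symmetrized bidisk.  So if two
    solutions differ at [z0], some rational solutions [a1 / b1] and [a2 / b2] differ at
    [z0] too, and the polynomial [a1 b2 - a2 b1] vanishes on the uniqueness set but not
    at [z0]. *)
Require Import Defs.
From HB Require Import structures.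
From mathcomp Require Import all_boot all_order all_algebra all_solvable all_field.
From mathcomp Require Import spectral sesquilinear polyXY.
From mathcomp Require Import all_classical all_reals all_analysis.
From mathcomp Require Import complex.
From mathcomp Require Import ring lra zify.

Set Implicit Arguments.
Unset Strict Implicit.
Unset Printing Implicit Defensive.

Import Order.TTheory GRing.Theory Num.Theory.
Import numFieldNormedType.Exports.
Local Open Scope classical_set_scope.
Local Open Scope ring_scope.
Local Open Scope sesquilinear_scope.

Local Notation Re := complex.Re.
Local Notation Im := complex.Im.

(** To separate [S] from one point [z0], a solution has to be replaced by a rational one with the
    same values at the [N] nodes and at [z0] only; finite matrices suffice and no limit of solutions
    is taken. The residual meets Ando's inequality through duality: minus its conjugate is a
    hermitian form that does not grow under multiplication by either coordinate, and these two
    multiplications are commuting contractions for it. Ando's dilation lives on infinite sequences;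
    in place of a Hilbert norm these carry increasing truncated seminorms, and a polynomial in the
    two dilations is estimated on a finite cyclic group, with an error that averaging removes.
    Solutions are only complex differentiable, so Taylor approximation rests on Goursat's argument,
    run in polar coordinates because the contour is a circle. Values must stay in the open disk: for
    the transfer function this follows from an energy identity and one node whose value has modulus
    less than one, in place of the maximum principle. *)

(** * Gram matrices *)

Section GramMatrices.
Variable C : numClosedFieldType.

Definition sqnorm n (v : 'rV[C]_n) : C := \sum_i `|v 0 i| ^+ 2.

Definition qform n (A : 'M[C]_n) (v : 'rV[C]_n) : C := (v *m A *m v^t*) 0 0.

Lemma adjmxM m n p (A : 'M[C]_(m, n)) (B : 'M[C]_(n, p)) :
  (A *m B)^t* = B^t* *m A^t*.
Proof. by rewrite trmx_mul map_mxM. Qed.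

Lemma sqnormE n (v : 'rV[C]_n) : sqnorm v = (v *m v^t*) 0 0.
Proof. by rewrite mxE; apply: eq_bigr => i _; rewrite !mxE normCK. Qed.

Lemma sqnorm_ge0 n (v : 'rV[C]_n) : 0 <= sqnorm v.
Proof. by apply: sumr_ge0 => i _; rewrite exprn_ge0. Qed.

Lemma sqnorm_eq0 n (v : 'rV[C]_n) : sqnorm v = 0 -> v = 0.
Proof.
move=> v0; apply/rowP => i; rewrite mxE; apply/eqP.
have /eqP := v0; rewrite psumr_eq0; last by move=> j _; rewrite exprn_ge0.
by move=> /allP/(_ i (mem_index_enum _)) /=; rewrite expf_eq0 /= normr_eq0.
Qed.

Lemma sqnorm_row_mx m n (u : 'rV[C]_m) (v : 'rV[C]_n) :
  sqnorm (row_mx u v) = sqnorm u + sqnorm v.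
Proof.
rewrite /sqnorm big_split_ord /=; congr (_ + _); apply: eq_bigr => i _.
  by rewrite row_mxEl.
by rewrite row_mxEr.
Qed.

Lemma sqnorm_unitary n (X : 'M[C]_n) (v : 'rV[C]_n) :
  X \is unitarymx -> sqnorm (v *m X) = sqnorm v.
Proof.
by move=> Xu; rewrite !sqnormE adjmxM mulmxA mulmxtVK.
Qed.

Lemma qform_mulmxt n (G : 'M[C]_n) (v : 'rV[C]_n) :
  qform (G *m G^t*) v = sqnorm (v *m G).
Proof. by rewrite /qform sqnormE adjmxM !mulmxA. Qed.

(** Spectral decomposition [A = P^* D P]: the form at the rows of [P] shows [D >= 0], and [G] is
    [P^*] times the square root of [D]. *)
Lemma psd_factor n (A : 'M[C]_n) : A^t* = A ->
  (forall v : 'rV[C]_n, 0 <= qform A v) -> exists G : 'M[C]_n, A = G *m G^t*.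
Proof.
move=> Ah Apos.
have /orthomx_spectralP As : A \is normalmx by apply/normalmxP; rewrite Ah.
set P := spectralmx A in As; set D := spectral_diag A in As.
have Pu : P \is unitarymx := spectral_unitarymx A.
rewrite invmx_unitary // in As.
have Dpos i : 0 <= D 0 i.
  have := Apos (row i P).
  have -> : row i P = delta_mx 0 i *m P by rewrite -rowE.
  rewrite /qform {1}As !mulmxA !adjmxM !mulmxA.
  rewrite (mulmxtVK _ Pu) (mulmxtVK _ Pu).
  rewrite -rowE mxE (bigD1 i) //= big1 ?addr0 => [|j ji].
    by rewrite !mxE !eqxx mulr1n conjC1 mulr1.
  by rewrite !mxE (negPf ji) andbF conjC0 mulr0.
pose E := \row_i sqrtC (D 0 i).
exists (P^t* *m diag_mx E).
rewrite adjmxM trmxCK !mulmxA {1}As; congr (_ *m _).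
rewrite -!mulmxA; congr (_ *m _).
rewrite tr_diag_mx map_diag_mx mulmx_diag; congr diag_mx.
apply/rowP => i; rewrite !mxE.
by rewrite -normCK ger0_norm ?sqrtC_ge0 // sqrtCK.
Qed.

Lemma gram_eq0 m n (A : 'M[C]_(m, n)) : A *m A^t* = 0 -> A = 0.
Proof.
move=> A0; apply/row_matrixP => i; rewrite row0; apply: sqnorm_eq0.
have /matrixP/(_ i i) := A0; rewrite !mxE => A0i; rewrite -[RHS]A0i.
by apply: eq_bigr => j _; rewrite !mxE normCK.
Qed.

Lemma castmx_unitary p n (U : 'M[C]_(p, n)) (e : p = n) : U *m U^t* = 1%:M ->
  castmx (e, erefl n) U \is unitarymx.
Proof. by case: _ / e U => U UU; rewrite castmx_id; apply/unitarymxP. Qed.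

Lemma mulmx_castmx m p n (V : 'M[C]_(m, p)) (U : 'M[C]_(p, n)) (e : p = n) :
  V *m U = castmx (erefl m, e) V *m castmx (e, erefl n) U.
Proof. by case: _ / e U => U; rewrite !castmx_id. Qed.

(* An orthonormal basis of the row space of [R] is [L *m R]; equality of the
   Gram matrices makes [L *m S] orthonormal too, and both families are completed
   to unitary matrices. *)
Lemma gram_unitary m n (R S : 'M[C]_(m, n)) : R *m R^t* = S *m S^t* ->
  exists2 X : 'M[C]_n, X \is unitarymx & R *m X = S.
Proof.
move=> RS.
pose k := \rank R; pose B := schmidt (row_base R).
have Bu : B \is unitarymx by rewrite schmidt_unitarymx ?rank_leq_col.
have BR : (B :=: R)%MS.
  exact: eqmx_trans (eqmx_schmidt_free (row_base_free _)) (eq_row_base _).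
have /submxP [L BL] : (B <= R)%MS by rewrite BR.
have /submxP [M RM] : (R <= B)%MS by rewrite BR.
pose B' := L *m S.
have Bu' : B' \is unitarymx.
  apply/unitarymxP; have -> : B' *m B'^t* = B *m B^t*.
    rewrite BL /B' !adjmxM !mulmxA -[L *m S *m _]mulmxA -RS.
    by rewrite mulmxA.
  exact/unitarymxP.
(* [L] and [M] come from [R] alone, but equal Gram matrices mean equal linear relations between
   rows: [(1 - M L) R = 0] makes the Gram matrix of [(1 - M L) S] vanish. *)
have SM : S = M *m B'.
  apply/eqP; rewrite -subr_eq0; apply/eqP.
  have -> : S - M *m B' = (1%:M - M *m L) *m S.
    by rewrite mulmxBl mul1mx mulmxA.
  apply: gram_eq0; rewrite adjmxM !mulmxA -[_ *m S *m _]mulmxA -RS.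
  have -> : (1%:M - M *m L) *m (R *m R^t*) = 0.
    by rewrite mulmxA mulmxBl mul1mx -(mulmxA M) -BL -RM subrr mul0mx.
  by rewrite mul0mx.
(* The missing [n - k] rows are an orthonormal basis of the orthogonal complement of the row space
   of [A]. *)
have ext (A : 'M[C]_(k, n)) : A \is unitarymx ->
    exists2 U : 'M[C]_n, U \is unitarymx & A = pid_mx k *m U.
  move=> Au.
  have rA : \rank A = k by apply: mxrank_unitary.
  have kn : (k <= n)%N by rewrite rank_leq_col.
  pose A2 := schmidt (row_base (orthomx Num.conj (mx_of_hermitian (hermitian1mx _)) A)).
  have r2 : \rank (orthomx Num.conj (mx_of_hermitian (hermitian1mx _)) A) = (n - k)%N.
    by rewrite rank_ortho rA.
  have A2u : A2 \is unitarymx by rewrite schmidt_unitarymx ?rank_leq_col.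
  have A2o : A *m A2^t* = 0.
    apply/eqP; rewrite -orthomx1E.
    rewrite orthomx_sym eqmx_schmidt_free ?row_base_free // eq_row_base.
    exact: submx_refl.
  move: A2 A2u A2o; rewrite r2 => A2 A2u A2o.
  have e : (k + (n - k) = n)%N by rewrite subnKC.
  exists (castmx (e, erefl n) (col_mx A A2)).
    have : col_mx A A2 *m (col_mx A A2)^t* = 1%:M.
      rewrite tr_col_mx map_row_mx mul_col_row A2o.
      rewrite (unitarymxP Au) (unitarymxP A2u).
      have -> : A2 *m A^t* = 0.
        by rewrite -[A2]trmxCK -adjmxM A2o trmx0 map_mx0.
      by rewrite -scalar_mx_block.
    by move/castmx_unitary; apply.
  have -> : (pid_mx k : 'M[C]_(k, n)) = castmx (erefl k, e) (row_mx 1%:M 0).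
    apply/matrixP => i j; rewrite castmxE /= cast_ord_id !mxE.
    case: splitP => l /= ->; rewrite !mxE.
      by rewrite ltn_ord andbT.
    by case: eqP (ltn_ord i) => // ->; rewrite ltnNge leq_addr.
  by rewrite -mulmx_castmx mul_row_col mul1mx mul0mx addr0.
have [U Uu BN] := ext B Bu.
have [U' Uu' BN'] := ext B' Bu'.
exists (U^t* *m U'); first by rewrite mul_unitarymx ?trmxC_unitary.
rewrite {1}RM SM BN' {1}BN !mulmxA.
by rewrite (mulmxtVK _ Uu).
Qed.

End GramMatrices.

(** * Fourier analysis on finite cyclic groups *)

Section FourierBound.
Variable C : numClosedFieldType.

Lemma primitive_root_exists n : (0 < n)%N -> exists z : C, n.-primitive_root z.
Proof.
move=> n_gt0; pose p : {poly C} := 'X^n - 1.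
have [r Dp] := closed_field_poly_normal p.
rewrite (monicP _) ?monicXnsubC // scale1r in Dp.
have rn1 : all n.-unity_root r.
  by apply/allP=> z; rewrite -root_prod_XsubC -Dp.
have sz_r : (n < (size r).+1)%N.
  by rewrite -(size_prod_XsubC r id) -Dp size_XnsubC.
have [|z] := hasP (has_prim_root n_gt0 rn1 _ sz_r); last by exists z.
by rewrite -separable_prod_XsubC -Dp separable_Xn_sub_1 // pnatr_eq0 -lt0n.
Qed.

Lemma norm_unity_root n (z : C) : (0 < n)%N -> z ^+ n = 1 -> `|z| = 1.
Proof.
move=> n0 zn; apply/eqP; rewrite -(pexpr_eq1 n0) //.
by rewrite -normrX zn normr1.
Qed.

Lemma unit_mul_conj (z : C) : `|z| = 1 -> z * z^* = 1.
Proof. by move=> z1; rewrite -normCK z1 expr1n. Qed.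

Section Dft.
Variables (N' : nat).
Let N := N'.+1.
Variables (w : C) (pw : N.-primitive_root w).

Let w1 : `|w| = 1.
Proof. exact: (norm_unity_root (prim_order_gt0 pw) (prim_expr_order pw)). Qed.

Let wX k : `|w ^+ k| = 1. Proof. by rewrite normrX w1 expr1n. Qed.

Lemma dft_orthogonal (m k : 'I_N) :
  \sum_(a < N) w ^+ (a * m) * (w ^+ (a * k))^* = N%:R * (m == k)%:R :> C.
Proof.
pose z := w ^+ m * (w ^+ k)^*.
have -> : \sum_(a < N) w ^+ (a * m) * (w ^+ (a * k))^* = \sum_(a < N) z ^+ a.
  by apply: eq_bigr => a _; rewrite /z exprMn mulnC exprM mulnC exprM rmorphXn.
case: eqP => [mk|mk].
  rewrite /z mk unit_mul_conj // mulr1.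
  rewrite (eq_bigr (fun=> 1)) => [|a _]; last by rewrite expr1n.
  by rewrite sumr_const card_ord.
have z1 : z - 1 != 0.
  apply/eqP => /eqP; rewrite subr_eq0 => /eqP z1; apply: mk.
  have : w ^+ m = w ^+ k.
    rewrite -[LHS]mulr1 -(unit_mul_conj (wX k)) mulrCA -/z z1.
    by rewrite mulr1.
  move/eqP; rewrite (eq_prim_root_expr pw) !modn_small // => /eqP mk.
  exact: val_inj.
rewrite mulr0; apply: (mulfI z1); rewrite mulr0.
have zN : z ^+ N = 1.
  rewrite /z exprMn -rmorphXn /= -!exprM [(m * N)%N]mulnC [(k * N)%N]mulnC.
  by rewrite !exprM (prim_expr_order pw) !expr1n rmorph1 mulr1.
by rewrite -subrX1 zN subrr.
Qed.

Lemma dft_parseval (u : 'I_N -> C) :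
  \sum_(a < N) `|\sum_(m < N) u m * w ^+ (a * m)| ^+ 2 =
  N%:R * \sum_(m < N) `|u m| ^+ 2.
Proof.
transitivity (\sum_(a < N) \sum_(m < N) \sum_(k < N)
    u m * (u k)^* * (w ^+ (a * m) * (w ^+ (a * k))^*)).
  apply: eq_bigr => a _; rewrite normCK rmorph_sum mulr_suml.
  apply: eq_bigr => m _; rewrite mulr_sumr; apply: eq_bigr => k _.
  by rewrite rmorphM /=; ring.
rewrite exchange_big /= mulr_sumr; apply: eq_bigr => m _.
rewrite exchange_big /= (bigD1 m) //= [X in _ + X]big1 ?addr0 => [|k km].
  by rewrite -mulr_sumr dft_orthogonal eqxx mulr1 -normCK mulrC.
by rewrite -mulr_sumr dft_orthogonal eq_sym (negPf km) !mulr0.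
Qed.

Lemma dft_parseval2 (u : 'I_N -> 'I_N -> C) :
  \sum_(a < N) \sum_(b < N)
    `|\sum_(n < N) \sum_(m < N) u n m * w ^+ (a * n) * w ^+ (b * m)| ^+ 2 =
  N%:R ^+ 2 * \sum_(n < N) \sum_(m < N) `|u n m| ^+ 2.
Proof.
transitivity (\sum_(a < N) \sum_(m < N)
    N%:R * `|\sum_(n < N) u n m * w ^+ (a * n)| ^+ 2).
  apply: eq_bigr => a _; rewrite -mulr_sumr -dft_parseval.
  apply: eq_bigr => b _; congr (`|_| ^+ 2); rewrite exchange_big /=.
  by apply: eq_bigr => m _; rewrite mulr_suml.
rewrite exchange_big [X in _ * X]exchange_big /= mulr_sumr.
apply: eq_bigr => m _; rewrite -mulr_sumr dft_parseval; ring.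
Qed.

Lemma dft_shift (u : 'I_N -> C) (a : 'I_N) j :
  \sum_(n < N) u (n + inZp j) * w ^+ (a * n) =
  ((w ^+ a)^*) ^+ j * \sum_(n < N) u n * w ^+ (a * n).
Proof.
rewrite [in RHS](reindex_inj (addIr (inZp j))) /= mulr_sumr.
apply: eq_bigr => n _; rewrite mulrCA; congr (_ * _).
rewrite !exprM -/N.
have -> : (w ^+ a) ^+ ((n + j %% N) %% N) = (w ^+ a) ^+ (n + j).
  by rewrite -!exprM ![(a * _)%N]mulnC !exprM modnDmr (prim_expr_mod pw).
rewrite exprD mulrCA -exprMn [_^* * _]mulrC unit_mul_conj //.
by rewrite expr1n mulr1.
Qed.

End Dft.

(** Wrapped into a cyclic group of order [L + d], both shifts become unitary. The Fourier transform
    turns [p] of the shifts into multiplication by values of [p] on the torus, and Parseval gives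
    the bound. For [n, m < L] and [j, l < d] no index wraps around, so the left side is part of the
    cyclic sum. *)
Lemma shift_polynomial_bound d L (p : 'I_d -> 'I_d -> C) (y : nat -> nat -> C)
    (b : C) :
  (forall z w : C, `|z| = 1 -> `|w| = 1 ->
     `|\sum_(j < d) \sum_(l < d) p j l * (z ^+ j * w ^+ l)| <= b) ->
  \sum_(n < L) \sum_(m < L)
     `|\sum_(j < d) \sum_(l < d) p j l * y (n + j)%N (m + l)%N| ^+ 2 <=
  b ^+ 2 * \sum_(n < L + d) \sum_(m < L + d) `|y n m| ^+ 2.
Proof.
move=> pb; have b0 : 0 <= b.
  by apply: le_trans (pb 1 1 _ _); rewrite ?normr1 ?normr_ge0.
case E : (L + d)%N => [|N'].
  have -> : L = 0%N by lia.
  by rewrite !big_ord0 mulr0.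
have [w pw] := primitive_root_exists (ltn0Sn N').
pose Y (n m : 'I_N'.+1) := y n m.
pose U (n m : 'I_N'.+1) :=
  \sum_(j < d) \sum_(l < d) p j l * Y (n + inZp j) (m + inZp l).
pose hat (u : 'I_N'.+1 -> 'I_N'.+1 -> C) (a b : 'I_N'.+1) :=
  \sum_(n < N'.+1) \sum_(m < N'.+1) u n m * w ^+ (a * n) * w ^+ (b * m).
have hatU a c : hat U a c =
    (\sum_(j < d) \sum_(l < d) p j l * (((w ^+ a)^*) ^+ j * ((w ^+ c)^*) ^+ l)) *
    hat Y a c.
  rewrite /hat /U.
  transitivity (\sum_(j < d) \sum_(l < d) p j l *
    \sum_(n < N'.+1) (\sum_(m < N'.+1) Y (n + inZp j) (m + inZp l) * w ^+ (c * m))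
       * w ^+ (a * n)).
    under eq_bigr => n _.
      under eq_bigr => m _.
        rewrite -mulrA mulr_suml.
        under eq_bigr => j _ do rewrite mulr_suml.
        over.
      rewrite exchange_big /=.
      over.
    rewrite exchange_big /=; apply: eq_bigr => j _.
    under eq_bigr => n _ do rewrite exchange_big /=.
    rewrite exchange_big /=; apply: eq_bigr => l _.
    rewrite mulr_sumr; apply: eq_bigr => n _.
    rewrite mulr_suml mulr_sumr; apply: eq_bigr => m _; ring.
  rewrite mulr_suml; apply: eq_bigr => j _.
  rewrite mulr_suml; apply: eq_bigr => l _.
  rewrite -mulrA; congr (_ * _).
  under eq_bigr => n _ do rewrite (dft_shift pw).
  rewrite (dft_shift pw (fun n => ((w ^+ c)^*) ^+ l * \sum_(m < N'.+1) Y n m * w ^+ (c * m))).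
  rewrite -mulrA; congr (_ * _); rewrite mulr_sumr; apply: eq_bigr => n _.
  rewrite -mulrA; congr (_ * _); rewrite mulr_suml; apply: eq_bigr => m _.
  ring.
have nw k : `|(w ^+ k)^*| = 1.
  rewrite norm_conjC normrX.
  by rewrite (norm_unity_root (prim_order_gt0 pw) (prim_expr_order pw)) expr1n.
have UY : \sum_(n < N'.+1) \sum_(m < N'.+1) `|U n m| ^+ 2 <=
    b ^+ 2 * \sum_(n < N'.+1) \sum_(m < N'.+1) `|Y n m| ^+ 2.
  have N0 : 0 < (N'.+1%:R : C) ^+ 2 by rewrite exprn_gt0 // ltr0n.
  rewrite -(ler_pM2l N0) mulrCA -!(dft_parseval2 pw) mulr_sumr.
  apply: ler_sum => a _; rewrite mulr_sumr; apply: ler_sum => c _.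
  rewrite -!/(hat _ _ _) hatU normrM exprMn ler_wpM2r ?exprn_ge0 //.
  by rewrite lerXn2r ?nnegrE // pb.
apply: le_trans UY.
have LN : (L <= N'.+1)%N by lia.
rewrite (big_ord_widen _ (fun n => \sum_(m < L)
  `|\sum_(j < d) \sum_(l < d) p j l * y (n + j)%N (m + l)%N| ^+ 2) LN).
rewrite [leRHS](bigID (fun n : 'I_N'.+1 => (n < L)%N)) /=.
rewrite ler_wpDr //; first by apply: sumr_ge0 => n _; apply: sumr_ge0 => m _; rewrite exprn_ge0.
apply: ler_sum => n nL.
rewrite (big_ord_widen _ (fun m =>
  `|\sum_(j < d) \sum_(l < d) p j l * y (n + j)%N (m + l)%N| ^+ 2) LN).
rewrite [leRHS](bigID (fun n : 'I_N'.+1 => (n < L)%N)) /=.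
rewrite ler_wpDr //; first by apply: sumr_ge0 => m _; rewrite exprn_ge0.
apply: ler_sum => m mL; rewrite le_eqVlt; apply/orP; left; apply/eqP.
congr (`|_| ^+ 2); apply: eq_bigr => j _; apply: eq_bigr => l _.
have small k (i : 'I_d) : (k < L)%N -> ((k + i %% N'.+1) %% N'.+1)%N = (k + i)%N.
  by move=> kL; rewrite modnDmr modn_small //; have := ltn_ord i; lia.
by rewrite /Y /= !small.
Qed.

End FourierBound.

Lemma le_of_quadratic_slack (R : realType) (x y : R[i]%C) d : 0 <= x -> 0 <= y ->
  (forall L : nat, L%:R ^+ 2 * x <= (L + d)%N%:R ^+ 2 * y) -> x <= y.
Proof.
move=> x0 y0 H.
have /complex_realP [a ax] : x \is Num.real by rewrite ger0_real.
have /complex_realP [b bx] : y \is Num.real by rewrite ger0_real.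
subst x y; rewrite lecR; rewrite !ler0c in x0 y0.
have {}H L : L%:R ^+ 2 * a <= (L + d)%N%:R ^+ 2 * b.
  by have := H L; rewrite -!(rmorph_nat (real_complex R)) -!rmorphXn -!rmorphM lecR.
rewrite leNgt; apply/negP => ba.
have ab : 0 < a - b by rewrite subr_gt0.
(* Expanding [(L + d)^2] leaves [L^2 (a - b) <= (2 d L + d^2) b], whose right side is only linear in
   [L]; this [L] violates it. *)
pose L := (Num.bound ((2 * d%:R + d%:R ^+ 2) * b / (a - b))).+1.
have L1 : 1 <= L%:R :> R by rewrite ler1n.
have : (2 * d%:R + d%:R ^+ 2) * b / (a - b) < L%:R.
  apply: (lt_trans (archi_boundP _)).
    apply: divr_ge0; last exact: ltW.
    by apply: mulr_ge0 => //; rewrite addr_ge0 ?mulr_ge0 ?exprn_ge0.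
  by rewrite ltr_nat.
rewrite ltr_pdivrMr // => HL.
have := H L; rewrite natrD => {}H.
have d0 : 0 <= d%:R :> R by [].
have e1 : L%:R ^+ 2 * (a - b) <= (2 * d%:R * L%:R + d%:R ^+ 2) * b by nra.
have e2 : (2 * d%:R * L%:R + d%:R ^+ 2) * b <= (2 * d%:R + d%:R ^+ 2) * b * L%:R.
  have : 0 <= d%:R ^+ 2 * b * (L%:R - 1).
    by rewrite !mulr_ge0 ?exprn_ge0 // subr_ge0.
  lra.
have e3 : (2 * d%:R + d%:R ^+ 2) * b * L%:R < L%:R * (a - b) * L%:R.
  by rewrite ltr_pM2r // (lt_le_trans _ L1).
by have := le_lt_trans (le_trans e1 e2) e3; rewrite expr2 -!mulrA [(a - b) * _]mulrC ltxx.
Qed.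

(** * Ando's inequality *)

Section Ando.
Variable C : numClosedFieldType.
(* Averaging over [L ^ 2] translates only gives this weak comparison; drawing the
   conclusion takes an archimedean field, see [le_of_quadratic_slack]. *)
Hypothesis quadratic_slack : forall (x y : C) d, 0 <= x -> 0 <= y ->
  (forall L : nat, L%:R ^+ 2 * x <= (L + d)%N%:R ^+ 2 * y) -> x <= y.

Section Averaging.
Variables (K : lmodType C) (W1 W2 : {linear K -> K}).
Variables (I : nat -> finType) (phi : forall B, I B -> {linear K -> C^o}).
(** Level [B] of a family of seminorms that replaces a Hilbert norm. The four inequalities below
    express that [W1] and [W2] are isometries: they increase no seminorm, and level [B.+1] of the
    image recovers level [B]. *)
Let Nrm B x := \sum_(i : I B) `|phi i x| ^+ 2.
Hypothesis W12 : forall x, W1 (W2 x) = W2 (W1 x).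
Hypothesis W1_le : forall B x, Nrm B (W1 x) <= Nrm B x.
Hypothesis W2_le : forall B x, Nrm B (W2 x) <= Nrm B x.
Hypothesis W1_ge : forall B x, Nrm B x <= Nrm B.+1 (W1 x).
Hypothesis W2_ge : forall B x, Nrm B x <= Nrm B.+1 (W2 x).

Let iterC n m x : iter n W1 (iter m W2 x) = iter m W2 (iter n W1 x).
Proof.
elim: n => //= n ->; elim: m => //= m IH.
by rewrite W12 IH.
Qed.

Let iter_lin (W : {linear K -> K}) n (J : finType) (c : J -> C) (x : J -> K) :
  iter n W (\sum_j c j *: x j) = \sum_j c j *: iter n W (x j).
Proof.
elim: n => //= n ->; rewrite linear_sum; apply: eq_bigr => j _.
by rewrite linearZ.
Qed.

(* The vectors [W1 ^ n (W2 ^ m x)] with [n, m < L] all have the norm of [x], so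
   the bound follows from [shift_polynomial_bound] by letting [L] tend to
   infinity. *)
Lemma isometry_polynomial_bound d (p : 'I_d -> 'I_d -> C) (b c : C) (s : K) :
  (forall z w : C, `|z| = 1 -> `|w| = 1 ->
     `|\sum_(j < d) \sum_(l < d) p j l * (z ^+ j * w ^+ l)| <= b) ->
  (forall B, Nrm B s <= c) ->
  Nrm 0 (\sum_(j < d) \sum_(l < d) p j l *: iter j W1 (iter l W2 s)) <=
  b ^+ 2 * c.
Proof.
move=> pb sc.
have Nrm_ge0 B x : 0 <= Nrm B x by apply: sumr_ge0 => i _; rewrite exprn_ge0.
have c0 : 0 <= c by apply: le_trans (sc 0%N).
have b0 : 0 <= b by apply: le_trans (pb 1 1 _ _); rewrite ?normr1 ?normr_ge0.
set S := \sum_(j < d) _.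
pose y n m := iter n W1 (iter m W2 s).
pose A n m := iter n W1 (iter m W2 S).
have AE n m : A n m = \sum_(j < d) \sum_(l < d) p j l *: y (n + j)%N (m + l)%N.
  rewrite /A /S pair_big /= !iter_lin pair_big /=.
  apply: eq_bigr => -[j l] _ /=; congr (_ *: _).
  by rewrite /y -iterC -iterD iterC -iterD iterC [(m + l)%N]addnC.
have lowW1 n B x : Nrm B x <= Nrm (B + n) (iter n W1 x).
  elim: n => [|n IH]; first by rewrite addn0.
  by rewrite addnS; apply: le_trans IH (W1_ge _ _).
have lowW2 n B x : Nrm B x <= Nrm (B + n) (iter n W2 x).
  elim: n => [|n IH]; first by rewrite addn0.
  by rewrite addnS; apply: le_trans IH (W2_ge _ _).
have low n m : Nrm 0 S <= Nrm (m + n) (A n m).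
  by apply: le_trans (lowW2 m 0%N S) _; apply: le_trans (lowW1 n _ _) _.
have upW1 n B x : Nrm B (iter n W1 x) <= Nrm B x.
  by elim: n => //= n IH; apply: le_trans (W1_le _ _) IH.
have upW2 n B x : Nrm B (iter n W2 x) <= Nrm B x.
  by elim: n => //= n IH; apply: le_trans (W2_le _ _) IH.
have up B n m : Nrm B (y n m) <= c.
  by apply: le_trans (upW1 _ _ _) _; apply: le_trans (upW2 _ _ _) _.
have mono B k x : Nrm B x <= Nrm (B + k) x.
  elim: k => [|k IH]; first by rewrite addn0.
  by rewrite addnS; apply: le_trans IH (le_trans (W1_ge _ _) (W1_le _ _)).
apply: (@quadratic_slack _ _ d) => // [|L].
  by rewrite mulr_ge0 ?exprn_ge0.
have sum_cst k x : \sum_(n < k) \sum_(m < k) x = k%:R ^+ 2 * x :> C.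
  by rewrite !sumr_const !card_ord -mulrnA -[LHS]mulr_natl natrM expr2.
rewrite -sum_cst.
(* [A n m] recovers [Nrm 0 S] at level [m + n], and [L + L] is above all these levels. *)
apply: (@le_trans _ _ (\sum_(n < L) \sum_(m < L) Nrm (L + L) (A n m))).
  apply: ler_sum => n _; apply: ler_sum => m _.
  apply: le_trans (low n m) _.
  have -> : (L + L = (m + n) + ((L - m) + (L - n)))%N.
    by have := ltn_ord n; have := ltn_ord m; lia.
  exact: mono.
have -> : \sum_(n < L) \sum_(m < L) Nrm (L + L) (A n m) =
    \sum_(i : I (L + L)%N) \sum_(n < L) \sum_(m < L) `|phi i (A n m)| ^+ 2.
  rewrite [RHS]exchange_big /=; apply: eq_bigr => n _.
  by rewrite [RHS]exchange_big.
apply: (@le_trans _ _ (\sum_(i : I (L + L)%N) b ^+ 2 *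
    \sum_(n < L + d) \sum_(m < L + d) `|phi i (y n m)| ^+ 2)).
  apply: ler_sum => i _.
  apply: le_trans (shift_polynomial_bound L (fun n m => phi i (y n m)) pb).
  rewrite le_eqVlt; apply/orP; left; apply/eqP.
  apply: eq_bigr => n _; apply: eq_bigr => m _; congr (`|_| ^+ 2).
  rewrite AE linear_sum; apply: eq_bigr => j _.
  by rewrite linear_sum; apply: eq_bigr => l _; rewrite linearZ.
rewrite -mulr_sumr exchange_big /= mulrCA ler_wpM2l ?exprn_ge0 //.
under eq_bigr => n _ do rewrite exchange_big /=.
apply: (@le_trans _ _ (\sum_(n < L + d) \sum_(m < L + d) c)).
  by apply: ler_sum => n _; apply: ler_sum => m _; apply: up.
by rewrite sum_cst.
Qed.

End Averaging.

Let mx11B (A B : 'M[C]_1) : (A - B) 0 0 = A 0 0 - B 0 0.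
Proof. by rewrite !mxE. Qed.

Section CommutingContractions.
Variables (M : nat) (T1 T2 Q G0 D1 D2 : 'M[C]_M) (X : 'M[C]_(M + M)).

Let K := ('rV[C]_M * (nat -> 'rV[C]_(M + M)))%type.

(* Read [s.2] as one sequence, each entry contributing its left half and then its
   right half: [dilate] shifts that sequence by one place and puts the defect
   [s.1 *m D] in front.  [rotate] supplies the unitary of Ando's construction,
   which makes the dilations of [T1] and [T2] commute. *)
Definition dilate (T D : 'M[C]_M) (s : K) : K :=
  (s.1 *m T, fun n =>
     if n is n'.+1 then row_mx (rsubmx (s.2 n')) (lsubmx (s.2 n))
     else row_mx (s.1 *m D) (lsubmx (s.2 0%N))).

Definition rotate (U : 'M[C]_(M + M)) (s : K) : K :=
  (s.1, fun n => s.2 n *m U).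

Let stateE a (x y : K) :
  a *: x + y = (a *: x.1 + y.1, fun n => a *: x.2 n + y.2 n).
Proof. by []. Qed.

Lemma dilate_linear T D : linear (dilate T D).
Proof.
move=> a [h e] [h' e']; rewrite !stateE /dilate /=; congr pair.
  by rewrite mulmxDl -scalemxAl.
apply/funext => -[|n] /=; rewrite scale_row_mx add_row_mx; congr row_mx.
- by rewrite mulmxDl -scalemxAl.
- by rewrite !linearD !linearZ.
- by rewrite !linearD !linearZ.
- by rewrite !linearD !linearZ.
Qed.

Lemma rotate_linear U : linear (rotate U).
Proof.
move=> a [h e] [h' e']; rewrite !stateE /rotate /=; congr pair.
by apply/funext => n /=; rewrite mulmxDl -scalemxAl.
Qed.

Definition ando1 (s : K) : K := rotate X (dilate T1 D1 s).
Definition ando2 (s : K) : K := dilate T2 D2 (rotate (X^t*) s).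

Lemma ando1_linear : linear ando1.
Proof. by move=> a x y; rewrite /ando1 dilate_linear rotate_linear. Qed.
Lemma ando2_linear : linear ando2.
Proof. by move=> a x y; rewrite /ando2 rotate_linear dilate_linear. Qed.

HB.instance Definition _ := GRing.isLinear.Build C K K _ ando1 ando1_linear.
HB.instance Definition _ := GRing.isLinear.Build C K K _ ando2 ando2_linear.

Definition coordinate B (i : 'I_M + 'I_B * 'I_(M + M)) (s : K) : C^o :=
  match i with
  | inl i => (s.1 *m G0) 0 i
  | inr (n, i) => s.2 n 0 i
  end.

Lemma coordinate_linear B i : linear (@coordinate B i).
Proof.
move=> a [h e] [h' e']; rewrite stateE; case: i => [i|[n i]] /=.
  by rewrite mulmxDl -scalemxAl !mxE.
by rewrite !mxE.
Qed.

HB.instance Definition _ B i :=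
  GRing.isLinear.Build C K C^o _ (@coordinate B i) (@coordinate_linear B i).

Hypothesis QG : Q = G0 *m G0^t*.
Hypothesis QD1 : Q - T1 *m Q *m T1^t* = D1 *m D1^t*.
Hypothesis QD2 : Q - T2 *m Q *m T2^t* = D2 *m D2^t*.
Hypothesis T12 : T1 *m T2 = T2 *m T1.
Hypothesis Xu : X \is unitarymx.
Hypothesis XE : row_mx (T2 *m D1) D2 *m X = row_mx (T1 *m D2) D1.

Let Nrm B (s : K) := \sum_(i : 'I_M + 'I_B * 'I_(M + M)) `|coordinate i s| ^+ 2.

Let NrmE B s : Nrm B s = qform Q s.1 + \sum_(n < B) sqnorm (s.2 n).
Proof.
rewrite /Nrm big_sumType /= QG qform_mulmxt; congr (_ + _).
by rewrite /sqnorm pair_big /=; apply: eq_bigr => -[n i].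
Qed.

Let qform_defect (T D : 'M[C]_M) : Q - T *m Q *m T^t* = D *m D^t* ->
  forall v : 'rV_M, qform Q v = qform Q (v *m T) + sqnorm (v *m D).
Proof.
move=> QD v; rewrite sqnormE /qform !adjmxM !mulmxA -[v *m D *m _]mulmxA -QD.
by rewrite mulmxBr mulmxBl !mulmxA mx11B addrC subrK.
Qed.

Let Nrm_rotate U B s : U \is unitarymx -> Nrm B (rotate U s) = Nrm B s.
Proof.
move=> Uu; rewrite !NrmE /=; congr (_ + _); apply: eq_bigr => n _.
exact: sqnorm_unitary.
Qed.

Let sqnormlr (v : 'rV[C]_(M + M)) : sqnorm v = sqnorm (lsubmx v) + sqnorm (rsubmx v).
Proof. by rewrite -sqnorm_row_mx hsubmxK. Qed.

(** The defect entry [s.1 *m D] restores what [T] takes from [qform Q]. For [B > 0], truncating the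
    image at [B] loses one half-entry of [s], while truncating at [B.+1] gains one. *)
Let Nrm_dilate (T D : 'M[C]_M) B s : Q - T *m Q *m T^t* = D *m D^t* ->
  Nrm B (dilate T D s) <= Nrm B s <= Nrm B.+1 (dilate T D s).
Proof.
move=> QD; rewrite !NrmE.
have E k : \sum_(n < k.+1) sqnorm ((dilate T D s).2 n) =
    sqnorm (s.1 *m D) + \sum_(n < k.+1) sqnorm (lsubmx (s.2 n)) +
    \sum_(n < k) sqnorm (rsubmx (s.2 n)).
  rewrite big_ord_recl /= sqnorm_row_mx.
  rewrite [X in _ = _ + X + _]big_ord_recl /= -!addrA; congr (_ + (_ + _)).
  rewrite -big_split; apply: eq_bigr => n _ /=.
  by rewrite sqnorm_row_mx addrC.
have E2 : \sum_(n < B) sqnorm (s.2 n) = \sum_(n < B) sqnorm (lsubmx (s.2 n)) +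
    \sum_(n < B) sqnorm (rsubmx (s.2 n)).
  by rewrite -big_split; apply: eq_bigr => n _ /=; rewrite sqnormlr.
rewrite (qform_defect QD s.1) E2; apply/andP; split.
  case: B {E2} => [|B].
    by rewrite !big_ord0 !addr0 lerDl sqnorm_ge0.
  rewrite E [X in _ <= _ + (_ + X)]big_ord_recr /= -!addrA.
  by rewrite !lerD2l lerDl sqnorm_ge0.
rewrite E [X in _ <= _ + (_ + X + _)]big_ord_recr /= -!addrA !lerD2l.
by rewrite lerDr sqnorm_ge0.
Qed.

(** On the right the two rotations cancel. On the left two half-block shifts move whole blocks by
    one place, so [X^*] and [X] cancel on every block but the front one, where the equality is
    [XE]. *)
Let ando_comm s : ando1 (ando2 s) = ando2 (ando1 s).
Proof.
rewrite /ando1 /ando2.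
have -> : rotate (X^t*) (rotate X (dilate T1 D1 s)) = dilate T1 D1 s.
  rewrite /rotate /=; congr pair; apply/funext => n.
  by rewrite (mulmxtVK _ Xu).
case: s => h e; rewrite /rotate /dilate /=; congr pair.
  by rewrite -!mulmxA T12.
apply/funext => -[|[|n]] /=.
- rewrite row_mxKl -mulmxA -mul_mx_row.
  by rewrite -mulmxA XE mul_mx_row mulmxA row_mxKl.
- by rewrite !row_mxKr !row_mxKl !hsubmxK mulmxKtV.
- by rewrite !row_mxKr !row_mxKl !hsubmxK mulmxKtV.
Qed.

(** Started at [(h, 0)], a polynomial in the dilations has as first component the polynomial in
    [T1], [T2] applied to [h], and [Nrm 0] sees this component only. *)
Lemma ando_dilation_bound d (p : 'I_d -> 'I_d -> C) (b : C) (h : 'rV[C]_M) :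
  (forall z w : C, `|z| = 1 -> `|w| = 1 ->
     `|\sum_(j < d) \sum_(l < d) p j l * (z ^+ j * w ^+ l)| <= b) ->
  qform Q (\sum_(j < d) \sum_(l < d)
    p j l *: iter j (mulmxr T1) (iter l (mulmxr T2) h)) <=
  b ^+ 2 * qform Q h.
Proof.
move=> pb; pose s : K := (h, fun=> 0).
have sc B : Nrm B s <= qform Q h.
  rewrite NrmE /= big1 ?addr0 // => n _.
  by rewrite /sqnorm big1 // => i _; rewrite mxE normr0 expr0n.
have W1_le B x : Nrm B (ando1 x) <= Nrm B x.
  by rewrite /ando1 Nrm_rotate //; case/andP: (Nrm_dilate B x QD1).
have W1_ge B x : Nrm B x <= Nrm B.+1 (ando1 x).
  by rewrite /ando1 Nrm_rotate //; case/andP: (Nrm_dilate B x QD1).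
have Xu' : X^t* \is unitarymx by rewrite trmxC_unitary.
have W2_le B x : Nrm B (ando2 x) <= Nrm B x.
  by rewrite /ando2 -(Nrm_rotate B x Xu'); case/andP: (Nrm_dilate B (rotate (X^t*) x) QD2).
have W2_ge B x : Nrm B x <= Nrm B.+1 (ando2 x).
  by rewrite /ando2 -(Nrm_rotate B x Xu'); case/andP: (Nrm_dilate B (rotate (X^t*) x) QD2).
have := @isometry_polynomial_bound K ando1 ando2 _ (fun B i => @coordinate B i)
  ando_comm W1_le W2_le W1_ge W2_ge d p b (qform Q h) s pb sc.
rewrite -/(Nrm _ _) NrmE big_ord0 addr0.
congr (qform Q _ <= _).
rewrite (raddf_sum fst) /=; apply: eq_bigr => j _.
rewrite (raddf_sum fst) /=; apply: eq_bigr => l _; congr (_ *: _).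
elim: (j : nat) => /= [|k ->] //.
by elim: (l : nat) => /= [|k ->].
Qed.

End CommutingContractions.

Lemma von_neumann_ando M (T1 T2 Q : 'M[C]_M) d (p : 'I_d -> 'I_d -> C) (b : C)
    (h : 'rV[C]_M) :
  Q^t* = Q -> (forall v : 'rV_M, 0 <= qform Q v) ->
  T1 *m T2 = T2 *m T1 ->
  (forall v : 'rV_M, qform Q (v *m T1) <= qform Q v) ->
  (forall v : 'rV_M, qform Q (v *m T2) <= qform Q v) ->
  (forall z w : C, `|z| = 1 -> `|w| = 1 ->
     `|\sum_(j < d) \sum_(l < d) p j l * (z ^+ j * w ^+ l)| <= b) ->
  qform Q (\sum_(j < d) \sum_(l < d)
    p j l *: iter j (mulmxr T1) (iter l (mulmxr T2) h)) <=
  b ^+ 2 * qform Q h.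
Proof.
move=> Qh Qpos T12 QT1 QT2 pb.
have [G0 QG] := psd_factor Qh Qpos.
have defect T : (forall v : 'rV_M, qform Q (v *m T) <= qform Q v) ->
    exists D : 'M[C]_M, Q - T *m Q *m T^t* = D *m D^t*.
  move=> QT; apply: psd_factor.
    by rewrite linearB map_mxB /= !adjmxM trmxCK Qh mulmxA.
  move=> v; have := QT v; rewrite -subr_ge0 /qform mulmxBr mulmxBl.
  by rewrite !adjmxM !mulmxA mx11B.
have [D1 QD1] := defect _ QT1.
have [D2 QD2] := defect _ QT2.
(* By commutation both Gram matrices equal [Q - E Q E^*] with [E = T1 T2]. *)
have [|X Xu XE] := @gram_unitary _ _ _ (row_mx (T2 *m D1) D2) (row_mx (T1 *m D2) D1).
  rewrite !tr_row_mx !map_col_mx !mul_row_col !adjmxM !mulmxA.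
  rewrite -(mulmxA T2 D1) -(mulmxA T1 D2) -QD1 -QD2 !mulmxBr !mulmxBl !mulmxA T12.
  rewrite -(mulmxA _ (T1^t*) (T2^t*)) -(mulmxA _ (T2^t*) (T1^t*)) -!adjmxM T12.
  by rewrite addrC subrKA [RHS]addrC subrKA.
exact: ando_dilation_bound QG QD1 QD2 T12 Xu XE _ _ _ _ pb.
Qed.

End Ando.

(** * Cauchy's theorem on the disk *)

Section ComplexModulus.
Variable R : realType.
Implicit Types z w : R[i]%C.
Import ComplexField.

Definition cabs z : R := Num.sqrt ((Re z) ^+ 2 + (Im z) ^+ 2).

Lemma cabsE z : `|z| = (cabs z)%:C%C. Proof. exact: normc_def. Qed.

Lemma cabs_ge0 z : 0 <= cabs z. Proof. exact: sqrtr_ge0. Qed.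

Lemma cabs_sqr z : cabs z ^+ 2 = (Re z) ^+ 2 + (Im z) ^+ 2.
Proof. by rewrite sqr_sqrtr // addr_ge0 ?sqr_ge0. Qed.

Lemma cabsM z w : cabs (z * w) = cabs z * cabs w.
Proof. by apply: complexI; rewrite rmorphM /= -!cabsE normrM. Qed.

Lemma cabsD z w : cabs (z + w) <= cabs z + cabs w.
Proof. by rewrite -lecR rmorphD /= -!cabsE ler_normD. Qed.

Lemma cabsN z : cabs (- z) = cabs z.
Proof. by apply: complexI; rewrite -!cabsE normrN. Qed.

Lemma cabsB z w : cabs (z - w) = cabs (w - z).
Proof. by rewrite -cabsN opprB. Qed.

Lemma cabs0 : cabs 0 = 0.
Proof. by apply: complexI; rewrite -cabsE normr0. Qed.

Lemma cabs_eq0 z : (cabs z == 0) = (z == 0).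
Proof. by rewrite -[RHS]normr_eq0 cabsE (inj_eq (@complexI R) _ 0). Qed.

Lemma cabsX z n : cabs (z ^+ n) = cabs z ^+ n.
Proof. by apply: complexI; rewrite rmorphXn /= -!cabsE normrX. Qed.

Lemma cabsV z : cabs z^-1 = (cabs z)^-1.
Proof. by apply: complexI; rewrite fmorphV /= -!cabsE normfV. Qed.

Lemma cabs_real (x : R) : cabs x%:C%C = `|x|.
Proof. by rewrite /cabs /= expr0n /= addr0 sqrtr_sqr. Qed.

Lemma cabs_sum n (F : 'I_n -> R[i]%C) : cabs (\sum_i F i) <= \sum_i cabs (F i).
Proof.
elim/big_ind2: _ => [|x a y b xa yb|//]; first by rewrite cabs0.
exact: le_trans (cabsD _ _) (lerD xa yb).
Qed.

Lemma Re_le_cabs z : `|Re z| <= cabs z.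
Proof.
rewrite -(@ler_pXn2r _ 2) ?nnegrE ?cabs_ge0 // cabs_sqr real_normK ?num_real //.
by rewrite lerDl sqr_ge0.
Qed.

Lemma Im_le_cabs z : `|Im z| <= cabs z.
Proof.
rewrite -(@ler_pXn2r _ 2) ?nnegrE ?cabs_ge0 // cabs_sqr real_normK ?num_real //.
by rewrite lerDr sqr_ge0.
Qed.

Lemma cabs_le_ReIm z : cabs z <= `|Re z| + `|Im z|.
Proof.
rewrite -(@ler_pXn2r _ 2) ?nnegrE ?cabs_ge0 ?addr_ge0 // cabs_sqr sqrrD.
rewrite !real_normK ?num_real // -addrA lerD2l lerDr mulrn_wge0 // mulr_ge0 //.
Qed.

Lemma Re_mul z w : Re (z * w) = Re z * Re w - Im z * Im w.
Proof. by case: z w => [a b] [c d]. Qed.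

Lemma Im_mul z w : Im (z * w) = Re z * Im w + Im z * Re w.
Proof. by case: z w => [a b] [c d]. Qed.

Lemma Re_add z w : Re (z + w) = Re z + Re w.
Proof. by case: z w => [a b] [c d]. Qed.

Lemma Im_add z w : Im (z + w) = Im z + Im w.
Proof. by case: z w => [a b] [c d]. Qed.

Lemma Re_opp z : Re (- z) = - Re z. Proof. by case: z. Qed.

Lemma Im_opp z : Im (- z) = - Im z. Proof. by case: z. Qed.

Lemma complex_ext z w : Re z = Re w -> Im z = Im w -> z = w.
Proof. by case: z w => [a b] [c d] /= -> ->. Qed.

End ComplexModulus.

Section Antiderivatives.
Variable R : realType.
Notation mu := (@lebesgue_measure R).

Lemma real_antiderivative (f : R -> R) : continuous f ->
  exists F : R -> R, forall x : R, is_derive x 1 F (f x).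
Proof.
move=> cf.
have intf a b : mu.-integrable `[a, b] (EFin \o f).
  apply: continuous_compact_integrable; first exact: segment_compact.
  by apply: continuous_in_subspaceT => x _; apply: cf.
pose P a x : R := (\int[mu]_(t in `[a, x]) f t)%R.
have Psub a b x : a <= b -> b <= x -> P a x - P a b = P b x.
  move=> ab bx; rewrite /P (Rintegral_itvB (intf a x)) ?bnd_simp //.
  rewrite Rintegral_itv_obnd_cbnd //.
  apply: (integrableS _ _ _ (intf b x)) => //.
  by apply: subset_itvr; rewrite bnd_simp.
(* [P a x] integrates only to the right of [a]. The base point lies to the left of both [x] and 0,
   and subtracting the value at 0 makes [F] independent of it. *)
pose F x := P (- (`|x| + 1)) x - P (- (`|x| + 1)) 0.
have FE A x : `|x| + 1 <= A -> F x = P (- A) x - P (- A) 0.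
  move=> xA; rewrite /F.
  have h1 : - A <= - (`|x| + 1) by rewrite lerN2.
  have h2 : - (`|x| + 1) <= x.
    by rewrite lerNl; have := ler_norm (- x); rewrite normrN; lra.
  have h3 : - (`|x| + 1) <= 0 by rewrite oppr_le0 addr_ge0.
  by rewrite -(Psub _ _ _ h1 h2) -(Psub _ _ _ h1 h3); ring.
exists F => x0; pose A := `|x0| + 3.
have dP : is_derive x0 1 (P (- A)) (f x0).
  have [] := @continuous_FTC1_closed R f (- A) x0 (x0 + 1) _ _ _ (cf x0).
  - by rewrite ltrDl.
  - exact: intf.
  - by have := ler_norm (- x0); rewrite normrN /A; lra.
  rewrite derive1E => d e; apply: DeriveDef => //.
have dG : is_derive x0 1 (fun x => P (- A) x - P (- A) 0) (f x0).
  have : is_derive x0 1 (P (- A) - cst (P (- A) 0)) (f x0 - 0).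
    exact: is_deriveB.
  by rewrite subr0.
apply: near_eq_is_derive dG.
near=> x; rewrite (FE A) // /A.
have : `|x - x0| < 1.
  near: x; apply/nbhs_normP; exists 1 => //= y; by rewrite distrC.
by have := ler_normD (x - x0) x0; rewrite subrK; lra.
Unshelve. all: by end_near. Qed.

End Antiderivatives.

Section CurveDerivatives.
Variable R : realType.
Notation C := (R[i]%C).
Implicit Types u v : R -> C.

Definition curve_derive u (t : R) (l : C) :=
  is_derive t (1 : R) (fun s => Re (u s)) (Re l) /\
  is_derive t (1 : R) (fun s => Im (u s)) (Im l).

Definition cis (t : R) : C := (cos t +i* sin t)%C.

Lemma curve_derive_cst (c : C) t : curve_derive (fun=> c) t 0.
Proof. by split; exact: is_derive_cst. Qed.

Lemma curve_derive_real t : curve_derive (fun s => s%:C%C) t 1.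
Proof. by split; [exact: is_derive_id | exact: is_derive_cst]. Qed.

Lemma curve_deriveD u v t l k :
  curve_derive u t l -> curve_derive v t k ->
  curve_derive (fun s => u s + v s) t (l + k).
Proof.
move=> [ul ul'] [vk vk']; split.
  have -> : (fun s => Re (u s + v s)) = (fun s => Re (u s)) + (fun s => Re (v s)).
    by apply/funext => s; rewrite fctE Re_add.
  rewrite Re_add.
  exact: is_deriveD.
have -> : (fun s => Im (u s + v s)) = (fun s => Im (u s)) + (fun s => Im (v s)).
  by apply/funext => s; rewrite fctE Im_add.
rewrite Im_add.
exact: is_deriveD.
Qed.

Lemma curve_deriveM u v t l k :
  curve_derive u t l -> curve_derive v t k ->
  curve_derive (fun s => u s * v s) t (u t * k + l * v t).
Proof.
move=> [ul ul'] [vk vk']; split.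
  have -> : (fun s => Re (u s * v s)) =
      (fun s => Re (u s)) * (fun s => Re (v s)) -
      (fun s => Im (u s)) * (fun s => Im (v s)).
    by apply/funext => s; exact: Re_mul.
  apply: is_derive_eq (is_deriveB (is_deriveM ul vk) (is_deriveM ul' vk')) _.
  rewrite Re_add !Re_mul /GRing.scale /=; ring.
have -> : (fun s => Im (u s * v s)) =
    (fun s => Re (u s)) * (fun s => Im (v s)) +
    (fun s => Im (u s)) * (fun s => Re (v s)).
  by apply/funext => s; exact: Im_mul.
apply: is_derive_eq (is_deriveD (is_deriveM ul vk') (is_deriveM ul' vk)) _.
rewrite Im_add !Im_mul /GRing.scale /=; ring.
Qed.

Lemma curve_deriveZ (c : C) u t l :
  curve_derive u t l -> curve_derive (fun s => c * u s) t (c * l).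
Proof.
move=> ul; have := curve_deriveM (curve_derive_cst c t) ul.
by rewrite mul0r addr0.
Qed.

Lemma curve_deriveB u v t l k :
  curve_derive u t l -> curve_derive v t k ->
  curve_derive (fun s => u s - v s) t (l - k).
Proof.
move=> ul vk; rewrite -(mulN1r k).
have -> : (fun s => u s - v s) = (fun s => u s + -1 * v s).
  by apply/funext => s; rewrite mulN1r.
exact: curve_deriveD ul (curve_deriveZ (-1) vk).
Qed.

Lemma curve_derive_cis t : curve_derive cis t ('i%C * cis t).
Proof.
split.
  have -> : Re ('i%C * cis t) = - sin t by rewrite Re_mul /= mul0r mul1r sub0r.
  exact: is_derive_cos.
have -> : Im ('i%C * cis t) = cos t by rewrite Im_mul /= mul0r mul1r add0r.
exact: is_derive_sin.
Qed.

Lemma curve_antiderivative u :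
  continuous (fun s => Re (u s)) -> continuous (fun s => Im (u s)) ->
  exists U : R -> C, forall t, curve_derive U t (u t).
Proof.
move=> /real_antiderivative [A dA] /real_antiderivative [B dB].
exists (fun t => (A t +i* B t)%C) => t; split; [exact: dA|exact: dB].
Qed.

(** The mean value equality fails for complex values; it is used for the real and imaginary parts
    separately, which costs the factor 2. *)
Lemma curve_mean_value u u' (a b B : R) : a <= b ->
  (forall t, a <= t <= b -> curve_derive u t (u' t)) ->
  (forall t, a <= t <= b -> cabs (u' t) <= B) ->
  cabs (u b - u a) <= 2 * B * (b - a).
Proof.
move=> ab du ub.
have bnd (f : C -> R) : (forall t, a <= t <= b ->
      is_derive t (1 : R) (fun s => f (u s)) (f (u' t))) ->
    (forall z, `|f z| <= cabs z) -> `|f (u b) - f (u a)| <= B * (b - a).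
  move=> df fz.
  have [||c cab ->] := @MVT_segment R (fun s => f (u s)) (fun s => f (u' s)) a b ab.
  - move=> x xab; apply: df; have : x \in `[a, b]%R by exact: subset_itv_oo_cc.
    by rewrite in_itv.
  - apply: derivable_within_continuous => x; rewrite in_itv /= => xab.
    by have [] := df x xab.
  rewrite normrM [`|b - a|]ger0_norm ?subr_ge0 // ler_wpM2r ?subr_ge0 //.
  apply: le_trans (fz _) (ub _ _); by rewrite in_itv in cab.
apply: le_trans (cabs_le_ReIm _) _.
rewrite Re_add Im_add Re_opp Im_opp.
have h1 := bnd (@complex.Re R) (fun t tab => (du t tab).1) (@Re_le_cabs R).
have h2 := bnd (@complex.Im R) (fun t tab => (du t tab).2) (@Im_le_cabs R).
lra.
Qed.

Lemma curve_derive0_cst u (a b : R) : a <= b ->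
  (forall t, a <= t <= b -> curve_derive u t 0) -> u b = u a.
Proof.
move=> ab du; apply/eqP; rewrite -subr_eq0 -cabs_eq0 eq_le cabs_ge0 andbT.
have := @curve_mean_value u (fun=> 0) a b 0 ab du.
by rewrite mulr0 mul0r; apply => t _; rewrite cabs0.
Qed.

Lemma cabs_cis t : cabs (cis t) = 1.
Proof. by rewrite /cabs /= cos2Dsin2 sqrtr1. Qed.

Lemma cisD s t : cis (s + t) = cis s * cis t.
Proof.
apply: complex_ext; rewrite ?Re_mul ?Im_mul /= ?cosD ?sinD //; ring.
Qed.

Lemma cis2pi t : cis (t + pi *+ 2) = cis t.
Proof. by rewrite /cis cosD2pi sinD2pi. Qed.

Lemma polar_form (z : C) : exists t, z = (cabs z)%:C%C * cis t.
Proof.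
have [->|z0] := eqVneq z 0; first by exists 0; rewrite cabs0 mul0r.
have c0 : cabs z != 0 by rewrite cabs_eq0.
have cp : 0 < cabs z by rewrite lt_neqAle eq_sym c0 cabs_ge0.
pose x := Re z / cabs z; pose y := Im z / cabs z.
have xy : x ^+ 2 + y ^+ 2 = 1.
  by rewrite !expr_div_n -mulrDl -cabs_sqr divff // sqrf_eq0.
have x1 : -1 <= x <= 1.
  rewrite -ler_norml -(@ler_pXn2r _ 2) ?nnegrE // expr1n real_normK ?num_real //.
  by rewrite -xy lerDl sqr_ge0.
have zE t : cos t = x -> sin t = y -> z = (cabs z)%:C%C * cis t.
  move=> ct st; apply: complex_ext; rewrite ?Re_mul ?Im_mul /= ct st /x /y; field => //.
have sa : sin (acos x) = `|y|.
  rewrite sin_acos // -sqrtr_sqr; congr Num.sqrt; rewrite -xy; ring.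
have [y0|y0] := leP 0 y.
  by exists (acos x); apply: zE; rewrite ?acosK ?in_itv // sa ger0_norm.
exists (- acos x); apply: zE; rewrite ?cosN ?sinN ?acosK ?in_itv // sa.
by rewrite ltr0_norm // opprK.
Qed.

End CurveDerivatives.

(** * Goursat's theorem for rectangles in polar coordinates *)

Section Goursat.
Variable R : realType.
Notation C := (R[i]%C).

Definition polar (r t : R) : C := r%:C%C * cis t.

Lemma curve_derive_polar_radius r t : curve_derive (fun s => polar s t) r (cis t).
Proof.
have := curve_deriveM (curve_derive_real r) (curve_derive_cst (cis t) r).
by rewrite mulr0 add0r mul1r.
Qed.

Lemma curve_derive_polar_angle r t :
  curve_derive (fun s => polar r s) t (r%:C%C * ('i%C * cis t)).
Proof. exact: curve_deriveZ (curve_derive_cis t). Qed.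

Lemma cabs_polar r t : 0 <= r -> cabs (polar r t) = r.
Proof. by move=> r0; rewrite cabsM cabs_cis mulr1 cabs_real ger0_norm. Qed.

Lemma cabs_i : cabs ('i%C : C) = 1.
Proof. by rewrite /cabs /= expr0n /= add0r expr1n sqrtr1. Qed.

(** Complex differentiability without division; taking [z = z0] forces [h z0 = al + be * z0]. *)
Definition affine_approx (h : C -> C) (z0 : C) := exists al be : C,
  forall e : R, 0 < e -> exists2 d : R, 0 < d &
    forall z, cabs (z - z0) < d -> cabs (h z - (al + be * z)) <= e * cabs (z - z0).

Variables (h : C -> C) (A B : R -> R -> C).

Record rect := Rect { xmin : R; xmax : R; ymin : R; ymax : R }.

Definition in_rect q r t := (xmin q <= r <= xmax q) && (ymin q <= t <= ymax q).

Definition wf_rect q :=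
  [/\ 0 <= xmin q, xmin q <= xmax q, xmax q <= 1 & ymin q <= ymax q].

(* The boundary integral of [h z dz] over the image of [q] under [polar], in
   terms of radial ([A]) and angular ([B]) antiderivatives. *)
Definition boundary (q : rect) : C :=
  (A (ymin q) (xmax q) - A (ymin q) (xmin q)) +
  (B (xmax q) (ymax q) - B (xmax q) (ymin q)) -
  (A (ymax q) (xmax q) - A (ymax q) (xmin q)) -
  (B (xmin q) (ymax q) - B (xmin q) (ymin q)).

Definition antiderivatives q := forall r t, in_rect q r t ->
  curve_derive (A t) r (h (polar r t) * cis t) /\
  curve_derive (B r) t (h (polar r t) * (r%:C%C * ('i%C * cis t))).

(* An affine [al + be z] has a primitive, so only the error term contributes. *)
Lemma boundary_le q al be e : wf_rect q -> antiderivatives q ->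
  (forall r t, in_rect q r t ->
     cabs (h (polar r t) - (al + be * polar r t)) <= e) ->
  cabs (boundary q) <= 4 * e * ((xmax q - xmin q) + (ymax q - ymin q)).
Proof.
case: q => a b c d [/= a0 ab b1 cd] dAB he.
pose L z : C := al * z + be / 2 * (z * z).
have dL (g : R -> C) s l : curve_derive g s l ->
    curve_derive (fun s => L (g s)) s ((al + be * g s) * l).
  move=> dg.
  have := curve_deriveD (curve_deriveZ al dg) (curve_deriveZ (be / 2) (curve_deriveM dg dg)).
  by congr (curve_derive _ _ _); field.
have DA t : c <= t <= d ->
    cabs ((A t b - L (polar b t)) - (A t a - L (polar a t))) <= 2 * e * (b - a).
  move=> tcd; apply: (@curve_mean_value _ (fun r => A t r - L (polar r t))
    (fun r => (h (polar r t) - (al + be * polar r t)) * cis t)) => // r rab.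
    rewrite mulrBl; apply: curve_deriveB.
      by have [] := dAB r t; rewrite /in_rect /= ?rab.
    exact: dL (curve_derive_polar_radius r t).
  by rewrite cabsM cabs_cis mulr1 he // /in_rect /= rab.
have DB r : a <= r <= b ->
    cabs ((B r d - L (polar r d)) - (B r c - L (polar r c))) <= 2 * e * (d - c).
  move=> rab; apply: (@curve_mean_value _ (fun t => B r t - L (polar r t))
    (fun t => (h (polar r t) - (al + be * polar r t)) * (r%:C%C * ('i%C * cis t)))) => // t tcd.
    rewrite mulrBl; apply: curve_deriveB.
      by have [] := dAB r t; rewrite /in_rect /= ?rab.
    exact: dL (curve_derive_polar_angle r t).
  rewrite !cabsM cabs_cis cabs_i !mulr1 cabs_real.
  have hh := he r t; rewrite /in_rect /= rab tcd in hh.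
  have {}hh := hh isT.
  have /andP [ar rb] := rab.
  rewrite ger0_norm; last by lra.
  have := cabs_ge0 (h (polar r t) - (al + be * polar r t)).
  by nra.
have -> : boundary (Rect a b c d) =
  ((A c b - L (polar b c)) - (A c a - L (polar a c))) +
  ((B b d - L (polar b d)) - (B b c - L (polar b c))) -
  ((A d b - L (polar b d)) - (A d a - L (polar a d))) -
  ((B a d - L (polar a d)) - (B a c - L (polar a c))).
  by rewrite /boundary /=; ring.
have b3 x y z w : cabs (x + y - z - w) <= cabs x + cabs y + cabs z + cabs w :> R.
  apply: le_trans (cabsD _ _) _; rewrite cabsN lerD2r.
  apply: le_trans (cabsD _ _) _; rewrite cabsN lerD2r.
  exact: cabsD.
apply: le_trans (b3 _ _ _ _) _.
have h1 := DA c; have h2 := DA d; have h3 := DB a; have h4 := DB b.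
rewrite !lexx ?ab ?cd /= in h1 h2 h3 h4.
have {}h1 := h1 isT; have {}h2 := h2 isT; have {}h3 := h3 isT; have {}h4 := h4 isT.
rewrite /=; lra.
Qed.

Lemma boundary_split_radius a m b c d :
  boundary (Rect a b c d) = boundary (Rect a m c d) + boundary (Rect m b c d).
Proof. by rewrite /boundary /=; ring. Qed.

Lemma boundary_split_angle a b c m d :
  boundary (Rect a b c d) = boundary (Rect a b c m) + boundary (Rect a b m d).
Proof. by rewrite /boundary /=; ring. Qed.

Definition quarter (q q' : rect) :=
  [/\ xmin q <= xmin q', xmax q' <= xmax q, ymin q <= ymin q' & ymax q' <= ymax q] /\
  [/\ xmax q' - xmin q' = (xmax q - xmin q) / 2,
      ymax q' - ymin q' = (ymax q - ymin q) / 2 &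
      cabs (boundary q) <= 4 * cabs (boundary q')].

(** Bisect in the radius, then in the angle; each time one half carries at least half of the modulus
    of the boundary integral. *)
Lemma exists_quarter q : wf_rect q -> exists q', quarter q q'.
Proof.
case: q => a b c d [/= a0 ab b1 cd].
pose m := (a + b) / 2; pose n := (c + d) / 2.
have half (x y z : C) : z = x + y ->
    cabs z <= 2 * cabs x \/ cabs z <= 2 * cabs y.
  move=> ->; have := cabsD x y.
  by have [xy|/ltW xy] := leP (cabs x) (cabs y) => H; [right|left]; lra.
have [a' [b' [h1 h2 h3 h4]]] : exists a' b', [/\ a <= a', b' <= b,
    b' - a' = (b - a) / 2 &
    cabs (boundary (Rect a b c d)) <= 2 * cabs (boundary (Rect a' b' c d))].
  by have [H|H] := half _ _ _ (boundary_split_radius a m b c d);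
    [exists a, m|exists m, b]; split => //; rewrite /m; lra.
have [c' [d' [k1 k2 k3 k4]]] : exists c' d', [/\ c <= c', d' <= d,
    d' - c' = (d - c) / 2 &
    cabs (boundary (Rect a' b' c d)) <= 2 * cabs (boundary (Rect a' b' c' d'))].
  by have [H|H] := half _ _ _ (boundary_split_angle a' b' c n d);
    [exists c, n|exists n, d]; split => //; rewrite /n; lra.
exists (Rect a' b' c' d'); split; split => //=; lra.
Qed.

Lemma polar_lipschitz r t r0 t0 : 0 <= r <= 1 -> 0 <= r0 <= 1 ->
  cabs (polar r t - polar r0 t0) <= 2 * (`|r - r0| + `|t - t0|).
Proof.
move=> /andP[r0' r1] /andP[r00 r01].
have -> : polar r t - polar r0 t0 = (r - r0)%:C%C * cis t + r0%:C%C * (cis t - cis t0).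
  by rewrite /polar rmorphB /=; ring.
apply: le_trans (cabsD _ _) _; rewrite !cabsM cabs_cis mulr1 !cabs_real.
have H x y : x <= y -> cabs (cis y - cis x) <= 2 * 1 * (y - x) :> R.
  move=> xy; apply: (@curve_mean_value _ (@cis R) (fun t => 'i%C * cis t)) => // s _.
    exact: curve_derive_cis.
  by rewrite cabsM cabs_cis cabs_i mulr1.
have {}H : cabs (cis t - cis t0) <= 2 * `|t - t0|.
  have [tt|/ltW tt] := leP t0 t.
    by rewrite ger0_norm ?subr_ge0 //; have := H _ _ tt; lra.
  by rewrite cabsB distrC ger0_norm ?subr_ge0 //; have := H _ _ tt; lra.
have := cabs_ge0 (cis t - cis t0); have := normr_ge0 (r - r0).
by rewrite [`|r0|]ger0_norm //; nra.
Qed.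

Theorem goursat q : wf_rect q -> antiderivatives q ->
  (forall r t, in_rect q r t -> affine_approx h (polar r t)) ->
  boundary q = 0.
Proof.
move=> wfq dAB hq; apply/eqP; rewrite -cabs_eq0; apply/negPn/negP => J0.
have {J0} J0 : 0 < cabs (boundary q) by rewrite lt_neqAle eq_sym J0 cabs_ge0.
have /choice [next nextP] : forall q, exists q', wf_rect q -> quarter q q'.
  move=> p; have [/exists_quarter [p' ?]|np] := pselect (wf_rect p).
    by exists p'.
  by exists p => /np.
pose Q n := iter n next q.
have wfQ n : wf_rect (Q n).
  elim: n => //= n IH; have [[h1 h2 h3 h4] [h5 h6 _]] := nextP _ IH.
  case: IH => k1 k2 k3 k4; split; lra.
have QS n : quarter (Q n) (Q n.+1) by apply: nextP.
have nest n m : [/\ xmin (Q n) <= xmin (Q (n + m)%N), xmax (Q (n + m)%N) <= xmax (Q n),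
    ymin (Q n) <= ymin (Q (n + m)%N) & ymax (Q (n + m)%N) <= ymax (Q n)].
  elim: m => [|m [h1 h2 h3 h4]]; first by rewrite addn0.
  by rewrite addnS; have [[k1 k2 k3 k4] _] := QS (n + m)%N; split; lra.
have cross n m : xmin (Q n) <= xmax (Q m) /\ ymin (Q n) <= ymax (Q m).
  have [h1 h2 h3 h4] := nest n m; have [k1 k2 k3 k4] := nest m n.
  rewrite addnC in k1 k2 k3 k4.
  have [_ w1 _ w2] := wfQ (n + m)%N; split; lra.
have size n : [/\ xmax (Q n) - xmin (Q n) = (xmax q - xmin q) / 2 ^+ n,
    ymax (Q n) - ymin (Q n) = (ymax q - ymin q) / 2 ^+ n &
    cabs (boundary q) <= 4 ^+ n * cabs (boundary (Q n))].
  elim: n => [|n [h1 h2 h3]]; first by rewrite expr0 !divr1 mul1r.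
  have [_ [-> -> k3]] := QS n; rewrite h1 h2 !exprS; split.
  - by rewrite invfM mulrAC mulrA.
  - by rewrite invfM mulrAC mulrA.
  - apply: le_trans h3 _; rewrite [4 * _]mulrC -mulrA.
    by apply: ler_wpM2l k3; rewrite exprn_ge0.
(* Every lower end is below every upper end, so the suprema of the lower ends give a point common to
   all the rectangles. *)
pose X := [set xmin (Q n) | n in [set: nat]].
pose Y := [set ymin (Q n) | n in [set: nat]].
have supX : has_sup X.
  split; first by exists (xmin (Q 0%N)), 0%N.
  by exists (xmax (Q 0%N)) => _ [n _ <-]; case: (cross n 0%N).
have supY : has_sup Y.
  split; first by exists (ymin (Q 0%N)), 0%N.
  by exists (ymax (Q 0%N)) => _ [n _ <-]; case: (cross n 0%N).
pose r0 := sup X; pose t0 := sup Y.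
have inQ n : in_rect (Q n) r0 t0.
  apply/andP; split; apply/andP; split.
  - by apply: ub_le_sup; [case: supX | exists n].
  - by apply: ge_sup; [case: supX | move=> _ [m _ <-]; case: (cross m n)].
  - by apply: ub_le_sup; [case: supY | exists n].
  - by apply: ge_sup; [case: supY | move=> _ [m _ <-]; case: (cross m n)].
have [al [be hab]] := hq _ _ (inQ 0%N).
pose s := (xmax q - xmin q) + (ymax q - ymin q).
have s0 : 0 <= s by case: wfq => w1 w2 w3 w4; rewrite /s; lra.
have s20 : 0 < 8 * s ^+ 2 + 1 by have := sqr_ge0 s; lra.
(* The sides of [Q n] sum to [s / 2^n] and the affine error there is at most [2 e s / 2^n]. With the
   factor [4^n], [boundary_le] bounds the whole integral by [8 e s^2], which this [e] makes smaller
   than the integral; the [+ 1] covers [s = 0]. *)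
pose e := cabs (boundary q) / (8 * s ^+ 2 + 1).
have e0 : 0 < e by rewrite divr_gt0.
have [d d0 hd] := hab e e0.
pose n := Num.bound (2 * s / d).
have p2 : 0 < 2 ^+ n :> R by rewrite exprn_gt0.
have small : 2 * (s / 2 ^+ n) < d.
  rewrite mulrA ltr_pdivrMr // [ltRHS]mulrC -ltr_pdivrMr //.
  apply: lt_trans (archi_boundP _) _; first by rewrite divr_ge0 ?mulr_ge0 // ltW.
  by have := ltn_expl n (isT : (1 < 2)%N); rewrite -(ltr_nat R) natrX.
have [sx sy sJ] := size n.
have := inQ n; rewrite /in_rect => /andP[/andP[i1 i2] /andP[i3 i4]].
have [w1 w2 w3 w4] := wfQ n.
have sn : (xmax (Q n) - xmin (Q n)) + (ymax (Q n) - ymin (Q n)) = s / 2 ^+ n.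
  by rewrite sx sy -mulrDl.
have : cabs (boundary (Q n)) <= 4 * (e * (2 * (s / 2 ^+ n))) * (s / 2 ^+ n).
  rewrite -{2}sn; apply: (@boundary_le _ al be) => //.
    move=> r t /andP[/andP[j1 j2] /andP[j3 j4]]; apply: dAB.
    have [n1 n2 n3 n4] := nest 0%N n; rewrite add0n /Q /= -/(Q n) in n1 n2 n3 n4.
    by apply/andP; split; apply/andP; split; lra.
  move=> r t /andP[/andP[j1 j2] /andP[j3 j4]].
  have dist : cabs (polar r t - polar r0 t0) <= 2 * (s / 2 ^+ n).
    apply: le_trans (polar_lipschitz _ _ _ _) _; try (apply/andP; split; lra).
    rewrite ler_pM2l // -sn; apply: lerD; rewrite ler_norml; apply/andP; split; lra.
  apply: le_trans (hd _ (le_lt_trans dist small)) _.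
  by rewrite ler_pM2l.
move=> bQ; have : cabs (boundary q) <= 8 * e * s ^+ 2.
  apply: le_trans sJ _.
  have -> : 8 * e * s ^+ 2 = 4 ^+ n * (4 * (e * (2 * (s / 2 ^+ n))) * (s / 2 ^+ n)).
    have -> : (4 : R) ^+ n = 2 ^+ n * 2 ^+ n by rewrite -exprMn -natrM.
    by field; rewrite gt_eqF.
  by rewrite ler_wpM2l // exprn_ge0.
have eE : e * (8 * s ^+ 2 + 1) = cabs (boundary q) by rewrite /e divfK // gt_eqF.
rewrite -eE; lra.
Qed.

End Goursat.

Section DiskFunctions.
Variable R : realType.
Notation C := (R[i]%C).

Definition cabs_continuous_at (f : C -> C) (z : C) := forall e : R, 0 < e ->
  exists2 d : R, 0 < d & forall w, cabs (w - z) < d -> cabs (f w - f z) < e.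

Lemma gtc0_real (e : C) : 0 < e -> exists2 d : R, 0 < d & e = d%:C%C.
Proof.
move=> e0; have /complex_realP [d de] : e \is Num.real by rewrite gtr0_real.
by exists d => //; move: e0; rewrite de ltcR.
Qed.

Lemma differentiable_affine_approx (f : CC R -> CC R) (z : CC R) :
  differentiable f z -> affine_approx f z.
Proof.
move=> /derivable1_diffP/cvg_ex[l] /cvgrPdist_lt fl.
exists (f z - l * z), l => e e0.
have e0' : 0 < (e%:C%C : CC R) by rewrite ltcR.
have := fl _ e0'; rewrite near_withinE => /nbhs_ballP [d' /= d'0 dH].
have [d d0 dE] := gtc0_real d'0.
exists d => // w wz.
have [->|wz0] := eqVneq w z.
  have -> : f z - (f z - l * z + l * z) = 0 by ring.
  by rewrite subrr cabs0 mulr0.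
have kz0 : w - z != 0 by rewrite subr_eq0.
have := dH (w - z); rewrite -ball_normE /= sub0r normrN cabsE dE ltcR => /(_ wz kz0).
rewrite cabsE ltcR => H.
have -> : f w - (f z - l * z + l * w) =
    - ((l - (w - z)^-1 *: (f ((w - z) *: 1 + z) - f z)) * (w - z)).
  have -> : (w - z) *: (1 : CC R) + z = w by rewrite /GRing.scale /= mulr1 subrK.
  by rewrite /GRing.scale /=; field.
by rewrite cabsN cabsM ler_wpM2r ?cabs_ge0 // ltW.
Qed.

Lemma affine_approx_continuous (f : C -> C) z :
  affine_approx f z -> cabs_continuous_at f z.
Proof.
move=> [al [be H]] e e0.
have fz : f z = al + be * z.
  apply/eqP; rewrite -subr_eq0 -cabs_eq0 eq_le cabs_ge0 andbT.
  have [d d0 dH] := H 1 ltr01.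
  by have := dH z; rewrite subrr cabs0 mulr0; apply.
have [d d0 dH] := H 1 ltr01.
have K0 : 0 < 1 + cabs be by have := cabs_ge0 be; lra.
have q0 : 0 < e / (1 + cabs be) by rewrite divr_gt0.
exists (Num.min d (e / (1 + cabs be))); first by rewrite lt_min d0.
move=> w; rewrite lt_min => /andP[wd we].
have -> : f w - f z = (f w - (al + be * w)) + be * (w - z) by rewrite fz; ring.
apply: le_lt_trans (cabsD _ _) _; rewrite cabsM.
have := dH w wd; rewrite mul1r => h1.
move: we; rewrite ltr_pdivlMr // => we; lra.
Qed.

Lemma curve_continuous (f : C -> C) (c : R -> C) :
  (forall s, continuous_at s (fun s => Re (c s))) ->
  (forall s, continuous_at s (fun s => Im (c s))) ->
  (forall s, cabs_continuous_at f (c s)) ->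
  continuous (fun s => Re (f (c s))) /\ continuous (fun s => Im (f (c s))).
Proof.
move=> c1 c2 cf.
suff H s (e : R) : 0 < e -> \forall t \near s, cabs (f (c t) - f (c s)) < e.
  split=> s; apply/cvgrPdist_lt => e e0; near=> t.
    rewrite distrC -Re_opp -Re_add; apply: le_lt_trans (Re_le_cabs _) _.
    by near: t; exact: H.
  rewrite distrC -Im_opp -Im_add; apply: le_lt_trans (Im_le_cabs _) _.
  by near: t; exact: H.
move=> e0; have [d d0 dH] := cf s e e0.
have d20 : 0 < d / 2 by rewrite divr_gt0.
have /cvgrPdist_lt/(_ _ d20) n1 := c1 s.
have /cvgrPdist_lt/(_ _ d20) n2 := c2 s.
near=> t; apply: dH; apply: le_lt_trans (cabs_le_ReIm _) _.
rewrite Re_add Im_add Re_opp Im_opp [`|Re _ - _|]distrC [`|Im _ - _|]distrC.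
have h1 : `|Re (c s) - Re (c t)| < d / 2 by near: t.
have h2 : `|Im (c s) - Im (c t)| < d / 2 by near: t.
by lra.
Unshelve. all: by end_near. Qed.

End DiskFunctions.

Section CircleIntegrals.
Variable R : realType.
Notation C := (R[i]%C).

Lemma cabs_continuousM (f k : C -> C) z : cabs_continuous_at f z ->
  cabs_continuous_at k z -> cabs_continuous_at (fun w => f w * k w) z.
Proof.
move=> cf ck e e0.
pose K := cabs (f z) + cabs (k z) + 1.
have K0 : 0 < K by have := cabs_ge0 (f z); have := cabs_ge0 (k z); rewrite /K; lra.
pose m := Num.min 1 (e / (2 * K)).
have m0 : 0 < m by rewrite lt_min ltr01 divr_gt0 // mulr_gt0.
have [d1 d10 H1] := cf m m0; have [d2 d20 H2] := ck m m0.
exists (Num.min d1 d2); first by rewrite lt_min d10.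
move=> w; rewrite lt_min => /andP[/H1 h1 /H2 h2].
have -> : f w * k w - f z * k z = (f w - f z) * (k w - k z) +
    (f w - f z) * k z + f z * (k w - k z) by ring.
have mK : m * K <= e / 2.
  have : m <= e / (2 * K) by rewrite ge_min lexx orbT.
  by rewrite -(ler_pM2r K0) => H; apply: le_trans H _;
    rewrite le_eqVlt; apply/orP; left; apply/eqP; field; rewrite gt_eqF.
have m1 : m <= 1 by rewrite ge_min lexx.
apply: le_lt_trans (cabsD _ _) _.
have := cabsD ((f w - f z) * (k w - k z)) ((f w - f z) * k z).
rewrite !cabsM; rewrite /K in mK.
have a0 := cabs_ge0 (f w - f z); have b0 := cabs_ge0 (k w - k z).
have c0 := cabs_ge0 (f z); have d0 := cabs_ge0 (k z).
set x := cabs (f w - f z) in h1 a0 *; set y := cabs (k w - k z) in h2 b0 *.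
set p := cabs (f z) in c0 mK *; set q := cabs (k z) in d0 mK *.
have xy : x * y <= m by nra.
have xq : x * q <= m * q by nra.
have py : p * y <= p * m by nra.
lra.
Qed.

Lemma cabs_continuous_cst (c z : C) : cabs_continuous_at (fun=> c) z.
Proof. by move=> e e0; exists 1 => // w _; rewrite subrr cabs0. Qed.

Lemma cabs_continuous_id (z : C) : cabs_continuous_at id z.
Proof. by move=> e e0; exists e. Qed.

Lemma polarE (r t : R) : polar r t = (r * cos t +i* (r * sin t))%C.
Proof. by apply: complex_ext; rewrite /polar ?Re_mul ?Im_mul /=; ring. Qed.

Variable rho : R.
Hypothesis rho01 : 0 < rho < 1.

(** [curve_antiderivative] wants continuity on the whole line, while [h] is continuous in the open
    disk only; clamping the radius keeps the argument inside and changes nothing on [[0, rho]]. *)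
Let clamp (s : R) := Num.max 0 (Num.min s rho).

Let clamp_id s : 0 <= s <= rho -> clamp s = s.
Proof. by case/andP => s0 s1; rewrite /clamp min_l // max_r. Qed.

Let clamp_bound s : 0 <= clamp s <= rho.
Proof.
case/andP: rho01 => r0 _.
by rewrite /clamp le_max lexx ge_max ge_min lexx orbT (ltW r0).
Qed.

Let clamp_lip s t : `|clamp s - clamp t| <= `|s - t|.
Proof.
rewrite /clamp /Num.max /Num.min; case/andP: rho01 => r0 r1.
have n1 := ler_norm (s - t); have n2 := ler_norm (t - s); rewrite distrC in n2.
case: (ltP s rho) => h1; case: (ltP t rho) => h2;
  try case: (ltP 0 s) => h3; try case: (ltP 0 t) => h4;
  try case: (ltP 0 rho) => h5;
  rewrite ler_norml; apply/andP; split; lra.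
Qed.

Let clamp_continuous : continuous clamp.
Proof.
move=> s; apply/cvgrPdist_lt => e e0; near=> t.
apply: le_lt_trans (clamp_lip _ _) _.
by near: t; apply/nbhs_normP; exists e.
Unshelve. all: by end_near. Qed.

Lemma polar_antiderivatives (h : C -> C) :
  (forall z, cabs z < 1 -> cabs_continuous_at h z) ->
  exists A B : R -> R -> C, forall r t, 0 <= r <= rho ->
    curve_derive (A t) r (h (polar r t) * cis t) /\
    curve_derive (B r) t (h (polar r t) * (r%:C%C * ('i%C * cis t))).
Proof.
move=> ch; case/andP: (rho01) => rho0 rho1.
have ch' r t : 0 <= r <= rho -> cabs_continuous_at h (polar r t).
  by move=> /andP[r0 r1]; apply: ch; rewrite cabs_polar //; lra.
have /choice [A HA] : forall t, exists At, forall r,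
    curve_derive At r (h (polar (clamp r) t) * cis t).
  move=> t; have [] := @curve_continuous R (fun z => h z * cis t)
    (fun r => polar (clamp r) t).
  - move=> s; under eq_fun do rewrite polarE /=.
    by apply: cvgM; [exact: clamp_continuous | exact: cvg_cst].
  - move=> s; under eq_fun do rewrite polarE /=.
    by apply: cvgM; [exact: clamp_continuous | exact: cvg_cst].
  - move=> s; apply: cabs_continuousM; last exact: cabs_continuous_cst.
    exact: ch'.
  - exact: curve_antiderivative.
have /choice [B HB] : forall r, exists Br, 0 <= r <= rho -> forall t,
    curve_derive Br t (h (polar r t) * ('i%C * polar r t)).
  move=> r; have [rr|nr] := pselect (0 <= r <= rho); last by exists (fun=> 0) => /nr.
  have [] := @curve_continuous R (fun z => h z * ('i%C * z))
    (fun t => polar r t).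
  - move=> s; under eq_fun do rewrite polarE /=.
    by apply: cvgM; [exact: cvg_cst | exact: continuous_cos].
  - move=> s; under eq_fun do rewrite polarE /=.
    by apply: cvgM; [exact: cvg_cst | exact: continuous_sin].
  - move=> s; apply: cabs_continuousM; first exact: ch'.
    by apply: cabs_continuousM; [exact: cabs_continuous_cst|exact: cabs_continuous_id].
  - by move=> c1 c2; have [U HU] := curve_antiderivative c1 c2; exists U.
exists A, B => r t rr; split.
  by have := HA t r; rewrite clamp_id.
by have := HB r rr t; congr (curve_derive _ _ (_ * _)); rewrite /polar; ring.
Qed.

End CircleIntegrals.

Section Cauchy.
Variable R : realType.
Notation C := (R[i]%C).

Lemma curve_derive_shift (u : R -> C) (t p : R) (l : C) :
  curve_derive u (t + p) l -> curve_derive (fun s => u (s + p)) t l.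
Proof.
move=> [h1 h2]; split.
  have := @is_derive1_comp R (fun s => Re (u s)) (shift p) t _ _ h1 (is_derive_shift t 1 p).
  by rewrite mulr1.
have := @is_derive1_comp R (fun s => Im (u s)) (shift p) t _ _ h2 (is_derive_shift t 1 p).
by rewrite mulr1.
Qed.

Lemma cis_eq1 (x : R) : `|x| <= pi -> cis x = 1 -> x = 0.
Proof.
move=> xpi [c1 _]; apply/eqP; rewrite -normr_eq0; apply/eqP.
have cx : cos `|x| = 1.
  rewrite -c1; have [x0|x0] := leP 0 x; first by rewrite ger0_norm.
  by rewrite ltr0_norm // cosN.
apply: cos_inj; rewrite ?in_itv /= ?normr_ge0 ?xpi ?lexx ?pi_ge0 //.
by rewrite cx cos0.
Qed.

(* The exceptional point [a] is enclosed in a small polar rectangle, on whose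
   boundary the integral is small; the rest of the disk is cut into four polar
   rectangles to which [goursat] applies. *)
Lemma cauchy_circle (h : C -> C) (a : C) (rho : R) :
  cabs a < rho -> rho < 1 -> a != 0 ->
  (forall z, cabs z < 1 -> cabs_continuous_at h z) ->
  (forall z, cabs z < 1 -> z != a -> affine_approx h z) ->
  exists U : R -> C,
    (forall t, curve_derive U t (h (polar rho t) * (rho%:C%C * ('i%C * cis t)))) /\
    U (pi *+ 2) = U 0.
Proof.
move=> arho rho1 a0 ch dh.
have a_gt0 : 0 < cabs a by rewrite lt_neqAle eq_sym cabs_eq0 a0 cabs_ge0.
have rho0 : 0 < rho by apply: lt_trans arho.
have rho01 : 0 < rho < 1 by rewrite rho0.
have [A [B AB]] := polar_antiderivatives rho01 ch.
have [th aE] := polar_form a.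
have pi0 := pi_gt0 R.
pose J := boundary A B.
have rE r t : 0 <= r -> polar r t = a -> r = cabs a.
  by move=> r0 <-; rewrite cabs_polar.
have tE t : polar (cabs a) t = a -> `|t - th| <= pi -> t = th.
  move=> ta tt; apply/eqP; rewrite -subr_eq0; apply/eqP; apply: cis_eq1 => //.
  have : (cabs a)%:C%C * cis t = (cabs a)%:C%C * cis th by rewrite -aE.
  have a0' : (cabs a)%:C%C != 0 :> C by rewrite (inj_eq (@complexI R) _ 0) gt_eqF.
  move=> /(mulfI a0') tth; rewrite cisD tth -cisD subrr.
  by rewrite /cis cos0 sin0.
have AD q : 0 <= xmin q -> xmax q <= rho -> antiderivatives h A B q.
  move=> q0 q1 r t /andP[/andP[h1 h2] _]; apply: AB; lra.
have J0 : J (Rect 0 rho (th - pi) (th + pi)) = 0.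
  apply/eqP; rewrite -cabs_eq0; apply/negPn/negP => Jn.
  have {Jn} Jp : 0 < cabs (J (Rect 0 rho (th - pi) (th + pi))).
    by rewrite lt_neqAle eq_sym Jn cabs_ge0.
  have [d d0 dH] := ch a (lt_trans arho rho1) 1 ltr01.
  pose K := cabs (h a) + 1.
  have K0 : 0 < K by have := cabs_ge0 (h a); rewrite /K; lra.
  (* Half-size of the rectangle around [a]. The first three bounds keep it inside the large one and
     off the origin; [d / 8] puts it where [h] is within 1 of [h a]. Its integral is at most
     [16 K de], which the last bound makes at most half of the integral that it equals. *)
  pose de := Num.min (Num.min (cabs a / 2) ((rho - cabs a) / 2))
    (Num.min (pi / 2) (Num.min (d / 8)
      (cabs (J (Rect 0 rho (th - pi) (th + pi))) / (32 * K)))).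
  have de0 : 0 < de.
    by rewrite !lt_min !divr_gt0 //= ?subr_gt0 // mulr_gt0.
  have [d1 [d2 [d3 [d4 d5]]]] : de <= cabs a / 2 /\ de <= (rho - cabs a) / 2 /\
      de <= pi / 2 /\ de <= d / 8 /\
      de <= cabs (J (Rect 0 rho (th - pi) (th + pi))) / (32 * K).
    by rewrite /de !ge_min !lexx !orbT.
  pose m := cabs a - de; pose M := cabs a + de.
  have zero q : wf_rect q -> xmax q <= rho ->
      (forall r t, in_rect q r t -> polar r t <> a) -> J q = 0.
    move=> wq q1 qa; have [w1 w2 w3 w4] := wq.
    apply: (@goursat R h A B q wq (AD _ w1 q1)).
    move=> r t rt; have /andP[/andP[h1 h2] _] := rt; apply: dh.
      rewrite cabs_polar; lra.
    by apply/eqP/qa.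
  have z1 : J (Rect 0 m (th - pi) (th + pi)) = 0.
    apply: zero => /=; rewrite /m; [split => /=; lra|lra|].
    move=> r t /andP[/andP[/= h1 h2] _] /(rE _ _ h1); lra.
  have z2 : J (Rect M rho (th - pi) (th + pi)) = 0.
    apply: zero => /=; rewrite /M; [split => /=; lra|lra|].
    move=> r t /andP[/andP[/= h1 h2] _] pa.
    have r0 : 0 <= r by lra.
    have := rE _ _ r0 pa; lra.
  have near_th t : th - pi <= t <= th + pi -> `|t - th| <= pi.
    by move=> /andP[h1 h2]; rewrite ler_norml; apply/andP; split; lra.
  have z3 : J (Rect m M (th - pi) (th - de)) = 0.
    apply: zero => /=; rewrite /m /M; [split => /=; lra|lra|].
    move=> r t /andP[/andP[/= h1 h2] /andP[/= h3 h4]] pa.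
    have r0 : 0 <= r by lra.
    have ra := rE _ _ r0 pa; rewrite ra in pa.
    have := tE t pa; rewrite near_th; last by apply/andP; split; lra.
    by move=> /(_ isT); lra.
  have z4 : J (Rect m M (th + de) (th + pi)) = 0.
    apply: zero => /=; rewrite /m /M; [split => /=; lra|lra|].
    move=> r t /andP[/andP[/= h1 h2] /andP[/= h3 h4]] pa.
    have r0 : 0 <= r by lra.
    have ra := rE _ _ r0 pa; rewrite ra in pa.
    have := tE t pa; rewrite near_th; last by apply/andP; split; lra.
    by move=> /(_ isT); lra.
  have Jsmall : J (Rect 0 rho (th - pi) (th + pi)) = J (Rect m M (th - de) (th + de)).
    rewrite /J (boundary_split_radius _ _ 0 m) -/J z1 add0r.
    rewrite /J (boundary_split_radius _ _ m M) -/J z2 addr0.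
    rewrite /J (boundary_split_angle _ _ m M (th - pi) (th - de)) -/J z3 add0r.
    by rewrite /J (boundary_split_angle _ _ m M _ (th + de)) -/J z4 addr0.
  have : cabs (J (Rect m M (th - de) (th + de))) <= 4 * K * ((M - m) + ((th + de) - (th - de))).
    apply: (@boundary_le R h A B (Rect m M (th - de) (th + de)) 0 0).
    - by split => /=; rewrite /m /M; lra.
    - by apply: AD => /=; rewrite /m /M; lra.
    - move=> r t /andP[/andP[/= h1 h2] /andP[/= h3 h4]].
      rewrite mul0r addr0 subr0.
      have r0 : 0 <= r by rewrite /m in h1; lra.
      have r1 : 0 <= r <= 1 by apply/andP; split; rewrite /M in h2; lra.
      have a1 : 0 <= cabs a <= 1 by apply/andP; split; lra.
      have : cabs (polar r t - a) < d.
        rewrite {1}aE -/(polar (cabs a) th).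
        apply: le_lt_trans (polar_lipschitz t th r1 a1) _.
        have : `|r - cabs a| <= de.
          by rewrite ler_norml; apply/andP; split; rewrite /m /M in h1 h2; lra.
        have : `|t - th| <= de by rewrite ler_norml; apply/andP; split; lra.
        by lra.
      move=> /dH ha; rewrite -(subrK (h a) (h (polar r t))).
      by apply: le_trans (cabsD _ _) _; rewrite /K; lra.
  rewrite -Jsmall /M /m => H.
  rewrite ler_pdivlMr ?mulr_gt0 // in d5.
  have : 0 < de * K by rewrite mulr_gt0.
  by nra.
have HB t : curve_derive (B rho) t (h (polar rho t) * (rho%:C%C * ('i%C * cis t))).
  by have [] := AB rho t; rewrite ?lexx ?ltW.
have thE : th + pi = (th - pi) + pi *+ 2 by rewrite mulr2n; ring.
(* The radial sides at [th - pi] and [th + pi] coincide in the plane and cancel, and the inner side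
   has radius 0; what remains of [J0] is the integral over the circle. *)
have Asides : A (th + pi) rho - A (th + pi) 0 = A (th - pi) rho - A (th - pi) 0.
  have : A (th + pi) rho - A (th - pi) rho = A (th + pi) 0 - A (th - pi) 0.
    apply: (@curve_derive0_cst _ (fun r => A (th + pi) r - A (th - pi) r)).
      exact: ltW.
    move=> r rr; have [d1 _] := AB r (th + pi) rr.
    have [d2 _] := AB r (th - pi) rr.
    have := curve_deriveB d1 d2; congr (curve_derive _ _ _).
    by rewrite /polar thE cis2pi subrr.
  move=> E; apply/eqP; rewrite -subr_eq0; apply/eqP.
  by rewrite -[RHS](subrr (A (th + pi) rho - A (th - pi) rho)) {2}E; ring.
have B0 : B 0 (th + pi) = B 0 (th - pi).
  apply: (@curve_derive0_cst _ (B 0)); first by lra.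
  move=> t _; have [|_] := AB 0 t; first by rewrite lexx ltW.
  by rewrite mul0r mulr0.
have Brho : B rho (th + pi) = B rho (th - pi).
  apply/eqP; rewrite -subr_eq0 -J0 /J /boundary /= Asides B0.
  by apply/eqP; ring.
exists (B rho); split => //.
(* By periodicity the increment over one period has derivative zero, so the window
   [[th - pi, th + pi]] may be moved to [[0, 2 pi]]. *)
have shift s t : s <= t ->
    B rho (t + pi *+ 2) - B rho t = B rho (s + pi *+ 2) - B rho s.
  move=> st; apply: (@curve_derive0_cst _ (fun t => B rho (t + pi *+ 2) - B rho t)) => // u _.
  rewrite -(subrr (h (polar rho u) * (rho%:C%C * ('i%C * cis u)))).
  apply: curve_deriveB => //.
  by apply: curve_derive_shift; have := HB (u + pi *+ 2); rewrite /polar cis2pi.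
apply/eqP; rewrite -subr_eq0 -[pi *+ 2]add0r.
have [h0|/ltW h0] := leP 0 (th - pi).
  by rewrite -(shift _ _ h0) -thE Brho subrr.
by rewrite (shift _ _ h0) -thE Brho subrr.
Qed.

End Cauchy.

(** * Taylor approximation with an explicit remainder *)

Section Taylor.
Variable R : realType.
Notation C := (R[i]%C).

Lemma affine_approxE (f : C -> C) z al be :
  (forall e : R, 0 < e -> exists2 d : R, 0 < d & forall w, cabs (w - z) < d ->
     cabs (f w - (al + be * w)) <= e * cabs (w - z)) -> f z = al + be * z.
Proof.
move=> H; apply/eqP; rewrite -subr_eq0 -cabs_eq0 eq_le cabs_ge0 andbT.
by have [d d0 dH] := H 1 ltr01; have := dH z; rewrite subrr cabs0 mulr0; apply.
Qed.

(** At [a] the quotient gets the derivative as value, and there only its continuity is elementary;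
    this is the exceptional point that [cauchy_circle] allows. *)
Lemma difference_quotient (g : C -> C) (a : C) : cabs a < 1 ->
  (forall z : CC R, cabs z < 1 -> differentiable (g : CC R -> CC R) z) ->
  exists h : C -> C, [/\ forall z, h z * (z - a) = g z - g a,
    forall z, cabs z < 1 -> cabs_continuous_at h z &
    forall z, cabs z < 1 -> z != a -> affine_approx h z].
Proof.
move=> a1 gd; have [al [be ga]] := differentiable_affine_approx (gd a a1).
have gaE := affine_approxE ga.
pose h z : C := if z == a then be else (g z - g a) / (z - a).
have hE z : z != a -> h z = (g z - g a) / (z - a) by move=> za; rewrite /h (negPf za).
have ha : h a = be by rewrite /h eqxx.
have dh z : cabs z < 1 -> z != a -> affine_approx h z.
  move=> z1 za.
  have za0 : z - a != 0 by rewrite subr_eq0.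
  have did : differentiable (id : CC R -> CC R) (z : CC R).
    by apply/derivable1_diffP; exact: derivable_id.
  have dg := @differentiableB _ (CC R) (CC R) g (cst (g a)) z (gd z z1) (differentiable_cst _ _).
  have dm := @differentiableB _ (CC R) (CC R) id (cst (a : CC R)) z
    did (differentiable_cst _ _).
  have := @differentiableM _ (CC R) _ _ z dg (@differentiableV _ (CC R) _ z dm za0).
  move=> /differentiable_affine_approx [al' [be' H]].
  exists al', be' => e e0; have [d d0 dH] := H e e0.
  have p0 : 0 < cabs (z - a) by rewrite lt_neqAle eq_sym cabs_eq0 za0 cabs_ge0.
  exists (Num.min d (cabs (z - a))); first by rewrite lt_min d0.
  move=> w; rewrite lt_min => /andP[/dH wd wa].
  rewrite hE //; apply: contraTneq wa => ->.
  by rewrite cabsB ltxx.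
exists h; split => // [z|z z1].
  have [->|za] := eqVneq z a; first by rewrite !subrr mulr0.
  by rewrite hE // divfK // subr_eq0.
have [->|za] := eqVneq z a; last exact/affine_approx_continuous/dh.
move=> e e0; have e20 : 0 < e / 2 by rewrite divr_gt0.
have [d d0 dH] := ga _ e20.
exists d => // w wa; rewrite ha.
have [->|wn] := eqVneq w a; first by rewrite ha subrr cabs0.
rewrite hE //; have w0 : w - a != 0 by rewrite subr_eq0.
have -> : (g w - g a) / (w - a) - be = (g w - (al + be * w)) / (w - a).
  by rewrite gaE; field.
have p0 : 0 < cabs (w - a) by rewrite lt_neqAle eq_sym cabs_eq0 w0 cabs_ge0.
rewrite cabsM cabsV ltr_pdivrMr //; apply: le_lt_trans (dH _ wa) _.
by rewrite ltr_pM2r //; lra.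
Qed.

(** The inverse of [polar rho t]; its [m]-th power is the kernel of the [m]-th Taylor
    coefficient. *)
Let W (rho t : R) : C := rho^-1%:C%C * cis (- t).

Let polarW rho t : rho != 0 -> polar rho t * W rho t = 1.
Proof.
move=> r0; rewrite /polar /W mulrACA -rmorphM /= divff // -cisD subrr.
by rewrite /cis cos0 sin0 mulr1.
Qed.

Let W2pi rho : W rho (pi *+ 2) = W rho 0.
Proof.
rewrite /W -(cis2pi (- (pi *+ 2))) addNr oppr0.
by [].
Qed.

Let cabsW (rho t : R) : 0 < rho -> cabs (W rho t) = rho^-1.
Proof.
by move=> r0; rewrite cabsM cabs_cis mulr1 cabs_real gtr0_norm // invr_gt0.
Qed.

Let curve_deriveW rho t : curve_derive (W rho) t (- 'i%C * W rho t).
Proof.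
have -> : - 'i%C * W rho t = rho^-1%:C%C * (- 'i%C * cis (- t)) by rewrite mulrCA.
apply: curve_deriveZ; split.
  have -> : (fun s => Re (cis (- s))) = @cos R by apply/funext => s; rewrite /= cosN.
  have -> : Re (- 'i%C * cis (- t)) = - sin t.
    by rewrite Re_mul /= sinN; ring.
  exact: is_derive_cos.
have -> : (fun s => Im (cis (- s))) = - @sin R by apply/funext => s; rewrite /= sinN.
have -> : Im (- 'i%C * cis (- t)) = - cos t.
  by rewrite Im_mul /= cosN; ring.
exact: is_deriveN.
Qed.

Let curve_deriveWX rho m t :
  curve_derive (fun s => W rho s ^+ m) t (- 'i%C * m%:R * W rho t ^+ m).
Proof.
elim: m => [|m IH]; first by rewrite mulr0 mul0r; exact: curve_derive_cst.
have := curve_deriveM (curve_deriveW rho t) IH.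
congr (curve_derive _ _ _); first by apply/funext => s; rewrite exprS.
by rewrite exprS -[in RHS]natr1; ring.
Qed.

Let WX_antiderivative rho m : exists E : R -> C,
  (forall t, curve_derive E t (W rho t ^+ m)) /\
  E (pi *+ 2) - E 0 = (m == 0%N)%:R * (pi *+ 2)%:C%C.
Proof.
case: m => [|m].
  exists (fun t => t%:C%C); split; first by move=> t; exact: curve_derive_real.
  by rewrite mul1r subr0.
exists (fun t => 'i%C / m.+1%:R * W rho t ^+ m.+1); split=> [t|].
  have := curve_deriveZ ('i%C / m.+1%:R) (curve_deriveWX rho m.+1 t).
  congr (curve_derive _ _ _).
  have m0 : m.+1%:R != 0 :> C by rewrite pnatr_eq0.
  have i2 : ('i%C : C) * 'i%C = -1 by rewrite -expr2 sqr_i.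
  have -> : 'i%C / m.+1%:R * (- 'i%C * m.+1%:R * W rho t ^+ m.+1) =
    - ('i%C * 'i%C) * (m.+1%:R / m.+1%:R) * W rho t ^+ m.+1 by ring.
  by rewrite i2 opprK mul1r divff // mul1r.
by rewrite W2pi subrr mul0r.
Qed.

Let polar_continuous_antiderivative (f : C -> C) (rho : R) :
  (forall t, cabs_continuous_at f (polar rho t)) ->
  exists U : R -> C, forall t, curve_derive U t (f (polar rho t)).
Proof.
move=> cf; have [] := @curve_continuous R f (polar rho) _ _ cf.
- move=> s; under eq_fun do rewrite polarE /=.
  by apply: cvgM; [exact: cvg_cst | exact: continuous_cos].
- move=> s; under eq_fun do rewrite polarE /=.
  by apply: cvgM; [exact: cvg_cst | exact: continuous_sin].
- exact: curve_antiderivative.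
Qed.

Let conj_continuous (z : C) : cabs_continuous_at (fun w => w^*%C) z.
Proof.
move=> e e0; exists e => // w.
by rewrite -[w^*%C - _]rmorphB /cabs; case: (w - z) => x y /=; rewrite sqrrN.
Qed.

(** On the circle the inverse is a multiple of the conjugate, which is continuous in the whole
    plane, as [polar_continuous_antiderivative] can use. *)
Let WE (rho t : R) : rho != 0 -> W rho t = (rho^-1 ^+ 2)%:C%C * (polar rho t)^*%C.
Proof.
move=> r0; rewrite /W polarE; apply: complex_ext; rewrite ?Re_mul ?Im_mul /= cosN sinN; field => //.
Qed.

(** The coefficients are Cauchy integrals over the circle of radius [rho], independent of [a] and
    [n]. The difference quotient [h] at [a] integrates to zero; adding its integral reduces the
    finite geometric sum to the term [- h(P) P (a / P)^n], where [P] runs over the circle and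
    [|a / P| <= r / rho]. *)
Lemma taylor_approx_neq0 (g : C -> C) (r rho : R) :
  (forall z : CC R, cabs z < 1 -> differentiable (g : CC R -> CC R) z) ->
  (forall z, cabs z < 1 -> cabs (g z) <= 1) ->
  0 < r -> r < rho -> rho < 1 ->
  exists c : nat -> C, forall n a, a != 0 -> cabs a <= r ->
    cabs (g a - \sum_(m < n) c m * a ^+ m) <= 4 * (r / rho) ^+ n / (1 - r / rho).
Proof.
move=> gd gb r0 rrho rho1.
have rho0 : 0 < rho by apply: lt_trans rrho.
have rhoN : rho != 0 by rewrite gt_eqF.
have cg t : cabs_continuous_at g (polar rho t).
  apply/affine_approx_continuous/differentiable_affine_approx/gd.
  by rewrite cabs_polar // ltW.
have cW k t : cabs_continuous_at (fun z => ((rho^-1 ^+ 2)%:C%C * z^*%C) ^+ k) (polar rho t).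
  elim: k => [|k IH]; first exact: cabs_continuous_cst.
  under eq_fun do rewrite exprS.
  apply: cabs_continuousM => //; apply: cabs_continuousM; first exact: cabs_continuous_cst.
  exact: conj_continuous.
have /choice [U HU] : forall m, exists Um : R -> C, forall t,
    curve_derive Um t (g (polar rho t) * W rho t ^+ m).
  move=> m; have [|Um HUm] := @polar_continuous_antiderivative
    (fun z => g z * ((rho^-1 ^+ 2)%:C%C * z^*%C) ^+ m) rho.
    by move=> t; apply: cabs_continuousM.
  by exists Um => t; rewrite WE.
have /choice [E HE] := WX_antiderivative rho.
have pi0 : 0 < pi *+ 2 :> R by rewrite mulrn_wgt0 // pi_gt0.
have piN : (pi *+ 2)%:C%C != 0 :> C by rewrite (inj_eq (@complexI R) _ 0) gt_eqF.
pose c m : C := (U m (pi *+ 2) - U m 0) / (pi *+ 2)%:C%C.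
have q1 : r / rho < 1 by rewrite ltr_pdivrMr // mul1r.
have q0 : 0 < r / rho by rewrite divr_gt0.
have q10 : 0 < 1 - r / rho by rewrite subr_gt0.
exists c => n a a0 ar.
case: n => [|n].
  rewrite big_ord0 subr0 expr0 mulr1 ler_pdivlMr //.
  have a1 : cabs a < 1 by lra.
  have := gb a a1; have := cabs_ge0 (g a); nra.
have arho : cabs a < rho by apply: le_lt_trans rrho.
have [h [hM hc hd]] := difference_quotient (lt_trans arho rho1) gd.
have [H [HH H0]] := cauchy_circle arho rho1 a0 hc hd.
(* Since [dz = i P dt], the factor ['i] turns the derivative of [H] into [- h(P) P], which cancels
   all but the highest power of [a w]. *)
pose Tot t := \sum_(m < n.+1) a ^+ m * U m t -
  g a * (\sum_(m < n.+1) a ^+ m * E m t) + 'i%C * H t.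
have sum_derive (u v : nat -> R -> C) k t :
    (forall m, curve_derive (u m) t (v m t)) ->
    curve_derive (fun s => \sum_(m < k) a ^+ m * u m s) t (\sum_(m < k) a ^+ m * v m t).
  move=> uv; elim: k => [|k IH].
    rewrite big_ord0; under eq_fun do rewrite big_ord0; exact: curve_derive_cst.
  rewrite big_ord_recr /=; under eq_fun do rewrite big_ord_recr /=.
  by apply: curve_deriveD => //; apply: curve_deriveZ.
have DTot t : curve_derive Tot t
    (- (h (polar rho t) * polar rho t * (a * W rho t) ^+ n.+1)).
  have D1 := sum_derive U (fun m t => g (polar rho t) * W rho t ^+ m) n.+1 t (fun m => HU m t).
  have D2 := sum_derive E (fun m t => W rho t ^+ m) n.+1 t (fun m => (HE m).1 t).
  have := curve_deriveD (curve_deriveB D1 (curve_deriveZ (g a) D2))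
    (curve_deriveZ 'i%C (HH t)).
  congr (curve_derive _ _ _).
  set P := polar rho t; set w := W rho t.
  have Pw : P * w = 1 by exact: polarW.
  have -> : \sum_(m < n.+1) a ^+ m * (g P * w ^+ m) = g P * \sum_(m < n.+1) (a * w) ^+ m.
    by rewrite mulr_sumr; apply: eq_bigr => m _; rewrite [(a * w) ^+ m]exprMn; ring.
  have -> : \sum_(m < n.+1) a ^+ m * w ^+ m = \sum_(m < n.+1) (a * w) ^+ m.
    by apply: eq_bigr => m _; rewrite [(a * w) ^+ m]exprMn.
  have -> : 'i%C * (h P * (rho%:C%C * ('i%C * cis t))) = - (h P * P).
    have -> : 'i%C * (h P * (rho%:C%C * ('i%C * cis t))) = ('i%C * 'i%C) * (h P * P).
      by rewrite /P /polar; ring.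
    by rewrite -expr2 sqr_i mulN1r.
  rewrite -mulrBl -hM.
  have -> : P - a = - P * (a * w - 1).
    have -> : - P * (a * w - 1) = P - a * (P * w) by ring.
    by rewrite Pw mulr1.
  have -> : h P * (- P * (a * w - 1)) * \sum_(m < n.+1) (a * w) ^+ m =
    - (h P * P) * ((a * w - 1) * \sum_(m < n.+1) (a * w) ^+ m) by ring.
  rewrite -subrX1; ring.
have TotE : Tot (pi *+ 2) - Tot 0 =
    (pi *+ 2)%:C%C * (\sum_(m < n.+1) c m * a ^+ m - g a).
  have -> : (pi *+ 2)%:C%C * (\sum_(m < n.+1) c m * a ^+ m - g a) =
     (\sum_(m < n.+1) a ^+ m * (U m (pi *+ 2) - U m 0)) - g a * (pi *+ 2)%:C%C.
    rewrite mulrBr mulr_sumr [_ * g a]mulrC; congr (_ - _); apply: eq_bigr => m _.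
    by rewrite /c mulrA [_ * (_ / _)]mulrC divfK // mulrC.
  have -> : (pi *+ 2)%:C%C = \sum_(m < n.+1) a ^+ m * (E m (pi *+ 2) - E m 0).
    rewrite big_ord_recl /= (HE 0%N).2 eqxx expr0 !mul1r big1 ?addr0 // => m _.
    by rewrite (HE _).2 mul0r mulr0.
  have split_sum (u : nat -> R -> C) x y : \sum_(m < n.+1) a ^+ m * (u m x - u m y) =
      \sum_(m < n.+1) a ^+ m * u m x - \sum_(m < n.+1) a ^+ m * u m y.
    by rewrite -sumrB; apply: eq_bigr => m _; rewrite mulrBr.
  by rewrite !split_sum /Tot H0; ring.
have := @curve_mean_value R Tot _ 0 (pi *+ 2) (2 * (r / rho) ^+ n.+1 / (1 - r / rho))
  (ltW pi0) (fun t _ => DTot t).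
rewrite TotE subr0 cabsM cabs_real [`|pi *+ 2|]gtr0_norm // cabsB.
have -> : 4 * (r / rho) ^+ n.+1 / (1 - r / rho) =
  2 * (2 * (r / rho) ^+ n.+1 / (1 - r / rho)) by ring.
move=> K; rewrite -(ler_pM2l pi0) [leRHS]mulrC; apply: K => t _.
set P := polar rho t.
have cP : cabs P = rho by rewrite cabs_polar // ltW.
rewrite cabsN cabsM [cabs (h P * P)]cabsM cP cabsX [cabs (a * _)]cabsM cabsW //.
have hP : cabs (h P) * (rho - r) <= 2.
  have : cabs (h P) * cabs (P - a) <= 2.
    rewrite -cabsM hM; apply: le_trans (cabsD _ _) _; rewrite cabsN.
    have b1 : cabs (g P) <= 1 by apply: gb; rewrite cP.
    have b2 : cabs (g a) <= 1 by apply: gb; lra.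
    lra.
  have : rho - r <= cabs (P - a).
    by have := cabsD (P - a) a; rewrite subrK cP; lra.
  by have := cabs_ge0 (h P); nra.
have -> : 2 * (r / rho) ^+ n.+1 / (1 - r / rho) = (2 / (1 - r / rho)) * (r / rho) ^+ n.+1 by ring.
have rhoV : 0 < rho^-1 by rewrite invr_gt0.
have x0 : 0 <= cabs a * rho^-1 by rewrite mulr_ge0 ?cabs_ge0 // ltW.
apply: ler_pM.
- by rewrite mulr_ge0 ?cabs_ge0 // ltW.
- exact: exprn_ge0.
- rewrite ler_pdivlMr //.
  have -> : cabs (h P) * rho * (1 - r / rho) = cabs (h P) * (rho - r) by field.
  exact: hP.
- rewrite lerXn2r ?nnegrE //; first exact: ltW.
  by rewrite ler_pM2r.
Qed.

End Taylor.

(** * Polynomial approximation on the bidisk *)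

Section Interpolation.
Variable R : realType.
Notation C := (R[i]%C).

Definition holomorphic_disk (g : C -> C) :=
  forall z : CC R, cabs z < 1 -> differentiable (g : CC R -> CC R) z.

Lemma cabs_continuousB (f k : C -> C) z : cabs_continuous_at f z ->
  cabs_continuous_at k z -> cabs_continuous_at (fun w => f w - k w) z.
Proof.
move=> cf ck e e0; have e20 : 0 < e / 2 by rewrite divr_gt0.
have [d1 d10 H1] := cf _ e20; have [d2 d20 H2] := ck _ e20.
exists (Num.min d1 d2); first by rewrite lt_min d10.
move=> w; rewrite lt_min => /andP[/H1 h1 /H2 h2].
have -> : f w - k w - (f z - k z) = (f w - f z) - (k w - k z) by ring.
by apply: le_lt_trans (cabsD _ _) _; rewrite cabsN; lra.
Qed.

Lemma cabs_continuous_sum n (c : nat -> C) z :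
  cabs_continuous_at (fun w => \sum_(m < n) c m * w ^+ m) z.
Proof.
elim: n => [|n IH].
  under eq_fun do rewrite big_ord0; exact: cabs_continuous_cst.
have cX : cabs_continuous_at (fun w => - c n * w ^+ n) z.
  apply: cabs_continuousM; first exact: cabs_continuous_cst.
  elim: {IH} n => [|n IH]; first exact: cabs_continuous_cst.
  under eq_fun do rewrite exprS.
  by apply: cabs_continuousM IH; exact: cabs_continuous_id.
have := cabs_continuousB IH cX; congr (cabs_continuous_at _ _).
by apply/funext => w; rewrite big_ord_recr /= mulNr opprK.
Qed.

Lemma taylor_approx (g : C -> C) (r rho : R) :
  holomorphic_disk g -> (forall z, cabs z < 1 -> cabs (g z) <= 1) ->
  0 < r -> r < rho -> rho < 1 ->
  exists c : nat -> C, forall n a, cabs a <= r ->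
    cabs (g a - \sum_(m < n) c m * a ^+ m) <= 4 * (r / rho) ^+ n / (1 - r / rho).
Proof.
move=> gd gb r0 rrho rho1; have [c Hc] := taylor_approx_neq0 gd gb r0 rrho rho1.
(* The polar rectangle around [a] in [cauchy_circle] has to avoid the origin; the case [a = 0]
   follows by continuity from small positive arguments [s]. *)
exists c => n a ar; have [a0|an] := eqVneq a 0; last exact: Hc.
apply/ler_addgt0Pr => e e0.
have cg : cabs_continuous_at g 0.
  by apply/affine_approx_continuous/differentiable_affine_approx/gd; rewrite cabs0.
have [d d0 dH] := cabs_continuousB cg (@cabs_continuous_sum n c 0) e0.
pose s := Num.min (d / 2) r.
have s0 : 0 < s by rewrite lt_min r0 divr_gt0.
have sr : s <= r by rewrite ge_min lexx orbT.
have sd : s < d by rewrite gt_min; apply/orP; left; lra.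
have cs : cabs s%:C%C = s by rewrite cabs_real gtr0_norm.
have := dH s%:C%C; rewrite subr0 cs => /(_ sd) h1.
have := Hc n s%:C%C; rewrite (inj_eq (@complexI R) _ 0) gt_eqF // cs => /(_ isT sr) h2.
rewrite a0.
set x := g 0 - _ in h1 *; set y := g s%:C%C - _ in h1 h2.
have -> : x = - (y - x) + y by ring.
by apply: le_trans (cabsD _ _) _; rewrite cabsN; lra.
Qed.

Section Nodes.
Variables (N' : nat).
Let N := N'.+1.
Variables (w : C) (pw : N.-primitive_root w).

(* The Lagrange basis at the [N]-th roots of unity. *)
Definition root_basis (k : 'I_N) (z : C) : C :=
  N%:R^-1 * \sum_(m < N) (z * (w ^+ k)^*%C) ^+ m.

Let cabs_w k : cabs (w ^+ k) = 1.
Proof.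
apply: (@complexI R); rewrite -cabsE normrX.
by rewrite (norm_unity_root (prim_order_gt0 pw) (prim_expr_order pw)) expr1n.
Qed.

Let cabs_w_le k : cabs (w ^+ k) <= 1. Proof. by rewrite cabs_w. Qed.

Lemma cabs_conj (z : C) : cabs z^*%C = cabs z.
Proof. by case: z => x y; rewrite /cabs /= sqrrN. Qed.

Lemma root_basis_le1 k z : cabs z <= 1 -> cabs (root_basis k z) <= 1.
Proof.
move=> z1; rewrite cabsM cabsV.
have cN : cabs (N%:R : C) = N%:R.
  by rewrite -(rmorph_nat (real_complex R)) cabs_real ger0_norm.
rewrite cN mulrC ler_pdivrMr ?ltr0n // mul1r.
apply: le_trans (cabs_sum _) _.
apply: (@le_trans _ _ (\sum_(m < N) 1)); last by rewrite sumr_const card_ord.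
apply: ler_sum => m _; rewrite cabsX cabsM cabs_conj cabs_w mulr1.
by rewrite exprn_ile1 // cabs_ge0.
Qed.

Lemma root_interpolation (c : nat -> C) z :
  \sum_(m < N) c m * z ^+ m =
  \sum_(k < N) (\sum_(m < N) c m * (w ^+ k) ^+ m) * root_basis k z.
Proof.
have N0 : N%:R != 0 :> C by rewrite pnatr_eq0.
symmetry.
transitivity (\sum_(k < N) \sum_(m < N) \sum_(l < N)
    N%:R^-1 * (c m * z ^+ l) * (w ^+ (k * m) * (w ^+ (k * l))^*)).
  apply: eq_bigr => k _; rewrite mulr_suml; apply: eq_bigr => m _.
  rewrite /root_basis mulrCA mulr_sumr mulr_sumr; apply: eq_bigr => l _.
  have -> : (w ^+ (k * l))^* = ((w ^+ k)^*%C) ^+ l by rewrite exprM rmorphXn.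
  by rewrite exprMn -(exprM w k m); ring.
rewrite exchange_big /=; apply: eq_bigr => m _.
rewrite exchange_big /= (bigD1 m) //= [X in _ + X]big1 ?addr0 => [|l lm].
  by rewrite -mulr_sumr (dft_orthogonal pw) eqxx mulr1 mulrAC mulVf // mul1r.
by rewrite -mulr_sumr (dft_orthogonal pw) eq_sym (negPf lm) !mulr0.
Qed.

(** Interpolation reproduces the Taylor polynomial of degree less than [N] exactly, and the basis is
    bounded by 1, so a Taylor error [e] becomes at most [e + N e]. *)
Lemma holomorphic_interpolation (g : C -> C) (r rho : R) z :
  holomorphic_disk g -> (forall z, cabs z < 1 -> cabs (g z) <= 1) ->
  0 < r -> r < rho -> rho < 1 -> cabs z <= 1 ->
  cabs (g (r%:C%C * z) - \sum_(k < N) g (r%:C%C * w ^+ k) * root_basis k z) <=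
  N.+1%:R * (4 * (r / rho) ^+ N / (1 - r / rho)).
Proof.
move=> gd gb r0 rrho rho1 z1.
have [c Hc] := taylor_approx gd gb r0 rrho rho1.
set e := 4 * _ / _.
pose T a := \sum_(m < N) c m * a ^+ m.
have cr u : cabs u <= 1 -> cabs (r%:C%C * u) <= r.
  by move=> u1; rewrite cabsM cabs_real gtr0_norm // ler_piMr // ltW.
have TE u : T (r%:C%C * u) = \sum_(m < N) (c m * r%:C%C ^+ m) * u ^+ m.
  by apply: eq_bigr => m _; rewrite exprMn mulrA.
have -> : g (r%:C%C * z) - \sum_(k < N) g (r%:C%C * w ^+ k) * root_basis k z =
    (g (r%:C%C * z) - T (r%:C%C * z)) +
    \sum_(k < N) (T (r%:C%C * w ^+ k) - g (r%:C%C * w ^+ k)) * root_basis k z.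
  have -> : T (r%:C%C * z) = \sum_(k < N) T (r%:C%C * w ^+ k) * root_basis k z.
    rewrite TE (root_interpolation (fun m => c m * r%:C%C ^+ m)).
    by apply: eq_bigr => k _; rewrite TE.
  under [X in _ = _ + X]eq_bigr => k _ do rewrite mulrBl.
  by rewrite sumrB; ring.
apply: le_trans (cabsD _ _) _.
rewrite -nat1r mulrDl mul1r; apply: lerD; first exact: Hc (cr _ z1).
apply: le_trans (cabs_sum _) _.
apply: (@le_trans _ _ (\sum_(k < N) e)); last by rewrite sumr_const card_ord [leRHS]mulr_natl.
apply: ler_sum => k _; rewrite cabsM cabsB.
have h1 := Hc N _ (cr _ (cabs_w_le k)).
have h2 := root_basis_le1 k z1.
have h3 := cabs_ge0 (root_basis k z).
have h4 := cabs_ge0 (g (r%:C%C * w ^+ k) - T (r%:C%C * w ^+ k)).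
by rewrite -/(T _) -/e in h1; nra.
Qed.

(** Interpolating in one variable after the other needs only separate differentiability: the
    coefficients are values of [F], so no Taylor coefficient has to be followed as the other
    variable moves. The errors add up to [(N + 1) e + N (N + 1) e]. *)
Lemma bidisk_interpolation (F : C -> C -> C) (r rho : R) z1 z2 :
  (forall u, cabs u < 1 -> holomorphic_disk (F u)) ->
  (forall u, cabs u < 1 -> holomorphic_disk (F^~ u)) ->
  (forall u v, cabs u < 1 -> cabs v < 1 -> cabs (F u v) <= 1) ->
  0 < r -> r < rho -> rho < 1 -> cabs z1 <= 1 -> cabs z2 <= 1 ->
  cabs (F (r%:C%C * z1) (r%:C%C * z2) - \sum_(k < N) \sum_(l < N)
    F (r%:C%C * w ^+ k) (r%:C%C * w ^+ l) * root_basis k z1 * root_basis l z2) <=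
  N.+1%:R ^+ 2 * (4 * (r / rho) ^+ N / (1 - r / rho)).
Proof.
move=> F1 F2 Fb r0 rrho rho1 z11 z21.
have cr u : cabs u <= 1 -> cabs (r%:C%C * u) < 1.
  move=> u1; apply: (@le_lt_trans _ _ r); last by apply: lt_trans rho1.
  by rewrite cabsM cabs_real gtr0_norm // ler_piMr // ltW.
set e := 4 * _ / _.
have h1 : cabs (F (r%:C%C * z1) (r%:C%C * z2) -
    \sum_(k < N) F (r%:C%C * w ^+ k) (r%:C%C * z2) * root_basis k z1) <= N.+1%:R * e.
  apply: (@holomorphic_interpolation (F^~ (r%:C%C * z2)) r rho) => //.
    exact/F2/cr.
  by move=> z zz; apply: Fb => //; apply: cr.
have h2 k : cabs (F (r%:C%C * w ^+ k) (r%:C%C * z2) -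
    \sum_(l < N) F (r%:C%C * w ^+ k) (r%:C%C * w ^+ l) * root_basis l z2) <= N.+1%:R * e.
  have c1 := cr _ (cabs_w_le k).
  by apply: (@holomorphic_interpolation (F (r%:C%C * w ^+ k)) r rho) => //;
    [exact: F1 | move=> z zz; apply: Fb].
set S := \sum_(k < N) \sum_(l < N) _.
have -> : F (r%:C%C * z1) (r%:C%C * z2) - S =
    (F (r%:C%C * z1) (r%:C%C * z2) -
    \sum_(k < N) F (r%:C%C * w ^+ k) (r%:C%C * z2) * root_basis k z1) +
    \sum_(k < N) (F (r%:C%C * w ^+ k) (r%:C%C * z2) -
    \sum_(l < N) F (r%:C%C * w ^+ k) (r%:C%C * w ^+ l) * root_basis l z2) * root_basis k z1.
  under [X in _ = _ + X]eq_bigr => k _ do rewrite mulrBl.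
  rewrite sumrB addrA subrK; congr (_ - _).
  apply: eq_bigr => k _; rewrite mulr_suml; apply: eq_bigr => l _.
  by rewrite mulrAC.
apply: le_trans (cabsD _ _) _.
have -> : N.+1%:R ^+ 2 * e = N.+1%:R * e + N%:R * (N.+1%:R * e).
  by rewrite expr2 -[X in X * _ * e]nat1r; ring.
apply: lerD => //; apply: le_trans (cabs_sum _) _.
apply: (@le_trans _ _ (\sum_(k < N) N.+1%:R * e)); last
  by rewrite sumr_const card_ord [leRHS]mulr_natl.
apply: ler_sum => k _; rewrite cabsM.
have h3 := root_basis_le1 k z11; have h4 := cabs_ge0 (root_basis k z1).
apply: le_trans (ler_wpM2l (cabs_ge0 _) h3) _; rewrite mulr1; exact: h2.
Qed.

End Nodes.

Lemma geometric_small (q e : R) : 0 < q < 1 -> 0 < e ->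
  exists N : nat, N.+2%:R ^+ 2 * (4 * q ^+ N.+1 / (1 - q)) <= e.
Proof.
move=> /andP[q0 q1] e0; pose x := q^-1 - 1.
have x0 : 0 < x by rewrite subr_gt0 invf_gt1.
have bern n : 1 + n%:R * x <= (1 + x) ^+ n.
  elim: n => [|n IH]; first by rewrite mul0r addr0 expr0.
  rewrite exprS -natr1; have n0 : 0 <= n%:R :> R by [].
  by have := ler_wpM2l (ltW (addr_gt0 ltr01 x0)) IH; nra.
have qx : q = (1 + x)^-1 by rewrite /x addrC subrK invrK.
have q10 : 0 < 1 - q by rewrite subr_gt0.
(* With exponent [3 M], Bernoulli's inequality gives [q^(3 M) <= (M x)^-3], one power of [M] more
   than the quadratic factor consumes; what is left is [K e / M]. *)
pose K := 64 / (1 - q) / x ^+ 3 / e.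
have K0 : 0 < K by rewrite !divr_gt0 // exprn_gt0.
pose M := (Num.bound K).+1.
have MK : K < M%:R.
  by apply: lt_trans (archi_boundP (ltW K0)) _; rewrite ltr_nat.
have M1 : 1 <= M%:R :> R by rewrite ler1n.
exists (3 * M).-1; rewrite prednK ?muln_gt0 //.
have -> : ((3 * M).-1.+2 = 3 * M + 1)%N by rewrite addn1 prednK // muln_gt0.
have M0 : 0 < M%:R :> R by apply: lt_le_trans M1.
have qM : q ^+ M <= (M%:R * x)^-1.
  have x1 : 0 < 1 + x by lra.
  rewrite [q]qx exprVn lef_pV2 ?posrE ?exprn_gt0 ?mulr_gt0 //.
  by apply: le_trans (bern M); rewrite lerDr.
have q3 : q ^+ (3 * M) <= (M%:R * x)^-1 ^+ 3.
  have y0 : 0 <= (M%:R * x)^-1 by rewrite invr_ge0 mulr_ge0 // ltW.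
  rewrite mulnC exprM; apply: (lerXn2r 3 _ _ qM); rewrite nnegrE //.
  by rewrite exprn_ge0 // ltW.
have n4 : (3 * M + 1)%N%:R <= 4 * M%:R :> R by rewrite natrD natrM; lra.
have n0 : 0 <= (3 * M + 1)%N%:R :> R by [].
apply: (@le_trans _ _ ((4 * M%:R) ^+ 2 * (4 * (M%:R * x)^-1 ^+ 3 / (1 - q)))).
  apply: ler_pM; rewrite ?exprn_ge0 //.
  - by rewrite divr_ge0 ?(ltW q10) // mulr_ge0 // exprn_ge0 // ltW.
  - by apply: (lerXn2r 2 _ _ n4); rewrite nnegrE // mulr_ge0.
  - by rewrite ler_pM2r ?invr_gt0 // ler_pM2l.
have -> : (4 * M%:R) ^+ 2 * (4 * (M%:R * x)^-1 ^+ 3 / (1 - q)) = K * e / M%:R.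
  by rewrite /K; field; rewrite !gt_eqF.
by rewrite ler_pdivrMr // mulrC ler_pM2l // ltW.
Qed.

End Interpolation.

Lemma decay_absurd (R : realType) (X Y Z k a : R) : - Y <= Z -> Z <= X ->
  Y <= k * a -> a * (2 * (k + 1)) <= - X -> 0 <= k -> 0 <= a -> X < 0 -> False.
Proof. by move=> *; nra. Qed.

Lemma limit_bound (R : realType) (X Y Z k a b : R) : - (k * (3 * a)) <= X - Y ->
  X <= (1 + a) ^+ 2 * Z -> a * (3 * k + 3 * Z + 1) <= b ->
  0 <= a -> a <= 1 -> 0 <= Z -> Y <= Z + b.
Proof.
move=> h1 h2 h3 a0 a1 Z0.
have : (1 + a) ^+ 2 * Z <= (1 + 3 * a) * Z by rewrite ler_wpM2r //; nra.
by nra.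
Qed.

(** * Hermitian forms contracted by both coordinates *)

Section BidiskInequality.
Variable R : realType.
Notation C := (R[i]%C).

Lemma normc_le (z : C) (x : R) : (`|z| <= x%:C%C) = (cabs z <= x).
Proof. by rewrite cabsE lecR. Qed.

Lemma cabs_lt1 (z : C) : (`|z| < 1) = (cabs z < 1).
Proof. by rewrite cabsE -(ltcR (cabs z) 1). Qed.

Variables (F : C -> C -> C).
Hypothesis F1 : forall u, cabs u < 1 -> holomorphic_disk (F u).
Hypothesis F2 : forall u, cabs u < 1 -> holomorphic_disk (F^~ u).
Hypothesis Fb : forall u v, cabs u < 1 -> cabs v < 1 -> cabs (F u v) <= 1.

Variables (M : nat) (l1 l2 : 'I_M -> C).
Hypothesis l1_lt1 : forall i, cabs (l1 i) < 1.
Hypothesis l2_lt1 : forall i, cabs (l2 i) < 1.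
Hypothesis F_radial : forall i (e : R), 0 < e -> exists2 d : R, 0 < d &
  forall r : R, 1 - d < r < 1 ->
    cabs (F (r%:C%C * l1 i) (r%:C%C * l2 i) - F (l1 i) (l2 i)) <= e.

(** The polynomial interpolates the dilated function [F (r z)], which is bounded by 1 on the closed
    bidisk; radial continuity at the nodes compares it with [F] there. *)
Lemma bidisk_polynomial_approx (e : R) : 0 < e ->
  exists d, exists p : 'I_d -> 'I_d -> C,
    (forall z w : C, `|z| = 1 -> `|w| = 1 ->
       `|\sum_(j < d) \sum_(l < d) p j l * (z ^+ j * w ^+ l)| <= (1 + e)%:C%C) /\
    (forall i, cabs (\sum_(j < d) \sum_(l < d) p j l * (l1 i ^+ j * l2 i ^+ l) -
       F (l1 i) (l2 i)) <= e).
Proof.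
move=> e0; have e20 : 0 < e / 2 by rewrite divr_gt0.
have /choice [d dH] : forall i, exists d : R, 0 < d /\
    forall r : R, 1 - d < r < 1 ->
    cabs (F (r%:C%C * l1 i) (r%:C%C * l2 i) - F (l1 i) (l2 i)) <= e / 2.
  by move=> i; have [d d0 dH] := F_radial i e20; exists d.
(* A positive number below every [d i] and at most 1/2; the sum of inverses stands in for a minimum
   over a possibly empty family. *)
pose D := (2 + \sum_i (d i)^-1)^-1.
have dV i : 0 < (d i)^-1 by rewrite invr_gt0; case: (dH i).
have D2 : 0 <= \sum_i (d i)^-1 by apply: sumr_ge0 => i _; apply: ltW.
have Dp : 0 < 2 + \sum_i (d i)^-1 by lra.
have D0 : 0 < D by rewrite invr_gt0.
have D1 : D <= 2^-1 by rewrite lef_pV2 ?posrE //; lra.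
have Dd i : D <= d i.
  rewrite -[d i]invrK lef_pV2 ?posrE //.
  rewrite (bigD1 i) //=; have : 0 <= \sum_(j < M | j != i) (d j)^-1.
    by apply: sumr_ge0 => j _; apply: ltW.
  lra.
pose r := 1 - D / 2; pose rho := 1 - D / 4.
have r0 : 0 < r by rewrite /r; lra.
have rrho : r < rho by rewrite /r /rho; lra.
have rho1 : rho < 1 by rewrite /rho; lra.
have q01 : 0 < r / rho < 1.
  have rho0 : 0 < rho by apply: lt_trans rrho.
  by rewrite divr_gt0 // ltr_pdivrMr // mul1r.
have [N' HN] := geometric_small q01 e20.
have [w pw] := primitive_root_exists C (ltn0Sn N').
pose f k l := F (r%:C%C * w ^+ k) (r%:C%C * w ^+ l).
pose p (j m : 'I_N'.+1) : C := \sum_(k < N'.+1) \sum_(l < N'.+1)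
  f k l * (N'.+1%:R^-1 * (w ^+ k)^*%C ^+ j) * (N'.+1%:R^-1 * (w ^+ l)^*%C ^+ m).
have distr (x y : C) (A B : 'I_N'.+1 -> C) :
    x * (y * \sum_m A m) * (y * \sum_m B m) =
    \sum_j \sum_m x * y * y * (A j * B m).
  have -> : x * (y * \sum_m A m) * (y * \sum_m B m) =
      x * y * y * ((\sum_m A m) * (\sum_m B m)) by ring.
  rewrite big_distrlr /= mulr_sumr; apply: eq_bigr => j _.
  by rewrite mulr_sumr.
have pE z1 z2 : \sum_(j < N'.+1) \sum_(m < N'.+1) p j m * (z1 ^+ j * z2 ^+ m) =
    \sum_(k < N'.+1) \sum_(l < N'.+1)
    f k l * root_basis w k z1 * root_basis w l z2.
  rewrite /p; under eq_bigr => j _.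
    under eq_bigr => m _.
      rewrite mulr_suml; under eq_bigr => k _ do rewrite mulr_suml.
      over.
    rewrite exchange_big /=.
    under eq_bigr => k _ do rewrite exchange_big /=.
    over.
  rewrite exchange_big /=; apply: eq_bigr => k _.
  rewrite exchange_big /=; apply: eq_bigr => l _.
  rewrite /root_basis distr; apply: eq_bigr => j _; apply: eq_bigr => m _.
  by rewrite !exprMn; ring.
have approx z1 z2 : cabs z1 <= 1 -> cabs z2 <= 1 ->
    cabs (F (r%:C%C * z1) (r%:C%C * z2) -
      \sum_(j < N'.+1) \sum_(m < N'.+1) p j m * (z1 ^+ j * z2 ^+ m)) <= e / 2.
  move=> h1 h2; rewrite pE; apply: le_trans HN.
  exact: (bidisk_interpolation pw F1 F2 Fb r0 rrho rho1 h1 h2).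
have cr u : cabs u <= 1 -> cabs (r%:C%C * u) < 1.
  move=> u1; apply: (@le_lt_trans _ _ r); last by apply: lt_trans rho1.
  by rewrite cabsM cabs_real gtr0_norm // ler_piMr // ltW.
exists N'.+1, p; split=> [z1 z2 n1 n2|i].
  have c1 : cabs z1 <= 1 by rewrite -normc_le n1.
  have c2 : cabs z2 <= 1 by rewrite -normc_le n2.
  rewrite normc_le; have := approx _ _ c1 c2.
  set S := \sum_(j < _) _; set y := F _ _ => h.
  have -> : S = - (y - S) + y by ring.
  apply: le_trans (cabsD _ _) _; rewrite cabsN.
  have : cabs y <= 1 by apply: Fb; apply: cr.
  lra.
have := approx _ _ (ltW (l1_lt1 i)) (ltW (l2_lt1 i)).
set S := \sum_(j < _) _; set y := F (_ * _) _ => h.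
have -> : S - F (l1 i) (l2 i) = - (y - S) + (y - F (l1 i) (l2 i)) by ring.
apply: le_trans (cabsD _ _) _; rewrite cabsN.
have : cabs (y - F (l1 i) (l2 i)) <= e / 2.
  have [_ H] := dH i; apply: H; have := Dd i; rewrite /r => ?.
  by apply/andP; split; lra.
lra.
Qed.

Lemma qformE n (A : 'M[C]_n) (v : 'rV[C]_n) :
  qform A v = \sum_i \sum_j v 0 i * A i j * (v 0 j)^*.
Proof.
rewrite /qform mxE exchange_big /=; apply: eq_bigr => j _.
by rewrite !mxE mulr_suml.
Qed.

Let T (l : 'I_M -> C) : 'M[C]_M := diag_mx (\row_i l i).

Lemma row_mul_diag (l : 'I_M -> C) (v : 'rV[C]_M) i : (v *m T l) 0 i = v 0 i * l i.
Proof. by rewrite mul_mx_diag !mxE. Qed.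

Lemma small_power (m e : R) : 0 <= m < 1 -> 0 < e -> exists n, m ^+ n <= e.
Proof.
move=> /andP[m0 m1] e0.
have q01 : 0 < (1 + m) / 2 < 1 by apply/andP; split; lra.
have [N HN] := geometric_small q01 e0.
exists N.+1; apply: le_trans HN.
apply: (@le_trans _ _ (((1 + m) / 2) ^+ N.+1)).
  by apply: lerXn2r; rewrite ?nnegrE; lra.
set q := (1 + m) / 2 in q01 *.
have /andP [q0 q1] := q01.
have qN : 0 <= q ^+ N.+1 by rewrite exprn_ge0 // ltW.
have a1 : 1 <= 4 / (1 - q) by rewrite ler_pdivlMr; lra.
have a2 : 1 <= N.+2%:R ^+ 2 :> R by rewrite exprn_ege1 // ler1n.
have -> : N.+2%:R ^+ 2 * (4 * q ^+ N.+1 / (1 - q)) =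
  (N.+2%:R ^+ 2 * (4 / (1 - q))) * q ^+ N.+1 by ring.
by rewrite ler_peMl // mulr_ege1.
Qed.

Lemma hermitian_form_real n (A : 'M[C]_n) (v : 'rV[C]_n) : A^t* = A -> Im (qform A v) = 0.
Proof.
move=> Ah; have : (qform A v)^* = qform A v.
  rewrite !qformE rmorph_sum exchange_big /=; apply: eq_bigr => j _.
  rewrite rmorph_sum; apply: eq_bigr => i _.
  have Aji : A j i = (A i j)^* by rewrite -[in LHS]Ah !mxE.
  by rewrite Aji !rmorphM /= !conjCK; ring.
case: (qform A v) => x y [h]; rewrite /=; lra.
Qed.

(** Iterating the multiplication by [l] sends [v] to 0 because every [l i] has modulus less than 1.
    The form does not increase along the way, so it cannot start below its limit 0. *)
Lemma contractive_form_ge0 (l : 'I_M -> C) (Q : 'M[C]_M) :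
  (forall i, cabs (l i) < 1) -> Q^t* = Q ->
  (forall v : 'rV_M, qform Q (v *m T l) <= qform Q v) ->
  forall v : 'rV_M, 0 <= qform Q v.
Proof.
move=> l_lt1 Qh Ql v.
rewrite lecE hermitian_form_real // eqxx /= leNgt; apply/negP => Qneg.
pose m := \big[Num.max/0]_i cabs (l i).
have m01 : 0 <= m < 1.
  apply/andP; split; first exact: bigmax_ge_id.
  by apply: bigmax_lt => //.
have lm i : cabs (l i) <= m by apply: le_bigmax.
pose K := \sum_i \sum_j cabs (v 0 i * Q i j * (v 0 j)^*).
have K0 : 0 <= K by apply: sumr_ge0 => i _; apply: sumr_ge0 => j _; exact: cabs_ge0.
have K1 : 0 < K + 1 by lra.
have e0 : 0 < - Re (qform Q v) / (2 * (K + 1)).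
  by rewrite divr_gt0 ?oppr_gt0 // mulr_gt0.
have [n Hn] := small_power m01 e0.
have iterE k i : (iter k (mulmxr (T l)) v) 0 i = v 0 i * l i ^+ k.
  elim: k => [|k IH] /=; first by rewrite mulr1.
  by rewrite row_mul_diag IH exprSr mulrA.
have decr k : Re (qform Q (iter k (mulmxr (T l)) v)) <= Re (qform Q v).
  elim: k => [|k IH]; first exact: lexx.
  apply: le_trans IH; rewrite iterS.
  by have := Ql (iter k (mulmxr (T l)) v); rewrite lecE => /andP[].
have bound : cabs (qform Q (iter n (mulmxr (T l)) v)) <= K * m ^+ n.
  rewrite qformE; apply: le_trans (cabs_sum _) _.
  rewrite mulr_suml; apply: ler_sum => i _; apply: le_trans (cabs_sum _) _.
  rewrite mulr_suml; apply: ler_sum => j _; rewrite !iterE rmorphM rmorphXn /=.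
  have -> : v 0 i * l i ^+ n * Q i j * ((v 0 j)^* * (l j)^* ^+ n) =
     (v 0 i * Q i j * (v 0 j)^*) * (l i ^+ n * (l j)^* ^+ n) by ring.
  rewrite cabsM ler_wpM2l ?cabs_ge0 // cabsM !cabsX.
  have -> : cabs (l j)^* = cabs (l j) := cabs_conj _.
  have /andP[m0 m1] := m01.
  have h1 : cabs (l i) ^+ n <= m ^+ n by apply: lerXn2r; rewrite ?nnegrE ?cabs_ge0.
  have h2 : cabs (l j) ^+ n <= 1 by rewrite exprn_ile1 ?cabs_ge0 // ltW.
  rewrite -[leRHS]mulr1; apply: ler_pM => //; exact: exprn_ge0 (cabs_ge0 _).
have := decr n; have := Re_le_cabs (qform Q (iter n (mulmxr (T l)) v)).
rewrite ler_norml => /andP[h1 _] h2.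
have /andP[m0 _] := m01; have mn0 : 0 <= m ^+ n by exact: exprn_ge0.
rewrite ler_pdivlMr ?mulr_gt0 // in Hn.
exact: decay_absurd h1 h2 bound Hn K0 mn0 Qneg.
Qed.

Lemma bidisk_form_inequality (Q : 'M[C]_M) : Q^t* = Q ->
  (forall v : 'rV_M, qform Q (v *m T l1) <= qform Q v) ->
  (forall v : 'rV_M, qform Q (v *m T l2) <= qform Q v) ->
  Re (qform Q (\row_i F (l1 i) (l2 i))) <= Re (qform Q (const_mx 1)).
Proof.
move=> Qh Q1 Q2.
have Qpos := contractive_form_ge0 l1_lt1 Qh Q1.
pose K := \sum_i \sum_j cabs (Q i j).
have K0 : 0 <= K by apply: sumr_ge0 => i _; apply: sumr_ge0 => j _; exact: cabs_ge0.
set one := const_mx 1; set wv := \row_i _.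
have one0 : 0 <= Re (qform Q one).
  by have := Qpos one; rewrite lecE => /andP[].
apply/ler_addgt0Pr => e' e'0.
pose L := 3 * K + 3 * Re (qform Q one) + 1.
have L0 : 0 < L by rewrite /L; lra.
pose e := Num.min 1 (e' / L).
have e0 : 0 < e by rewrite lt_min ltr01 divr_gt0.
have e1 : e <= 1 by rewrite ge_min lexx.
have eL : e * L <= e' by rewrite -ler_pdivlMr // ge_min lexx orbT.
have [d [p [pb pF]]] := bidisk_polynomial_approx e0.
have TT : T l1 *m T l2 = T l2 *m T l1 by exact: diag_mxC.
have slack := @le_of_quadratic_slack R.
(* A polynomial in the diagonal operators [T l1], [T l2] sends the constant vector 1 to its values
   at the nodes. *)
have := @von_neumann_ando _ slack M _ _ Q d p _ one Qh Qpos TT Q1 Q2 pb.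
set u := \sum_(j < d) _.
have uE i : u 0 i = \sum_(j < d) \sum_(l < d) p j l * (l1 i ^+ j * l2 i ^+ l).
  rewrite /u summxE; apply: eq_bigr => j _; rewrite summxE; apply: eq_bigr => l _.
  rewrite mxE; congr (_ * _).
  have -> : (iter j (mulmxr (T l1)) (iter l (mulmxr (T l2)) one)) 0 i =
      (iter l (mulmxr (T l2)) one) 0 i * l1 i ^+ j.
    elim: (j : nat) => [|k IH] /=; first by rewrite mulr1.
    by rewrite row_mul_diag IH exprSr mulrA.
  rewrite mulrC; congr (_ * _).
  elim: (l : nat) => [|k IH] /=; first by rewrite mxE.
  by rewrite row_mul_diag IH exprSr.
have uw i : cabs (u 0 i - wv 0 i) <= e by rewrite uE mxE; apply: pF.
have w1 i : cabs (wv 0 i) <= 1 by rewrite mxE Fb.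
have u1 i : cabs (u 0 i) <= 2.
  have := cabsD (u 0 i - wv 0 i) (wv 0 i); rewrite subrK => h.
  have := uw i; have := w1 i; lra.
have diff : cabs (qform Q u - qform Q wv) <= K * (3 * e).
  rewrite !qformE -sumrB; apply: le_trans (cabs_sum _) _.
  rewrite mulr_suml; apply: ler_sum => i _; rewrite -sumrB.
  apply: le_trans (cabs_sum _) _; rewrite mulr_suml; apply: ler_sum => j _.
  have -> : u 0 i * Q i j * (u 0 j)^* - wv 0 i * Q i j * (wv 0 j)^* =
     Q i j * ((u 0 i - wv 0 i) * (u 0 j)^* + wv 0 i * (u 0 j - wv 0 j)^*).
    by rewrite rmorphB /=; ring.
  rewrite cabsM ler_wpM2l ?cabs_ge0 //; apply: le_trans (cabsD _ _) _.
  have cc (z : C) : cabs z^* = cabs z := cabs_conj z.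
  rewrite !cabsM !cc.
  have h1 := uw i; have h2 := uw j; have h3 := u1 j; have h4 := w1 i.
  have g1 := cabs_ge0 (u 0 i - wv 0 i); have g2 := cabs_ge0 (u 0 j - wv 0 j).
  have g3 := cabs_ge0 (u 0 j); have g4 := cabs_ge0 (wv 0 i).
  have p1 : cabs (u 0 i - wv 0 i) * cabs (u 0 j) <= e * 2 by apply: ler_pM.
  have p2 : cabs (wv 0 i) * cabs (u 0 j - wv 0 j) <= 1 * e by apply: ler_pM.
  lra.
have := le_trans (Re_le_cabs _) diff; rewrite Re_add Re_opp ler_norml => /andP[h1 _].
have -> : (1 + e)%:C%C ^+ 2 * qform Q one = ((1 + e) ^+ 2 * Re (qform Q one))%:C%C.
  rewrite rmorphM rmorphXn /=; congr (_ * _).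
  by apply: complex_ext => //=; rewrite hermitian_form_real.
rewrite lecE => /andP[_ /= h2].
exact: limit_bound h1 h2 eL (ltW e0) e1 one0.
Qed.

End BidiskInequality.

Lemma sqr_le_bound (R : realType) (u v : R) : u ^+ 2 <= v -> 0 <= v -> u <= v + 1.
Proof. by move=> *; nra. Qed.

(** * The Agler decomposition *)

Section ConeProjection.
Variable R : realType.
Notation C := (R[i]%C).

Lemma Re_sum n (f : 'I_n -> C) : Re (\sum_i f i) = \sum_i Re (f i).
Proof. by elim/big_ind2: _ => // x a y b <- <-; rewrite Re_add. Qed.

Lemma Im_sum n (f : 'I_n -> C) : Im (\sum_i f i) = \sum_i Im (f i).
Proof. by elim/big_ind2: _ => // x a y b <- <-; rewrite Im_add. Qed.

Section Existence.
Variables (M : nat) (a1 a2 : 'I_M -> R) (k1 k2 t : 'M[C]_M).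
Hypothesis a1_gt0 : forall i, 0 < a1 i.
Hypothesis a2_gt0 : forall i, 0 < a2 i.
Hypothesis k1E : forall i, k1 i i = (a1 i)%:C%C.
Hypothesis k2E : forall i, k2 i i = (a2 i)%:C%C.

Definition residual (A B : 'M[C]_M) i j : C := t i j - (k1 i j * A i j + k2 i j * B i j).

Definition residual_norm (A B : 'M[C]_M) : R :=
  \sum_i \sum_j cabs (residual A B i j) ^+ 2.

(** The pair [G], [H] is coded by a real row vector, where closed boxes are compact: one Boolean
    selects [G] or [H], the other the real or imaginary part. *)
Let idx : finType := (bool * bool * 'I_M * 'I_M)%type.
Let n := #|{: idx}|.

Let entry (x : 'rV[R]_n) (b : bool) (i j : 'I_M) : C :=
  (x 0 (enum_rank ((b, false, i, j) : idx)) +i* x 0 (enum_rank ((b, true, i, j) : idx)))%C.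

Let mx (x : 'rV[R]_n) (b : bool) : 'M[C]_M := \matrix_(i, j) entry x b i j.

Let obj (x : 'rV[R]_n) : R :=
  residual_norm (mx x false *m (mx x false)^t*) (mx x true *m (mx x true)^t*).

Let mx_surj (G H : 'M[C]_M) : exists x, mx x false = G /\ mx x true = H.
Proof.
exists (\row_k let: (b, c, i, j) := (enum_val k : idx) in
  let z := if b then H i j else G i j in if c then Im z else Re z).
by split; apply/matrixP => i j; rewrite !mxE /entry !mxE !enum_rankK /=; apply: complex_ext.
Qed.

Let contC (f : 'rV[R]_n -> C) :=
  continuous (fun x => Re (f x)) /\ continuous (fun x => Im (f x)).

Let continuous_sum_real p (f : 'I_p -> 'rV[R]_n -> R) :
  (forall i, continuous (f i)) -> continuous (fun x => \sum_i f i x).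
Proof.
elim: p f => [|p IH] f cf.
  under eq_fun do rewrite big_ord0.
  exact: cst_continuous.
have -> : (fun x => \sum_i f i x) =
    (fun x => \sum_(i < p) f (widen_ord (leqnSn p) i) x) + f ord_max.
  by apply/funext => x; rewrite big_ord_recr.
move=> x; apply: continuousD; last exact: cf.
exact: (IH (fun i => f (widen_ord (leqnSn p) i)) (fun i => cf _) x).
Qed.

Let contC_sum p (f : 'I_p -> 'rV[R]_n -> C) :
  (forall i, contC (f i)) -> contC (fun x => \sum_i f i x).
Proof.
move=> cf; split.
  under eq_fun do rewrite Re_sum.
  by apply: continuous_sum_real => i; exact: (cf i).1.
under eq_fun do rewrite Im_sum.
by apply: continuous_sum_real => i; exact: (cf i).2.
Qed.

Let contC_cst c : contC (fun=> c).
Proof. by split; exact: cst_continuous. Qed.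

Let contCM f g : contC f -> contC g -> contC (fun x => f x * g x).
Proof.
move=> [f1 f2] [g1 g2]; split.
  have -> : (fun x => Re (f x * g x)) =
      (fun x => Re (f x)) * (fun x => Re (g x)) -
      (fun x => Im (f x)) * (fun x => Im (g x)).
    by apply/funext => x; exact: Re_mul.
  move=> x; apply: continuousB; apply: continuousM;
    [exact: f1|exact: g1|exact: f2|exact: g2].
have -> : (fun x => Im (f x * g x)) =
    (fun x => Re (f x)) * (fun x => Im (g x)) +
    (fun x => Im (f x)) * (fun x => Re (g x)).
  by apply/funext => x; exact: Im_mul.
move=> x; apply: continuousD; apply: continuousM;
  [exact: f1|exact: g2|exact: f2|exact: g1].
Qed.

Let contCD f g : contC f -> contC g -> contC (fun x => f x + g x).
Proof.
move=> [f1 f2] [g1 g2]; split.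
  have -> : (fun x => Re (f x + g x)) = (fun x => Re (f x)) + (fun x => Re (g x)).
    by apply/funext => x; exact: Re_add.
  by move=> x; apply: continuousD; [exact: f1|exact: g1].
have -> : (fun x => Im (f x + g x)) = (fun x => Im (f x)) + (fun x => Im (g x)).
  by apply/funext => x; exact: Im_add.
by move=> x; apply: continuousD; [exact: f2|exact: g2].
Qed.

Let contCN f : contC f -> contC (fun x => - f x).
Proof.
move=> cf; have := contCM (contC_cst (-1)) cf.
by congr contC; apply/funext => x; rewrite mulN1r.
Qed.

Let contC_entry b i j : contC (fun x => mx x b i j).
Proof.
split.
  under eq_fun do rewrite mxE /=.
  exact: coord_continuous.
under eq_fun do rewrite mxE /=.
exact: coord_continuous.
Qed.

Let contC_conj f : contC f -> contC (fun x => (f x)^*).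
Proof.
move=> [f1 f2]; split.
  have -> : (fun x => Re (f x)^*) = (fun x => Re (f x)).
    by apply/funext => x; case: (f x).
  exact: f1.
have -> : (fun x => Im (f x)^*) = (fun x => - Im (f x)).
  by apply/funext => x; case: (f x).
have -> : (fun x => - Im (f x)) = - (fun x => Im (f x)) by [].
by move=> x; apply: continuousN; exact: f2.
Qed.

Let contC_cabs_sqr f : contC f -> continuous (fun x => cabs (f x) ^+ 2).
Proof.
move=> [f1 f2].
have -> : (fun x => cabs (f x) ^+ 2) =
    (fun x => Re (f x)) * (fun x => Re (f x)) +
    (fun x => Im (f x)) * (fun x => Im (f x)).
  by apply/funext => x; rewrite cabs_sqr !expr2.
move=> x; apply: continuousD; apply: continuousM;
  [exact: f1|exact: f1|exact: f2|exact: f2].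
Qed.

Let obj_continuous : continuous obj.
Proof.
rewrite /obj /residual_norm; apply: continuous_sum_real => i.
apply: continuous_sum_real => j.
have gram b : contC (fun x => (mx x b *m (mx x b)^t*) i j).
  under eq_fun do rewrite mxE.
  apply: contC_sum => k.
  under eq_fun do rewrite [_^t* _ _]mxE [_^T _ _]mxE.
  by apply: contCM; [|apply: contC_conj].
apply: contC_cabs_sqr; apply: contCD; first exact: contC_cst.
by apply: contCN; apply: contCD; apply: contCM => //; exact: contC_cst.
Qed.

Lemma gram_diag (G : 'M[C]_M) i :
  (G *m G^t*) i i = (\sum_k cabs (G i k) ^+ 2)%:C%C.
Proof.
rewrite mxE rmorph_sum; apply: eq_bigr => k _; rewrite !mxE -normCK cabsE.
by rewrite -rmorphXn.
Qed.

(** The cone is unbounded, but a diagonal entry of the fit is the sum of the squared row norms of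
    [G] and [H] with the positive weights [a1 i], [a2 i], and it is controlled by the target and the
    residual. *)
Let entry_bound x : obj x <= obj 0 -> forall b i j,
  cabs (mx x b i j) ^+ 2 <=
  (\sum_i cabs (t i i) + obj 0 + 1) * \sum_i ((a1 i)^-1 + (a2 i)^-1).
Proof.
move=> ox b i j.
have obj_ge0 y : 0 <= obj y.
  by apply: sumr_ge0 => k _; apply: sumr_ge0 => l _; rewrite exprn_ge0 ?cabs_ge0.
set A := mx x false *m (mx x false)^t*; set B := mx x true *m (mx x true)^t*.
pose p c := \sum_k cabs (mx x c i k) ^+ 2.
have p0 c : 0 <= p c by apply: sumr_ge0 => k _; rewrite exprn_ge0 ?cabs_ge0.
have res : cabs (residual A B i i) ^+ 2 <= obj 0.
  apply: le_trans ox; rewrite /obj /residual_norm (bigD1 i) //= (bigD1 i) //=.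
  rewrite -addrA lerDl addr_ge0 //.
    by apply: sumr_ge0 => k _; rewrite exprn_ge0 ?cabs_ge0.
  by apply: sumr_ge0 => l _; apply: sumr_ge0 => k _; rewrite exprn_ge0 ?cabs_ge0.
have res1 : cabs (residual A B i i) <= obj 0 + 1.
  exact: sqr_le_bound res (obj_ge0 0).
have sum_le : a1 i * p false + a2 i * p true <= cabs (t i i) + (obj 0 + 1).
  have -> : a1 i * p false + a2 i * p true =
      cabs (k1 i i * A i i + k2 i i * B i i).
    rewrite k1E k2E /A /B !gram_diag -!rmorphM -rmorphD /= cabs_real ger0_norm //.
    by apply: addr_ge0; apply: mulr_ge0; [exact: ltW|exact: (p0 false)|exact: ltW|exact: (p0 true)].
  have -> : k1 i i * A i i + k2 i i * B i i = t i i - residual A B i i.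
    by rewrite /residual subKr.
  apply: le_trans (cabsD _ _) _; rewrite cabsN; apply: lerD => //; exact: res1.
have t_le : cabs (t i i) <= \sum_i cabs (t i i).
  rewrite (bigD1 i) //= lerDl; apply: sumr_ge0 => k _; exact: cabs_ge0.
set S := \sum_i cabs (t i i) + obj 0 + 1.
have S0 : 0 <= S.
  have := obj_ge0 0; have := cabs_ge0 (t i i); rewrite /S; lra.
have a_le : (a1 i)^-1 + (a2 i)^-1 <= \sum_i ((a1 i)^-1 + (a2 i)^-1).
  rewrite (bigD1 i) //= lerDl; apply: sumr_ge0 => k _.
  by rewrite addr_ge0 // invr_ge0 ltW.
have pc : p b <= S * ((a1 i)^-1 + (a2 i)^-1).
  have i1 : 0 < (a1 i)^-1 by rewrite invr_gt0.
  have i2 : 0 < (a2 i)^-1 by rewrite invr_gt0.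
  have m1 := mulr_ge0 (ltW (a1_gt0 i)) (p0 false).
  have m2 := mulr_ge0 (ltW (a2_gt0 i)) (p0 true).
  rewrite mulrDr; case: b.
    apply: (@le_trans _ _ (S / a2 i)); last by rewrite lerDr mulr_ge0 // ltW.
    by rewrite ler_pdivlMr // mulrC /S; lra.
  apply: (@le_trans _ _ (S / a1 i)); last by rewrite lerDl mulr_ge0 // ltW.
  by rewrite ler_pdivlMr // mulrC /S; lra.
apply: (@le_trans _ _ (p b)).
  by rewrite /p (bigD1 j) //= lerDl; apply: sumr_ge0 => k _; rewrite exprn_ge0 ?cabs_ge0.
by apply: le_trans pc _; rewrite ler_wpM2l.
Qed.

Lemma residual_norm_min : exists G H : 'M[C]_M, forall G' H' : 'M[C]_M,
  residual_norm (G *m G^t*) (H *m H^t*) <= residual_norm (G' *m G'^t*) (H' *m H'^t*).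
Proof.
set b2 := (\sum_i cabs (t i i) + obj 0 + 1) * \sum_i ((a1 i)^-1 + (a2 i)^-1).
pose b := `|b2| + 1.
have b0 : 0 <= b by rewrite addr_ge0.
pose K := [set x : 'rV[R]_n | forall i, `[- b, b]%classic (x ord0 i)].
have K0 : K !=set0.
  by exists 0 => i; rewrite /= mxE in_itv /= oppr_le0 b0.
have cK : compact K.
  exact: (@rV_compact R n (fun=> `[- b, b]%classic) (fun=> @segment_compact R _ _)).
have [x xK xmin] := EVT_min_rV K0 cK (continuous_subspaceT obj_continuous).
exists (mx x false), (mx x true) => G' H'.
have [y [<- <-]] := mx_surj G' H'.
rewrite -/(obj x) -/(obj y).
(* A pair worse than 0 may lie outside the box, but 0 lies in it. *)
have [oy|/ltW oy] := leP (obj y) (obj 0); last first.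
  apply: le_trans (xmin 0 _) oy; rewrite inE => i.
  by rewrite /= mxE in_itv /= oppr_le0 b0.
apply: (xmin y); rewrite inE => k /=; rewrite in_itv /= -ler_norml.
have [[[[c d] i] j] kE] : exists q : idx, enum_rank q = k.
  by exists (enum_val k); rewrite enum_valK.
have bound : cabs (mx y c i j) <= b.
  have h1 := entry_bound oy c i j; have h2 := ler_norm b2.
  rewrite /b.
  exact: sqr_le_bound (le_trans h1 h2) (normr_ge0 _).
apply: le_trans bound; rewrite -kE mxE.
by case: d {kE}; [exact: (Im_le_cabs (entry y c i j))|exact: (Re_le_cabs (entry y c i j))].
Qed.

End Existence.
End ConeProjection.

(** One-sided derivative at a minimum: divide by [s] and let [s] tend to 0. *)
Lemma first_order_condition (R : realType) (p q : R) : 0 <= q ->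
  (forall s, 0 < s <= 1 -> 2 * s * p <= s ^+ 2 * q) -> p <= 0.
Proof.
move=> q0 H; rewrite leNgt; apply/negP => p0.
have q1 : 0 < q + p + 1 by lra.
pose s := p / (q + p + 1).
have s0 : 0 < s by rewrite divr_gt0.
have s1 : s <= 1 by rewrite ler_pdivrMr //; lra.
have sE : s * (q + p + 1) = p by rewrite divfK // gt_eqF.
have := H s; rewrite s0 s1 => /(_ isT).
have -> : 2 * s * p = 2 * s ^+ 2 * (q + p + 1) by rewrite -{1}sE; ring.
have s2 : 0 < s ^+ 2 by rewrite exprn_gt0.
have : 0 < s ^+ 2 * (q + 2 * p + 2) by rewrite mulr_gt0 //; lra.
lra.
Qed.

Section AglerDecomposition.
Variable R : realType.
Notation C := (R[i]%C).
Variables (F : C -> C -> C).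
Hypothesis F1 : forall u, cabs u < 1 -> holomorphic_disk (F u).
Hypothesis F2 : forall u, cabs u < 1 -> holomorphic_disk (F^~ u).
Hypothesis Fb : forall u v, cabs u < 1 -> cabs v < 1 -> cabs (F u v) <= 1.
Variables (M : nat) (l1 l2 : 'I_M -> C).
Hypothesis l1_lt1 : forall i, cabs (l1 i) < 1.
Hypothesis l2_lt1 : forall i, cabs (l2 i) < 1.
Hypothesis F_radial : forall i (e : R), 0 < e -> exists2 d : R, 0 < d &
  forall r : R, 1 - d < r < 1 ->
    cabs (F (r%:C%C * l1 i) (r%:C%C * l2 i) - F (l1 i) (l2 i)) <= e.

Let w i := F (l1 i) (l2 i).

Let conj_mul (z : C) : z * z^* = (cabs z ^+ 2)%:C%C.
Proof. by rewrite -normCK cabsE -rmorphXn. Qed.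

Let defect (l : 'I_M -> C) : 'M[C]_M := \matrix_(i, j) (1 - l i * (l j)^*).

Let defect_herm l i j : defect l j i = (defect l i j)^*.
Proof. by rewrite !mxE rmorphB rmorph1 rmorphM /= conjCK mulrC. Qed.

Let gram_herm (G : 'M[C]_M) : (G *m G^t*)^t* = G *m G^t*.
Proof. by rewrite adjmxM trmxCK. Qed.

Let gram_pos (G : 'M[C]_M) v : 0 <= qform (G *m G^t*) v.
Proof. by rewrite qform_mulmxt sqnorm_ge0. Qed.

Let rank1 (v : 'rV[C]_M) : 'M[C]_M := \matrix_(i, j) (v 0 i * (v 0 j)^*).

Let rank1_herm v : (rank1 v)^t* = rank1 v.
Proof. by apply/matrixP => i j; rewrite !mxE rmorphM /= conjCK mulrC. Qed.

Let rank1_pos v u : 0 <= qform (rank1 v) u.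
Proof.
have -> : qform (rank1 v) u = `|\sum_i u 0 i * v 0 i| ^+ 2.
  rewrite normCK rmorph_sum big_distrlr /= qformE; apply: eq_bigr => i _.
  by apply: eq_bigr => j _; rewrite !mxE rmorphM /=; ring.
by rewrite exprn_ge0.
Qed.

Let qformD (A B : 'M[C]_M) v : qform (A + B) v = qform A v + qform B v.
Proof. by rewrite /qform mulmxDr mulmxDl mxE. Qed.

Let qformZ c (A : 'M[C]_M) v : qform (c *: A) v = c * qform A v.
Proof. by rewrite /qform -scalemxAr -scalemxAl mxE. Qed.

Let scaleE c (X : 'M[C]_M) i j : (c *: X) i j = c * X i j.
Proof. by rewrite mxE. Qed.

Let addZE c (X Y : 'M[C]_M) i j : (X + c *: Y) i j = X i j + c * Y i j.
Proof. by rewrite mxE scaleE. Qed.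

(* [G G^*] and [H H^*] are chosen at minimal distance from the target.  The
   residual, viewed as a hermitian form, is then contractive for multiplication
   by [l1] and by [l2], so [bidisk_form_inequality] forces it to vanish. *)
Theorem agler_decomposition : exists G H : 'M[C]_M, forall i j,
  1 - w i * (w j)^* =
  (1 - l1 i * (l1 j)^*) * (G *m G^t*) i j + (1 - l2 i * (l2 j)^*) * (H *m H^t*) i j.
Proof.
pose k1 := defect l1; pose k2 := defect l2; pose t := defect w.
have lt1_pos (l : 'I_M -> C) : (forall i, cabs (l i) < 1) ->
    forall i, 0 < 1 - cabs (l i) ^+ 2.
  by move=> ll i; rewrite subr_gt0 exprn_ilt1 ?cabs_ge0.
have diagE (l : 'I_M -> C) i : defect l i i = (1 - cabs (l i) ^+ 2)%:C%C.
  by rewrite mxE conj_mul rmorphB.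
have [G [H GHmin]] := residual_norm_min t (lt1_pos _ l1_lt1) (lt1_pos _ l2_lt1)
  (diagE l1) (diagE l2).
set A := G *m G^t* in GHmin; set B := H *m H^t* in GHmin.
pose rho i j := residual k1 k2 t A B i j.
have Ah : A^t* = A := gram_herm G; have Bh : B^t* = B := gram_herm H.
have Apos v : 0 <= qform A v := gram_pos G v.
have Bpos v : 0 <= qform B v := gram_pos H v.
have psd_min A' B' : A'^t* = A' -> B'^t* = B' ->
    (forall v, 0 <= qform A' v) -> (forall v, 0 <= qform B' v) ->
    residual_norm k1 k2 t A B <= residual_norm k1 k2 t A' B'.
  move=> hA hB pA pB.
  have [G' ->] := psd_factor hA pA; have [H' ->] := psd_factor hB pB.
  exact: GHmin.
pose inner (E : 'I_M -> 'I_M -> C) : R := \sum_i \sum_j Re ((rho i j)^* * E i j).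
(* A direction [E] along which the fit may move within the cone makes no acute angle with the
   residual. *)
have pert (E : 'I_M -> 'I_M -> C) :
    (forall s : R, 0 < s <= 1 ->
       residual_norm k1 k2 t A B <= \sum_i \sum_j cabs (rho i j - s%:C%C * E i j) ^+ 2) ->
    inner E <= 0.
  move=> HE; pose NE := \sum_i \sum_j cabs (E i j) ^+ 2.
  have NE0 : 0 <= NE.
    by apply: sumr_ge0 => i _; apply: sumr_ge0 => j _; rewrite exprn_ge0 ?cabs_ge0.
  apply: (first_order_condition NE0) => s s01.
  have := HE s s01.
  have -> : \sum_i \sum_j cabs (rho i j - s%:C%C * E i j) ^+ 2 =
      residual_norm k1 k2 t A B - 2 * s * inner E + s ^+ 2 * NE.
    rewrite /residual_norm /inner /NE !mulr_sumr -sumrB -big_split /=.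
    apply: eq_bigr => i _; rewrite !mulr_sumr -sumrB -big_split /=.
    apply: eq_bigr => j _; rewrite -/(rho i j).
    case: (rho i j) (E i j) => [a b] [c d].
    by rewrite !cabs_sqr /= ; ring.
  by move=> h; rewrite -subr_ge0; move: h; rewrite -subr_ge0; congr (0 <= _); ring.
have herm_scale (s : R) (X : 'M[C]_M) : X^t* = X -> (s%:C%C *: X)^t* = s%:C%C *: X.
  move=> Xh; rewrite -[in RHS]Xh; apply/matrixP => i j; rewrite !mxE rmorphM.
  by congr (_ * _); exact: conjc_real.
have hermD (X Y : 'M[C]_M) : X^t* = X -> Y^t* = Y -> (X + Y)^t* = X + Y.
  by move=> Xh Yh; rewrite linearD map_mxD /= Xh Yh.
have p1 v : inner (fun i j => k1 i j * rank1 v i j) <= 0.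
  apply: pert => s /andP[s0 s1].
  have hA := hermD _ _ Ah (herm_scale s _ (rank1_herm v)).
  have pA u : 0 <= qform (A + s%:C%C *: rank1 v) u.
    rewrite qformD qformZ; apply: addr_ge0; first exact: Apos.
    by apply: mulr_ge0; [rewrite ler0c ltW|exact: rank1_pos].
  have := psd_min _ _ hA Bh pA Bpos.
  have -> : residual_norm k1 k2 t (A + s%:C%C *: rank1 v) B =
      \sum_i \sum_j cabs (rho i j - s%:C%C * (k1 i j * rank1 v i j)) ^+ 2.
    apply: eq_bigr => i _; apply: eq_bigr => j _; congr (cabs _ ^+ 2).
    rewrite /rho /residual addZE; ring.
  exact.
have p2 v : inner (fun i j => k2 i j * rank1 v i j) <= 0.
  apply: pert => s /andP[s0 s1].
  have hB := hermD _ _ Bh (herm_scale s _ (rank1_herm v)).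
  have pB u : 0 <= qform (B + s%:C%C *: rank1 v) u.
    rewrite qformD qformZ; apply: addr_ge0; first exact: Bpos.
    by apply: mulr_ge0; [rewrite ler0c ltW|exact: rank1_pos].
  have := psd_min _ _ Ah hB Apos pB.
  have -> : residual_norm k1 k2 t A (B + s%:C%C *: rank1 v) =
      \sum_i \sum_j cabs (rho i j - s%:C%C * (k2 i j * rank1 v i j)) ^+ 2.
    apply: eq_bigr => i _; apply: eq_bigr => j _; congr (cabs _ ^+ 2).
    rewrite /rho /residual addZE; ring.
  exact.
pose fit i j := k1 i j * A i j + k2 i j * B i j.
(* Scaling both kernels by [1 - s] stays in the cone and moves the fit along [- fit]. *)
have p3 : inner (fun i j => - fit i j) <= 0.
  apply: pert => s /andP[s0 s1].
  have s10 : 0 <= (1 - s)%:C%C :> C by rewrite ler0c subr_ge0.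
  have pA u : 0 <= qform ((1 - s)%:C%C *: A) u.
    by rewrite qformZ; apply: mulr_ge0; [exact: s10|exact: Apos].
  have pB u : 0 <= qform ((1 - s)%:C%C *: B) u.
    by rewrite qformZ; apply: mulr_ge0; [exact: s10|exact: Bpos].
  have := psd_min _ _ (herm_scale _ _ Ah) (herm_scale _ _ Bh) pA pB.
  have -> : residual_norm k1 k2 t ((1 - s)%:C%C *: A) ((1 - s)%:C%C *: B) =
      \sum_i \sum_j cabs (rho i j - s%:C%C * - fit i j) ^+ 2.
    apply: eq_bigr => i _; apply: eq_bigr => j _; congr (cabs _ ^+ 2).
    rewrite /rho /fit /residual !scaleE rmorphB rmorph1; ring.
  exact.
(* With this sign, the loss of the form under multiplication by [l] is [- inner] of a rank-one
   direction of the cone, and its change from the constant vector 1 to the values of [F] is [inner]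
   of the target. *)
pose Q : 'M[C]_M := \matrix_(i, j) - (rho i j)^*.
have hmxE (X : 'M[C]_M) : X^t* = X -> forall i j, X j i = (X i j)^*.
  by move=> Xh i j; rewrite -[in LHS]Xh !mxE.
have rho_herm i j : rho j i = (rho i j)^*.
  rewrite /rho /residual rmorphB rmorphD !rmorphM /=.
  by rewrite -!(hmxE _ Ah) -!(hmxE _ Bh) -!defect_herm.
have Qh : Q^t* = Q.
  by apply/matrixP => i j; rewrite !mxE rmorphN /= conjCK -rho_herm.
have form_le (l : 'I_M -> C) (k : 'M[C]_M) : k = defect l ->
    (forall v, inner (fun i j => k i j * rank1 v i j) <= 0) ->
    forall v : 'rV_M, qform Q (v *m diag_mx (\row_i l i)) <= qform Q v.
  move=> kE pk v; rewrite lecE !hermitian_form_real // eqxx /= -subr_ge0.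
  have -> : Re (qform Q v) - Re (qform Q (v *m diag_mx (\row_i l i))) =
      - inner (fun i j => k i j * rank1 v i j).
    rewrite !qformE !Re_sum -sumrB /inner -sumrN; apply: eq_bigr => i _.
    rewrite !Re_sum -sumrB -sumrN; apply: eq_bigr => j _.
    rewrite -!Re_opp -Re_add; congr (Re _).
    by rewrite !row_mul_diag kE !mxE !rmorphM /=; ring.
  by rewrite oppr_ge0.
have := bidisk_form_inequality F1 F2 Fb l1_lt1 l2_lt1 F_radial Qh
  (form_le _ _ erefl p1) (form_le _ _ erefl p2).
have -> : Re (qform Q (\row_i F (l1 i) (l2 i))) =
    Re (qform Q (const_mx 1)) + inner (fun i j => t i j).
  rewrite !qformE !Re_sum /inner -big_split /=; apply: eq_bigr => i _.
  rewrite !Re_sum -big_split /=; apply: eq_bigr => j _.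
  rewrite -Re_add; congr (Re _); rewrite !mxE -/(w i) -/(w j) rmorph1; ring.
rewrite gerDl => p4.
(* The squared norm of the residual is its pairing with [t - fit]; [p4] and [p3] make both parts
   nonpositive. *)
have rho0 : \sum_i \sum_j cabs (rho i j) ^+ 2 <= 0.
  have -> : \sum_i \sum_j cabs (rho i j) ^+ 2 =
      inner (fun i j => t i j) + inner (fun i j => - fit i j).
    rewrite /inner -big_split /=; apply: eq_bigr => i _.
    rewrite -big_split /=; apply: eq_bigr => j _.
    rewrite -Re_add -mulrDr.
    have -> : t i j + - fit i j = rho i j by [].
    by rewrite mulrC conj_mul.
  by rewrite -[leRHS]addr0; apply: lerD.
exists G, H => i j.
have : cabs (rho i j) ^+ 2 <= 0.
  apply: le_trans rho0; rewrite (bigD1 i) //= (bigD1 j) //= -addrA lerDl addr_ge0 //.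
    by apply: sumr_ge0 => k _; rewrite exprn_ge0 ?cabs_ge0.
  by apply: sumr_ge0 => l _; apply: sumr_ge0 => k _; rewrite exprn_ge0 ?cabs_ge0.
rewrite le_eqVlt ltNge exprn_ge0 ?cabs_ge0 // orbF sqrf_eq0 cabs_eq0 => /eqP.
move=> /eqP; rewrite /rho /residual subr_eq0 => /eqP.
by rewrite !mxE.
Qed.

End AglerDecomposition.

(** * Transfer functions *)

Section TransferFunction.
Variables (C : numClosedFieldType) (M : nat).

Definition block_scale (z1 z2 : C) : 'M[C]_(M + M) :=
  diag_mx (row_mx (const_mx z1) (const_mx z2)).

Lemma block_scale_row z1 z2 (u v : 'rV[C]_M) :
  row_mx u v *m block_scale z1 z2 = row_mx (z1 *: u) (z2 *: v).
Proof.
apply/rowP => i; rewrite mul_mx_diag !mxE.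
by case: splitP => j _; rewrite !mxE mulrC.
Qed.

Lemma block_scale_contract z1 z2 (v : 'rV[C]_(M + M)) :
  `|z1| < 1 -> `|z2| < 1 ->
  sqnorm (v *m block_scale z1 z2) <= sqnorm v /\
  (sqnorm v <= sqnorm (v *m block_scale z1 z2) -> v = 0).
Proof.
move=> n1 n2; rewrite -(hsubmxK v) block_scale_row !sqnorm_row_mx.
have scaleE z (u : 'rV[C]_M) : sqnorm (z *: u) = `|z| ^+ 2 * sqnorm u.
  rewrite /sqnorm mulr_sumr; apply: eq_bigr => i _.
  by rewrite mxE normrM exprMn.
rewrite !scaleE; set p := sqnorm (lsubmx v); set q := sqnorm (rsubmx v).
have p0 : 0 <= p := sqnorm_ge0 _; have q0 : 0 <= q := sqnorm_ge0 _.
have m1 : 0 < 1 - `|z1| ^+ 2 by rewrite subr_gt0 exprn_ilt1.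
have m2 : 0 < 1 - `|z2| ^+ 2 by rewrite subr_gt0 exprn_ilt1.
have E : p + q - (`|z1| ^+ 2 * p + `|z2| ^+ 2 * q) =
    (1 - `|z1| ^+ 2) * p + (1 - `|z2| ^+ 2) * q by ring.
have s1 : 0 <= (1 - `|z1| ^+ 2) * p by rewrite mulr_ge0 // ltW.
have s2 : 0 <= (1 - `|z2| ^+ 2) * q by rewrite mulr_ge0 // ltW.
split; first by rewrite -subr_ge0 E addr_ge0.
rewrite -subr_le0 E => le0.
have : (1 - `|z1| ^+ 2) * p + (1 - `|z2| ^+ 2) * q == 0.
  by rewrite eq_le le0 addr_ge0.
rewrite paddr_eq0 // !mulf_eq0 (gt_eqF m1) (gt_eqF m2) /=.
move=> /andP[/eqP/sqnorm_eq0 -> /eqP/sqnorm_eq0 ->].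
by rewrite row_mx0.
Qed.

Variable X : 'M[C]_(1 + (M + M)).
Hypothesis Xu : X \is unitarymx.

Let A : 'M[C]_1 := ulsubmx X.
Let B : 'M[C]_(1, M + M) := ursubmx X.
Let D' : 'M[C]_(M + M, 1) := dlsubmx X.
Let D : 'M[C]_(M + M) := drsubmx X.

Let XE : X = block_mx A B D' D. Proof. by rewrite submxK. Qed.

Let pencil z1 z2 : 'M[C]_(M + M) := 1%:M - block_scale z1 z2 *m D.

Let action a (v : 'rV[C]_(M + M)) :
  row_mx a v *m X = row_mx (a *m A + v *m D') (a *m B + v *m D).
Proof. by rewrite XE mul_row_block. Qed.

(** Write [Z] for [block_scale z1 z2]. A kernel row satisfies [v = v Z D], so it is part of the
    unitary image of [(0, v Z)] and no longer than [v Z]; strict contraction by [Z] leaves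
    [v = 0]. *)
Let pencil_unit z1 z2 : `|z1| < 1 -> `|z2| < 1 -> pencil z1 z2 \in unitmx.
Proof.
move=> n1 n2; rewrite -row_free_unit -kermx_eq0; apply/eqP/row_matrixP => i.
rewrite row0; set v := row i _.
have : v *m pencil z1 z2 = 0 by rewrite /v -row_mul mulmx_ker row0.
rewrite mulmxBr mulmx1 mulmxA => /eqP; rewrite subr_eq0 => /eqP vE.
apply: (block_scale_contract v n1 n2).2.
set u := v *m block_scale z1 z2 in vE *.
have := sqnorm_unitary (row_mx 0 u) Xu.
rewrite action !mul0mx !add0r !sqnorm_row_mx -vE => H.
have s0 : sqnorm (0 : 'rV[C]_1) = 0.
  by rewrite /sqnorm big1 // => k _; rewrite mxE normr0 expr0n.
by rewrite -[leRHS]add0r -[X in X + _]s0 -H lerDr sqnorm_ge0.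
Qed.

Let state z1 z2 : 'rV[C]_(M + M) := B *m invmx (pencil z1 z2).

(** The feedback loop through [X]: the state solves [x = B + x Z D] with [Z = block_scale z1 z2],
    and the output is [A + x Z D']. *)
Let transfer z1 z2 : C := A 0 0 + (state z1 z2 *m block_scale z1 z2 *m D') 0 0.

Let state_eq z1 z2 : `|z1| < 1 -> `|z2| < 1 ->
  row_mx 1%:M (state z1 z2 *m block_scale z1 z2) *m X =
  row_mx (transfer z1 z2)%:M (state z1 z2).
Proof.
move=> n1 n2; rewrite action !mul1mx; congr row_mx.
  by rewrite [LHS]mx11_scalar /transfer mxE.
have : state z1 z2 *m pencil z1 z2 = B by rewrite mulmxKV // pencil_unit.
rewrite mulmxBr mulmx1 mulmxA => <-.
by rewrite subrK.
Qed.

Let sqnorm11 (a : C) : sqnorm (a%:M : 'rV[C]_1) = `|a| ^+ 2.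
Proof. by rewrite /sqnorm big_ord1 mxE mulr1n. Qed.

Let transfer_energy z1 z2 : `|z1| < 1 -> `|z2| < 1 ->
  `|transfer z1 z2| ^+ 2 + sqnorm (state z1 z2) =
  1 + sqnorm (state z1 z2 *m block_scale z1 z2).
Proof.
move=> n1 n2; have := sqnorm_unitary (row_mx 1%:M (state z1 z2 *m block_scale z1 z2)) Xu.
by rewrite state_eq // !sqnorm_row_mx !sqnorm11 normr1 expr1n.
Qed.

Lemma transfer_solution z1 z2 (a : C) (x : 'rV[C]_(M + M)) :
  `|z1| < 1 -> `|z2| < 1 ->
  row_mx 1%:M (x *m block_scale z1 z2) *m X = row_mx a%:M x -> a = transfer z1 z2.
Proof.
move=> n1 n2; rewrite action !mul1mx => /eq_row_mx [aE xE].
have xB : x *m pencil z1 z2 = B.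
  by rewrite mulmxBr mulmx1 mulmxA -{1}xE addrK.
have xS : x = state z1 z2 by rewrite /state -xB mulmxK // pencil_unit.
have /matrixP/(_ 0 0) := aE; rewrite xS mxE [RHS]mxE mulr1n => <-.
by [].
Qed.

(** Modulus 1 at one point makes the scaled state as long as the state by [transfer_energy], so the
    state is zero, [B = 0] and the function is constant. *)
Lemma transfer_lt1 : (exists z1 z2, [/\ `|z1| < 1, `|z2| < 1 & `|transfer z1 z2| < 1]) ->
  forall z1 z2, `|z1| < 1 -> `|z2| < 1 -> `|transfer z1 z2| < 1.
Proof.
move=> [y1 [y2 [y11 y21 ylt]]] z1 z2 n1 n2.
have energy := transfer_energy n1 n2.
have [c1 c2] := block_scale_contract (state z1 z2) n1 n2.
have le1 : `|transfer z1 z2| ^+ 2 <= 1.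
  by rewrite -(lerD2r (sqnorm (state z1 z2))) energy lerD2l.
have nle1 : `|transfer z1 z2| <= 1.
  by rewrite -(@ler_pXn2r _ 2) ?nnegrE // expr1n.
rewrite lt_neqAle nle1 andbT; apply/negP => /eqP t1.
move: energy; rewrite t1 expr1n => /addrI energy.
have st0 : state z1 z2 = 0 by apply: c2; rewrite energy.
have B0 : B = 0.
  by rewrite -(mulmxKV (pencil_unit n1 n2) B) -/(state z1 z2) st0 mul0mx.
have const u1 u2 : transfer u1 u2 = A 0 0.
  have z0 : (0 : 'M[C]_1) 0 0 = 0 by rewrite mxE.
  by rewrite /transfer /state B0 !mul0mx z0 addr0.
by move: ylt; rewrite const -(const z1 z2) t1 ltxx.
Qed.

Let outer (c : C) : {poly {poly C}} := c%:P%:P.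

Let eval2 z1 z2 : {poly {poly C}} -> C := horner_eval z2 \o horner_eval z1%:P.

Let eval2_outer z1 z2 n m (Z : 'M[C]_(n, m)) :
  map_mx (eval2 z1 z2) (map_mx outer Z) = Z.
Proof.
by apply/matrixP => i j; rewrite !mxE /eval2 /outer /= /horner_eval !hornerC.
Qed.

Let scale_poly : 'M[{poly {poly C}}]_(M + M) :=
  diag_mx (row_mx (const_mx 'X) (const_mx 'X%:P)).

Let eval2_scale z1 z2 : map_mx (eval2 z1 z2) scale_poly = block_scale z1 z2.
Proof.
rewrite map_diag_mx map_row_mx !map_const_mx /eval2 /= /horner_eval.
by rewrite hornerX !hornerC hornerX.
Qed.

Let pencil_poly : 'M[{poly {poly C}}]_(M + M) := 1%:M - scale_poly *m map_mx outer D.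

Let eval2_pencil z1 z2 : map_mx (eval2 z1 z2) pencil_poly = pencil z1 z2.
Proof. by rewrite map_mxB map_mx1 map_mxM eval2_scale eval2_outer. Qed.

(** Cramer's rule for the inverse of the pencil; the outer indeterminate stands for [z1], the inner
    one for [z2]. *)
Lemma transfer_rational : exists n d : {poly {poly C}}, forall z1 z2,
  `|z1| < 1 -> `|z2| < 1 ->
  d.[z1, z2] != 0 /\ transfer z1 z2 = n.[z1, z2] / d.[z1, z2].
Proof.
exists (outer (A 0 0) * \det pencil_poly +
  (map_mx outer B *m \adj pencil_poly *m scale_poly *m map_mx outer D') 0 0).
exists (\det pencil_poly) => z1 z2 n1 n2.
have dE : (\det pencil_poly).[z1, z2] = \det (pencil z1 z2).
  by rewrite -eval2_pencil det_map_mx.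
have d0 : \det (pencil z1 z2) != 0 by rewrite -unitfE -unitmxE pencil_unit.
split; first by rewrite dE.
rewrite hornerD hornerD hornerM hornerM dE !hornerC mulrDl mulfK //.
congr (_ + _).
have E : map_mx (eval2 z1 z2)
    (map_mx outer B *m \adj pencil_poly *m scale_poly *m map_mx outer D') =
    B *m \adj (pencil z1 z2) *m block_scale z1 z2 *m D'.
  by rewrite !map_mxM map_mx_adj eval2_pencil eval2_scale !eval2_outer.
have -> : ((map_mx outer B *m \adj pencil_poly *m scale_poly *m map_mx outer D') 0 0).[z1, z2] =
    (B *m \adj (pencil z1 z2) *m block_scale z1 z2 *m D') 0 0.
  by rewrite -E [RHS]mxE.
rewrite /state /invmx pencil_unit // -scalemxAr -!scalemxAl mxE mulrC.
by [].
Qed.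

Lemma unitary_realization : exists n d : {poly {poly C}},
  [/\ forall z1 z2, `|z1| < 1 -> `|z2| < 1 -> d.[z1, z2] != 0,
      forall z1 z2 a (x : 'rV[C]_(M + M)), `|z1| < 1 -> `|z2| < 1 ->
        row_mx 1%:M (x *m block_scale z1 z2) *m X = row_mx a%:M x ->
        a = n.[z1, z2] / d.[z1, z2] &
      (exists z1 z2, [/\ `|z1| < 1, `|z2| < 1 & `|n.[z1, z2] / d.[z1, z2]| < 1]) ->
        forall z1 z2, `|z1| < 1 -> `|z2| < 1 -> `|n.[z1, z2] / d.[z1, z2]| < 1].
Proof.
have [n [d nd]] := transfer_rational; exists n, d; split.
- by move=> z1 z2 n1 n2; case: (nd z1 z2 n1 n2).
- move=> z1 z2 a x n1 n2 ax; rewrite -(nd z1 z2 n1 n2).2.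
  exact: transfer_solution ax.
- move=> [y1 [y2 [h1 h2 h3]]] z1 z2 n1 n2; rewrite -(nd z1 z2 n1 n2).2.
  apply: transfer_lt1 => //; exists y1, y2; split => //.
  by rewrite (nd y1 y2 h1 h2).2.
Qed.

End TransferFunction.

(** * Symmetrization *)

Section SymmetricPolynomials.
Variable K : comNzRingType.

Let symmetrizable (m : {poly {poly K}}) := exists t : {poly {poly K}},
  forall z1 z2, t.[z1 + z2, z1 * z2] = m.[z1, z2] + m.[z2, z1].

(** Newton's recursion: a power sum is [z1 + z2] times the previous one minus [z1 z2] times the one
    before. *)
Let power_sum k : exists t : {poly {poly K}},
  forall z1 z2, t.[z1 + z2, z1 * z2] = z1 ^+ k + z2 ^+ k.
Proof.
elim/ltn_ind: k => -[|[|k]] IH.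
- exists 2%:R => z1 z2; rewrite !expr0 -polyC_natr hornerC -polyC_natr hornerC.
  by rewrite mulr2n.
- by exists 'X => z1 z2; rewrite hornerX hornerC !expr1.
- have [t1 H1] := IH k.+1 (ltnSn _).
  have [t0 H0] := IH k (leqnSn _).
  exists ('X * t1 - 'X%:P * t0) => z1 z2.
  rewrite hornerD hornerN !hornerM hornerX hornerC hornerD hornerN !hornerM.
  by rewrite hornerX hornerC H1 H0 !exprS; ring.
Qed.

Let symmetrizableD m1 m2 : symmetrizable m1 -> symmetrizable m2 -> symmetrizable (m1 + m2).
Proof.
move=> [t1 H1] [t2 H2]; exists (t1 + t2) => z1 z2.
by rewrite !hornerD H1 H2; ring.
Qed.

Let monomialE (a : K) i j z1 z2 :
  ((a%:P * 'X^j)%:P * 'X^i).[z1, z2] = a * z1 ^+ i * z2 ^+ j.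
Proof.
rewrite hornerM hornerC hornerXn hornerM hornerM hornerC hornerXn.
by rewrite -polyC_exp hornerC mulrAC.
Qed.

(** The lower of the two exponents is taken out as a power of [z1 z2], leaving a power sum. *)
Let symmetrizable_monomial (a : K) i j : symmetrizable ((a%:P * 'X^j)%:P * 'X^i).
Proof.
have [t Ht] := power_sum (maxn i j - minn i j).
exists (a%:P%:P * 'X%:P ^+ minn i j * t) => z1 z2.
rewrite !monomialE !hornerM hornerC hornerC -polyC_exp hornerC hornerXn Ht.
have [ij|ji] := leqP i j.
  by rewrite -{3 4}(subnK ij) !exprD exprMn; ring.
by rewrite -{3 4}(subnK (ltnW ji)) !exprD exprMn; ring.
Qed.

Lemma symmetrized_polynomial (m : {poly {poly K}}) : exists t : {poly {poly K}},
  forall z1 z2, t.[z1 + z2, z1 * z2] = m.[z1, z2] + m.[z2, z1].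
Proof.
have zero : symmetrizable 0 by exists 0 => z1 z2; rewrite !horner0 addr0.
have inner (c : {poly K}) : forall i j, symmetrizable ((c * 'X^j)%:P * 'X^i).
  elim/poly_ind: c => [|c a IH] i j; first by rewrite mul0r polyC0 mul0r.
  have -> : (c * 'X + a%:P) * 'X^j = c * 'X^(j.+1) + a%:P * 'X^j.
    by rewrite mulrDl -mulrA -exprS.
  by rewrite polyCD mulrDl; apply: symmetrizableD.
suff outer : forall i, symmetrizable (m * 'X^i) by have := outer 0%N; rewrite mulr1.
elim/poly_ind: m => [|m c IH] i; first by rewrite mul0r.
rewrite mulrDl -mulrA -exprS; apply: symmetrizableD => //.
by have := inner c i 0%N; rewrite mulr1.
Qed.

End SymmetricPolynomials.

Section RationalInterpolation.
Variable R : realType.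
Notation C := (R[i]%C).
Variables (F : C -> C -> C).
Hypothesis F1 : forall u, cabs u < 1 -> holomorphic_disk (F u).
Hypothesis F2 : forall u, cabs u < 1 -> holomorphic_disk (F^~ u).
Hypothesis Fb : forall u v, cabs u < 1 -> cabs v < 1 -> cabs (F u v) < 1.

Theorem rational_interpolation M (l1 l2 : 'I_M.+1 -> C) :
  (forall i, cabs (l1 i) < 1) -> (forall i, cabs (l2 i) < 1) ->
  (forall i (e : R), 0 < e -> exists2 d : R, 0 < d &
    forall r : R, 1 - d < r < 1 ->
      cabs (F (r%:C%C * l1 i) (r%:C%C * l2 i) - F (l1 i) (l2 i)) <= e) ->
  exists n d : {poly {poly C}},
    [/\ forall z1 z2, `|z1| < 1 -> `|z2| < 1 -> d.[z1, z2] != 0,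
        forall z1 z2, `|z1| < 1 -> `|z2| < 1 -> `|n.[z1, z2] / d.[z1, z2]| < 1 &
        forall i, F (l1 i) (l2 i) = n.[l1 i, l2 i] / d.[l1 i, l2 i]].
Proof.
move=> l1_lt1 l2_lt1 F_radial.
have Fb' u v : cabs u < 1 -> cabs v < 1 -> cabs (F u v) <= 1.
  by move=> hu hv; exact/ltW/Fb.
have [G [H GH]] := agler_decomposition F1 F2 Fb' l1_lt1 l2_lt1 F_radial.
pose w i := F (l1 i) (l2 i).
(* With its negative terms moved across, the Agler decomposition equates the Gram matrices of the
   rows [(1, l1 G, l2 H)] and [(w, G, H)]. *)
pose P : 'M[C]_(M.+1, 1 + (M.+1 + M.+1)) := row_mx (const_mx 1)
  (row_mx (diag_mx (\row_i l1 i) *m G) (diag_mx (\row_i l2 i) *m H)).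
pose S : 'M[C]_(M.+1, 1 + (M.+1 + M.+1)) := row_mx (\col_i w i) (row_mx G H).
have PS : P *m P^t* = S *m S^t*.
  rewrite /P /S !tr_row_mx !map_col_mx !mul_row_col.
  apply/matrixP => i j.
  have addE n m (A B : 'M[C]_(n, m)) k l : (A + B) k l = A k l + B k l by rewrite mxE.
  have outerE (u v : 'cV[C]_M.+1) : (u *m v^t*) i j = u i 0 * (v j 0)^*.
    by rewrite mxE big_ord1 !mxE.
  rewrite !addE !outerE !adjmxM !mulmxA.
  have dE (l : 'I_M.+1 -> C) (Z : 'M[C]_M.+1) :
      (diag_mx (\row_i l i) *m Z *m Z^t* *m (diag_mx (\row_i l i))^t*) i j =
      (l i * (l j)^*) * (Z *m Z^t*) i j.
    rewrite -(mulmxA _ Z) tr_diag_mx map_diag_mx mul_mx_diag mul_diag_mx !mxE.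
    by rewrite mulrAC.
  have balance (a b g h x : C) : 1 - x = (1 - a) * g + (1 - b) * h ->
      1 + (a * g + b * h) = x + (g + h).
    move=> E; have -> : x = 1 - (1 - x) by rewrite subKr.
    by rewrite E; ring.
  rewrite !dE [in LHS]mxE [const_mx _ j 0]mxE rmorph1 mulr1 ![(\col_i _) _ 0]mxE.
  exact: balance (GH i j).
have [X Xu PX] := gram_unitary PS.
have [n [d [nd0 ndE ndlt]]] := unitary_realization Xu.
have n1 i : `|l1 i| < 1 by rewrite cabs_lt1.
have n2 i : `|l2 i| < 1 by rewrite cabs_lt1.
have val i : w i = n.[l1 i, l2 i] / d.[l1 i, l2 i].
  apply: (ndE _ _ _ (row i (row_mx G H))) => //.
  have := congr1 (row i) PX; rewrite row_mul /P /S !row_row_mx block_scale_row.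
  have -> : row i (const_mx 1 : 'cV[C]_M.+1) = 1%:M.
    by apply/matrixP => a b; rewrite !mxE !ord1.
  have -> : row i (\col_i w i) = (w i)%:M.
    by apply/matrixP => a b; rewrite !mxE !ord1 mulr1n.
  have rowE' (l : 'I_M.+1 -> C) Z :
      row i (diag_mx (\row_i l i) *m Z) = l i *: row i Z.
    by apply/rowP => k; rewrite mxE mul_diag_mx !mxE.
  by rewrite !rowE'.
exists n, d; split => //.
(* The index type ['I_M.+1] provides a node, where the value of [F] has modulus less than 1. *)
apply: ndlt; exists (l1 ord0), (l2 ord0); split => //.
by rewrite -val cabs_lt1; apply: Fb.
Qed.

End RationalInterpolation.

(** * Descent to the symmetrized bidisk *)

Section RationalSolutions.
Variable R : realType.
Notation C := (R[i]%C).
Implicit Types p : {poly {poly C}}.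

Lemma differentiable_horner2 p (z : CC2 R) :
  differentiable (fun z : CC2 R => p.[z.1, z.2] : CC R) z.
Proof.
have d1 : differentiable (fun z : CC2 R => z.1 : CC R) z.
  apply: (@linear_differentiable (CC R) (CC2 R) (CC R) (@fst (CC R) (CC R))).
  by move=> y; exact: cvg_fst.
have d2 : differentiable (fun z : CC2 R => z.2 : CC R) z.
  apply: (@linear_differentiable (CC R) (CC2 R) (CC R) (@snd (CC R) (CC R))).
  by move=> y; exact: cvg_snd.
have inner (c : {poly C}) : differentiable (fun z : CC2 R => c.[z.2] : CC R) z.
  elim/poly_ind: c => [|c a IH].
    rewrite (_ : (fun _ => _) = cst 0); last by apply/funext => y; rewrite horner0.
    exact: differentiable_cst.
  rewrite (_ : (fun _ => _) = (fun z : CC2 R => c.[z.2] : CC R) * (fun z => z.2) + cst a).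
    by apply: differentiableD; [exact: differentiableM|exact: differentiable_cst].
  by apply/funext => y; rewrite hornerMXaddC.
elim/poly_ind: p => [|p c IH].
  rewrite (_ : (fun _ => _) = cst 0); last by apply/funext => y; rewrite !horner0.
  exact: differentiable_cst.
rewrite (_ : (fun _ => _) = (fun z : CC2 R => p.[z.1, z.2] : CC R) * (fun z => z.1)
   + (fun z => c.[z.2])).
  by apply: differentiableD; [exact: (@differentiableM (CC R) (CC2 R))|exact: inner].
by apply/funext => y; rewrite hornerMXaddC hornerD hornerM hornerC.
Qed.

Let G := symmetrized_bidisk R.

Lemma rational_analytic (a b : {poly {poly C}}) :
  (forall z, G z -> b.[z.1, z.2] != 0) ->
  analytic_on G (fun z => a.[z.1, z.2] / b.[z.1, z.2]).
Proof.
move=> b0 z Gz.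
apply: (@differentiableM (CC R) (CC2 R) (fun z => a.[z.1, z.2]) (fun z => b.[z.1, z.2]^-1)).
  exact: differentiable_horner2.
by apply: (@differentiableV (CC R) (CC2 R)); [exact: differentiable_horner2|exact: b0].
Qed.

Variable f : CC2 R -> CC R.
Hypothesis f_analytic : analytic_on G f.
Hypothesis f_lt1 : forall z, G z -> disk R (f z).

Let F (u v : C) : C := f (u + v, u * v).

Let G_mem (u v : C) : cabs u < 1 -> cabs v < 1 -> G (u + v, u * v).
Proof. by move=> hu hv; exists u, v; split => //; rewrite /disk /= cabs_lt1. Qed.

Let FC u v : F u v = F v u.
Proof. by rewrite /F addrC mulrC. Qed.

Let F_hol (u : C) : cabs u < 1 -> holomorphic_disk (F u).
Proof.
move=> hu v hv; apply: (@differentiable_comp (CC R) (CC R) (CC2 R) (CC R)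
  (fun v : CC R => ((u : CC R) + v, (u : CC R) * v) : CC2 R) f v).
  apply: differentiable_pair.
    by apply: (@differentiableD _ _ _ (cst (u : CC R)) id); first exact: differentiable_cst.
  by apply: (@differentiableM _ _ (cst (u : CC R)) id); first exact: differentiable_cst.
exact/f_analytic/G_mem.
Qed.

Let F_radial (u v : C) (e : R) : cabs u < 1 -> cabs v < 1 -> 0 < e ->
  exists2 d : R, 0 < d & forall r : R, 1 - d < r < 1 ->
    cabs (F (r%:C%C * u) (r%:C%C * v) - F u v) <= e.
Proof.
move=> hu hv e0.
have fc : {for ((u + v, u * v) : CC2 R), continuous f}.
  exact/differentiable_continuous/f_analytic/G_mem.
have e0' : 0 < (e%:C%C : CC R) by rewrite ltcR.
have /cvgrPdist_le/(_ _ e0')/nbhs_ballP [d' /= d'0 dH] := fc.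
have [d d0 dE] := gtc0_real d'0.
(* Both coordinates [u + v] and [u v] move by at most [2 (1 - r)]; the 1 keeps [r] positive. *)
exists (Num.min 1 (d / 2)); first by rewrite lt_min ltr01 divr_gt0.
move=> r /andP[r1 r2]; rewrite -normc_le -normrN opprB.
have r0 : 0 < r by move: r1; rewrite ltrBlDr -ltrBlDl lt_min => /andP[]; lra.
have rd : 1 - r < d / 2 by move: r1; rewrite ltrBlDr -ltrBlDl lt_min => /andP[_]; lra.
have twice : (1 - r) * 2 < d by rewrite -ltr_pdivlMr.
apply: dH; split; rewrite -ball_normE /= dE cabsE ltcR.
- have -> : u + v - (r%:C%C * u + r%:C%C * v) = (1 - r)%:C%C * (u + v).
    by rewrite rmorphB rmorph1; ring.
  rewrite cabsM cabs_real ger0_norm; last by rewrite subr_ge0 ltW.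
  apply: (@le_lt_trans _ _ ((1 - r) * 2)); last exact: twice.
  apply: ler_wpM2l; first by rewrite subr_ge0 ltW.
  by apply: le_trans (cabsD _ _) _; rewrite -[2]/(1 + 1) lerD ?ltW.
- have -> : u * v - r%:C%C * u * (r%:C%C * v) = ((1 - r) * (1 + r))%:C%C * (u * v).
    by rewrite rmorphM rmorphB rmorphD rmorph1; ring.
  rewrite cabsM cabs_real ger0_norm; last by rewrite mulr_ge0 ?subr_ge0 ?addr_ge0 ?ltW.
  apply: (@le_lt_trans _ _ ((1 - r) * 2)); last exact: twice.
  rewrite -mulrA; apply: ler_wpM2l; first by rewrite subr_ge0 ltW.
  rewrite -[leRHS]mulr1; apply: ler_pM; rewrite ?cabs_ge0 ?addr_ge0 ?ltW //.
    by rewrite -[2]/(1 + 1) ltrD2l.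
  by rewrite cabsM -[1]mulr1 ltr_pM ?cabs_ge0.
Qed.

(* Interpolating at both orderings of each pair of roots lets the rational interpolant on the
   bidisk be averaged over the swap of its variables without losing its values. *)
Theorem rational_interpolation_symmetrized M (L : 'I_M.+1 -> CC2 R) :
  (forall i, G (L i)) ->
  exists a b : {poly {poly C}},
    [/\ forall z, G z -> b.[z.1, z.2] != 0,
        forall z, G z -> disk R (a.[z.1, z.2] / b.[z.1, z.2]) &
        forall i, f (L i) = a.[(L i).1, (L i).2] / b.[(L i).1, (L i).2]].
Proof.
move=> GL.
have /choice [x xP] : forall i, exists x : CC2 R,
    [/\ cabs x.1 < 1, cabs x.2 < 1 & L i = (x.1 + x.2, x.1 * x.2)].
  move=> i; have [x1 [x2 [h1 h2 E]]] := GL i; exists (x1, x2).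
  by split => //; rewrite -cabs_lt1.
pose l1 (k : 'I_(M.+1 + M.+1)) : C :=
  match fintype.split k with inl i => (x i).1 | inr i => (x i).2 end.
pose l2 (k : 'I_(M.+1 + M.+1)) : C :=
  match fintype.split k with inl i => (x i).2 | inr i => (x i).1 end.
have h1 k : cabs (l1 k) < 1.
  by rewrite /l1; case: (fintype.split k) => i; have [] := xP i.
have h2 k : cabs (l2 k) < 1.
  by rewrite /l2; case: (fintype.split k) => i; have [] := xP i.
have F_hol' u : cabs u < 1 -> holomorphic_disk (F^~ u).
  move=> hu; rewrite (_ : F^~ u = F u); first exact: F_hol.
  by apply/funext => v; rewrite FC.
have F_lt1 u v : cabs u < 1 -> cabs v < 1 -> cabs (F u v) < 1.
  by move=> hu hv; rewrite -cabs_lt1; apply/f_lt1/G_mem.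
have [n [d [d0 nd_lt1 ndE]]] := rational_interpolation F_hol F_hol' F_lt1 h1 h2
  (fun k e => F_radial (h1 k) (h2 k)).
(* The quotient of the two symmetrized polynomials is the average of [n / d] and its swap, which
   stays in the disk by convexity. *)
have [b bE] := symmetrized_polynomial (2^-1%:P%:P * (d * swapXY d)).
have [a aE] := symmetrized_polynomial (2^-1%:P%:P * (n * swapXY d)).
have bE' z1 z2 : b.[z1 + z2, z1 * z2] = d.[z1, z2] * d.[z2, z1].
  by rewrite bE !hornerM !hornerC !horner2_swapXY; field.
have aE' z1 z2 : a.[z1 + z2, z1 * z2] =
    (n.[z1, z2] * d.[z2, z1] + n.[z2, z1] * d.[z1, z2]) / 2.
  by rewrite aE !hornerM !hornerC !horner2_swapXY; field.
have abE z1 z2 : `|z1| < 1 -> `|z2| < 1 ->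
    a.[z1 + z2, z1 * z2] / b.[z1 + z2, z1 * z2] =
    (n.[z1, z2] / d.[z1, z2] + n.[z2, z1] / d.[z2, z1]) / 2.
  move=> z1_lt1 z2_lt1; rewrite aE' bE'.
  by field; rewrite !d0.
exists a, b; split.
- by move=> _ [z1 [z2 [z1_lt1 z2_lt1 ->]]] /=; rewrite bE' mulf_neq0 ?d0.
- move=> _ [z1 [z2 [z1_lt1 z2_lt1 ->]]] /=; rewrite /disk /= abE //.
  rewrite normrM normfV normr_nat ltr_pdivrMr ?ltr0n // mul1r.
  apply: le_lt_trans (ler_normD _ _) _.
  by rewrite -[2]/(1 + 1) ltrD ?nd_lt1.
- move=> i; have [x1 x2 ->] := xP i; rewrite /= abE ?cabs_lt1 //.
  have := ndE (@lshift M.+1 M.+1 i); have := ndE (@rshift M.+1 M.+1 i).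
  rewrite /l1 /l2 (unsplitK (inl i)) (unsplitK (inr i)) => <- <-.
  by rewrite [F (x i).2 _]FC /F; field.
Qed.

End RationalSolutions.

Theorem mainTheorem6 (R : realType) (N : nat)
    (lambda : 'I_N -> CC2 R) (w : 'I_N -> CC R) (S : set (CC2 R)) :
  pick_problem lambda w ->
  pick_solvable lambda w ->
  is_uniqueness_set lambda w S ->
  exists W : set (CC2 R),
    algebraic_variety W /\ S = symmetrized_bidisk R `&` W.
Proof.
move=> [_ lambdaG _] _ /uniqueness_setP SE.
pose P : set {poly {poly R[i]%C}} := [set p | forall z, S z -> p.[z.1, z.2] = 0].
exists [set z | forall p, P p -> p.[z.1, z.2] = 0]; split; first by exists P.
apply/seteqP; split=> [z Sz|z0 [Gz0 Wz0]].
  by split; [move: Sz; rewrite SE => -[]|move=> p; exact].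
rewrite SE; split => // f g fsol gsol.
(* [z0] is put in front as node [ord0]; this also makes the family nonempty when [N = 0]. *)
pose L (i : 'I_N.+1) := if unlift ord0 i is Some j then lambda j else z0.
have GL i : symmetrized_bidisk R (L i) by rewrite /L; case: unliftP.
have rational h : pick_solution lambda w h -> exists a b : {poly {poly R[i]%C}},
    [/\ forall z, symmetrized_bidisk R z -> b.[z.1, z.2] != 0,
        pick_solution lambda w (fun z => a.[z.1, z.2] / b.[z.1, z.2]) &
        h z0 = a.[z0.1, z0.2] / b.[z0.1, z0.2]].
  move=> [h_analytic h_lt1 hw].
  have [a [b [b0 ab_lt1 abE]]] := rational_interpolation_symmetrized h_analytic h_lt1 GL.
  exists a, b; split => //; last by have := abE ord0; rewrite /L unlift_none.
  split; [exact: rational_analytic|by []|move=> j].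
  by have := abE (lift ord0 j); rewrite /L liftK hw.
have [a1 [b1 [b10 sol1 ->]]] := rational f fsol.
have [a2 [b2 [b20 sol2 ->]]] := rational g gsol.
have /Wz0 : P (a1 * b2 - a2 * b1).
  move=> z; rewrite SE => -[Gz agree]; rewrite !hornerE.
  have /eqP := agree _ _ sol1 sol2.
  by rewrite eqr_div ?b10 ?b20 // => /eqP ->; rewrite subrr.
rewrite !hornerE => /eqP; rewrite subr_eq0 => E.
by apply/eqP; rewrite eqr_div ?b10 ?b20.
Qed.
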